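(* For $N=n+1$, it holds $$\ln(16N)+\gamma+\sum_{k=1}^{p}\frac{\alpha_k}{N^k}<\pi G_n<\ln(16N)+\gamma+\sum_{k=1}^{q}\frac{\alpha_k}{N^k}$$ for all $n=0,1,2,\dots$, and for all $p=4s+1,\ 4s+2$ and all $q=4m,\ 4m+3$, with $s=0,1,2,\dots$ and $m=0,1,2,\dots$.
   Context: The Landau constants are $G_0=1$ and $G_n=1+\left(\frac12\right)^2+\left(\frac{1\cdot 3}{2\cdot 4}\right)^2+\cdots+\left(\frac{1\cdot3\cdots(2n-1)}{2\cdot4\cdots(2n)}\right)^2$ for $n=1,2,\dots$. Write $N=n+1$, and let $\gamma=0.577215\ldots$ be Euler's constant. It is known that there are (unique) real constants $\alpha_1,\alpha_2,\dots$ such that, as $n\to\infty$, $\pi G_n\sim \ln(16N)+\gamma+\sum_{k=1}^\infty\frac{\alpha_k}{N^k}$; that is, for every integer $m\ge 0$, $\pi G_n=\ln(16N)+\gamma+\sum_{k=1}^m\frac{\alpha_k}{N^k}+O(N^{-m-1})$ as $n\to\infty$. Empty sums are zero. *)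

(* Defs.v *)
From Stdlib Require Import Reals.
From Coquelicot Require Import Coquelicot.
Open Scope R_scope.

(** [central_ratio k] is (1·3···(2k-1)) / (2·4···(2k)), with value 1 at k = 0. *)
Fixpoint central_ratio (k : nat) : R :=
  match k with
  | O => 1
  | S j => central_ratio j * (INR (2 * j + 1) / INR (2 * j + 2))
  end.

Definition landau_G (n : nat) : R :=
  sum_n_m (fun k => central_ratio k ^ 2) 0 n.

(** The term of index 0 involves the junk value [ln 0]; it does not affect the
    limit. *)
Definition euler_gamma : R :=
  real (Lim_seq (fun n => sum_n_m (fun k => / INR k) 1 n - ln (INR n))).

(** ln(16N) + γ + Σ_{k=1}^m α_k / N^k with N = n + 1.  [sum_n_m _ 1 0] is the
    empty sum, and [alpha 0] is never used. *)
Definition landau_partial (alpha : nat -> R) (m n : nat) : R :=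
  ln (16 * INR (n + 1)) + euler_gamma
  + sum_n_m (fun k => alpha k / INR (n + 1) ^ k) 1 m.

(** For each order m, the remainder is O(N^{-m-1}) as n tends to infinity; the
    implied constant may depend on m. *)
Definition landau_expansion (alpha : nat -> R) : Prop :=
  forall m : nat, exists C : R,
    eventually (fun n : nat =>
      Rabs (PI * landau_G n - landau_partial alpha m n)
      <= C * / INR (n + 1) ^ (m + 1)).

(* Main.v *)
Require Import Defs.
From Stdlib Require Import Reals Factorial Lra Lia Psatz.
From Coquelicot Require Import Coquelicot.
Open Scope R_scope.

(* Put X = 2N and f(N) = pi G_{N-1} - ln(16N) - gamma. Up to a positive factor, f(N) equals
     int_0^oo  y / sinh(pi y) * (g(y) - X a(y)) / (X^2 + y^2) dy      with 0 <= g < a.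
   Expanding 1 / (X^2 + y^2) into a finite geometric series yields the expansion of f in
   powers of 1/N, together with remainders of known sign: with the factor (-1)^J, the density
   that remains is y^(2J) (g - X a) < 0 after 2J terms and y^(2J) (g + y^2 a / X) > 0 after
   2J + 1 terms.

   With n = 2j + 1, the functions a and g are the superpositions with weights
   (central_ratio j)^2 of
     sum_k 1 / ((n+k)^2 + y^2)   and
     sum_k (-1)^k (n+k) / ((n+k)^2 + y^2) - exp(-pi y) sum_k (-1)^k / (n+k).
   The representation follows from f(N) - f(N+1) = ln(1 + 1/N) - pi (central_ratio N)^2. The
   partial fractions of csch and coth turn the integral attached to n into alternating
   harmonic sums; its difference in N is a logarithm minus a kernel k(n, 2N+1). Summed
   against (central_ratio j)^2, the kernel satisfies the two-term recurrence of
   (central_ratio N)^2, because the defect telescopes in j. *)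

(** The bounds [0 <= g < a] replace any estimate of a remainder: at every order the remaining
    density has one sign on the whole half-line, and the period 4 in p and q is the product of
    [(-1)^J] with the alternation between the two densities. Of these bounds, [g < a] holds term by
    term, while [0 <= g] is delicate: at each level g is a difference whose two parts agree as y
    tends to 0 and of which, for large y, one is of order [1 / y^2] and the other exponentially
    small. Small and large y therefore need different arguments. The factor exp(-pi y) in g is the
    source of the logarithm: [exp(-t) / sinh t = coth t - 1], where coth contributes rational terms
    and -1 contributes the logarithm. Neither the positive factor nor the constants ln 16 and gamma
    are evaluated. The expansion of order 0 says that f(N) tends to 0, and so does the integral, so
    that only increments have to be compared. The ratio of the two parts of the increment is then
    forced, since with any other ratio G would converge. *)

(** * Integrals over the half-line *)

(* Coquelicot's lemmas leave equalities in a packed carrier, which [ring] and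
   [field] do not recognise as [R]. *)
Ltac real_eq := match goal with |- ?a = ?b => change (@eq R a b) end.

Lemma sum_n_S (a : nat -> R) (n : nat) : sum_n a (S n) = sum_n a n + a (S n).
Proof. exact (sum_Sn a n). Qed.

(** Nothing is required at 0, where the integrands below take default values of [0 / 0]. The
    majorant has the primitive [C * atan], and the explicit constant [C] lets a series of functions
    be dominated by a series of constants. *)
Definition admissible (C : R) (f : R -> R) : Prop :=
  (forall y, 0 < y -> continuous f y) /\
  (forall y, 0 < y -> Rabs (f y) <= C / (1 + y ^ 2)).

(** Both endpoints move, so that the value of [f] at 0 never enters. *)
Definition cut (f : R -> R) (n : nat) : R := RInt f (/ INR (S n)) (INR (S n)).

Definition halfline_int (f : R -> R) : R := real (Lim_seq (cut f)).

Lemma INR_S_pos (n : nat) : 0 < INR (S n).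
Proof. apply lt_0_INR; lia. Qed.

Lemma INR_S_ge1 (n : nat) : 1 <= INR (S n).
Proof. rewrite S_INR; pose proof (pos_INR n); lra. Qed.

Lemma cut_endpoints (n : nat) : / INR (S n) <= INR (S n).
Proof.
pose proof (INR_S_ge1 n).
apply Rle_trans with 1; auto.
rewrite <- Rinv_1; apply Rinv_le_contravar; lra.
Qed.

Lemma ex_RInt_positive (f : R -> R) (a b : R) :
  (forall y, 0 < y -> continuous f y) -> 0 < a -> 0 < b -> ex_RInt f a b.
Proof.
intros Hf Ha Hb; apply (ex_RInt_continuous (V := R_CompleteNormedModule)).
intros z [Hz _]; apply Hf; apply Rlt_le_trans with (2 := Hz).
now apply Rmin_glb_lt.
Qed.

Lemma is_RInt_weight (C a b : R) :
  is_RInt (fun y => C / (1 + y ^ 2)) a b (C * (atan b - atan a)).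
Proof.
replace (C * (atan b - atan a)) with (minus (C * atan b) (C * atan a))
  by (unfold minus, plus, opp; simpl; ring).
apply (is_RInt_derive (V := R_CompleteNormedModule) (fun y => C * atan y)
  (fun y => C / (1 + y ^ 2))).
- intros x _.
  replace (C / (1 + x ^ 2)) with (C * (/ (1 + x²))) by (unfold Rdiv, Rsqr; do 2 f_equal; ring).
  apply is_derive_scal, is_derive_atan.
- intros x _; apply (ex_derive_continuous (K := R_AbsRing) (V := R_NormedModule)).
  auto_derive; nra.
Qed.

Lemma admissible_RInt_bound (C : R) (f : R -> R) (a b : R) :
  admissible C f -> 0 < a -> a <= b -> Rabs (RInt f a b) <= C * (atan b - atan a).
Proof.
intros [Hc Hd] Ha Hab.
apply Rle_trans with (RInt (fun t => Rabs (f t)) a b).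
- apply abs_RInt_le; auto; apply ex_RInt_positive; auto; lra.
- rewrite <- (is_RInt_unique _ _ _ _ (is_RInt_weight C a b)).
  apply RInt_le; auto.
  + apply ex_RInt_positive; try lra.
    intros y Hy; apply (continuous_comp f Rabs); auto.
    apply continuous_Rabs.
  + eexists; apply is_RInt_weight.
  + intros x Hx; apply Hd; lra.
Qed.

Lemma cut_diff_bound (C : R) (f : R -> R) (m n : nat) :
  admissible C f -> (n <= m)%nat ->
  Rabs (cut f m - cut f n) <=
  C * ((atan (INR (S m)) - atan (/ INR (S m))) - (atan (INR (S n)) - atan (/ INR (S n)))).
Proof.
intros Hf Hnm; pose proof (proj1 Hf) as Hc.
pose proof (INR_S_pos m) as Hm; pose proof (INR_S_pos n) as Hn.
assert (Hle : INR (S n) <= INR (S m)) by (apply le_INR; lia).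
assert (Hle' : / INR (S m) <= / INR (S n)) by (apply Rinv_le_contravar; auto).
pose proof (Rinv_0_lt_compat _ Hm) as Hm'; pose proof (Rinv_0_lt_compat _ Hn) as Hn'.
assert (E : cut f m = RInt f (/ INR (S m)) (/ INR (S n)) + cut f n + RInt f (INR (S n)) (INR (S m))).
{ unfold cut.
  rewrite <- (RInt_Chasles (V := R_CompleteNormedModule) f (/ INR (S m)) (/ INR (S n)) (INR (S m)));
    [|apply ex_RInt_positive; auto ..].
  rewrite <- (RInt_Chasles (V := R_CompleteNormedModule) f (/ INR (S n)) (INR (S n)) (INR (S m)));
    [|apply ex_RInt_positive; auto ..].
  unfold plus; simpl; ring. }
rewrite E.
replace (_ + cut f n + _ - cut f n) with
  (RInt f (/ INR (S m)) (/ INR (S n)) + RInt f (INR (S n)) (INR (S m))) by ring.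
apply Rle_trans with (1 := Rabs_triang _ _).
pose proof (admissible_RInt_bound C f _ _ Hf Hm' Hle').
pose proof (admissible_RInt_bound C f _ _ Hf Hn Hle).
lra.
Qed.

(** The increments of [cut f] are dominated by those of the sequence [v] of integrals of the
    majorant, which is nondecreasing and bounded, hence Cauchy. *)
Lemma halfline_int_lim (C : R) (f : R -> R) :
  admissible C f -> is_lim_seq (cut f) (halfline_int f).
Proof.
intros Hf; unfold halfline_int; apply Lim_seq_correct'.
apply ex_lim_seq_cauchy_corr.
set (v := fun n => C * (atan (INR (S n)) - atan (/ INR (S n)))).
assert (Hinc : forall n m, (n <= m)%nat -> Rabs (cut f m - cut f n) <= v m - v n).
{ intros n m Hnm; pose proof (cut_diff_bound C f m n Hf Hnm); unfold v; lra. }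
assert (Hv : ex_finite_lim_seq v).
{ apply ex_finite_lim_seq_incr with (Rabs C * 4).
  - intros n; pose proof (Hinc n (S n) ltac:(lia)) as H.
    pose proof (Rabs_pos (cut f (S n) - cut f n)); lra.
  - intros n; unfold v.
    pose proof (atan_bound (INR (S n))); pose proof (atan_bound (/ INR (S n))).
    pose proof PI_4.
    apply Rle_trans with (1 := Rle_abs _).
    rewrite Rabs_mult; apply Rmult_le_compat_l; [apply Rabs_pos|].
    apply Rabs_le; lra. }
apply ex_lim_seq_cauchy_corr in Hv.
intros eps; destruct (Hv eps) as [N HN]; exists N; intros n m Hn Hm.
destruct (Nat.le_ge_cases n m) as [H|H].
- rewrite Rabs_minus_sym.
  apply Rle_lt_trans with (1 := Hinc n m H).
  apply Rle_lt_trans with (1 := Rle_abs _); auto.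
- apply Rle_lt_trans with (1 := Hinc m n H).
  apply Rle_lt_trans with (1 := Rle_abs _); auto.
Qed.

Lemma halfline_int_unique (f : R -> R) (l : R) :
  is_lim_seq (cut f) l -> halfline_int f = l.
Proof. intros H; unfold halfline_int; now rewrite (is_lim_seq_unique _ _ H). Qed.

Lemma cut_ext (f g : R -> R) (n : nat) :
  (forall y, 0 < y -> f y = g y) -> cut f n = cut g n.
Proof.
intros H; apply (RInt_ext (V := R_CompleteNormedModule)); intros x [Hx _]; apply H.
apply Rle_lt_trans with (2 := Hx).
pose proof (INR_S_pos n).
apply Rmin_glb; auto with real.
Qed.

Lemma halfline_int_ext (f g : R -> R) :
  (forall y, 0 < y -> f y = g y) -> halfline_int f = halfline_int g.
Proof.
intros H; unfold halfline_int; f_equal; apply Lim_seq_ext; intros n; now apply cut_ext.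
Qed.

Lemma continuous_positive_ext (f g : R -> R) :
  (forall y, 0 < y -> f y = g y) -> (forall y, 0 < y -> continuous f y) ->
  forall y, 0 < y -> continuous g y.
Proof.
intros H Hf y Hy; apply (continuous_ext_loc g f); auto.
exists (mkposreal y Hy); intros z Hz; apply H.
unfold ball in Hz; simpl in Hz; unfold AbsRing_ball, abs, minus, plus, opp in Hz; simpl in Hz.
apply Rabs_def2 in Hz; lra.
Qed.

Lemma admissible_ext (C : R) (f g : R -> R) :
  (forall y, 0 < y -> f y = g y) -> admissible C f -> admissible C g.
Proof.
intros H [Hc Hd]; split.
- now apply continuous_positive_ext with f.
- intros y Hy; rewrite <- H; auto.
Qed.

Lemma admissible_le (C C' : R) (f : R -> R) : C <= C' -> admissible C f -> admissible C' f.
Proof.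
intros H [Hc Hd]; split; auto; intros y Hy.
apply Rle_trans with (1 := Hd y Hy); apply Rmult_le_compat_r; auto.
apply Rlt_le, Rinv_0_lt_compat; nra.
Qed.

Lemma admissible_plus (C D : R) (f g : R -> R) :
  admissible C f -> admissible D g -> admissible (C + D) (fun y => f y + g y).
Proof.
intros [Hc Hd] [Hc' Hd']; split; intros y Hy.
- apply (continuous_plus (V := R_NormedModule) f g); auto.
- apply Rle_trans with (1 := Rabs_triang _ _); unfold Rdiv; rewrite Rmult_plus_distr_r.
  apply Rplus_le_compat; [apply Hd | apply Hd']; auto.
Qed.

Lemma admissible_scal (C a : R) (f : R -> R) :
  admissible C f -> admissible (Rabs a * C) (fun y => a * f y).
Proof.
intros [Hc Hd]; split; intros y Hy.
- apply (continuous_mult (K := R_AbsRing) (fun _ => a) f); auto; apply continuous_const.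
- rewrite Rabs_mult; unfold Rdiv; rewrite Rmult_assoc.
  apply Rmult_le_compat_l; [apply Rabs_pos | now apply Hd].
Qed.

Lemma halfline_int_plus (C D : R) (f g : R -> R) :
  admissible C f -> admissible D g ->
  halfline_int (fun y => f y + g y) = halfline_int f + halfline_int g.
Proof.
intros Hf Hg; apply halfline_int_unique.
apply is_lim_seq_ext with (fun n => cut f n + cut g n).
- intros n; unfold cut; symmetry.
  pose proof (INR_S_pos n).
  apply (RInt_plus (V := R_CompleteNormedModule) f g);
    apply ex_RInt_positive; try apply Hf; try apply Hg; auto with real.
- apply is_lim_seq_plus'; eapply halfline_int_lim; eassumption.
Qed.

Lemma halfline_int_scal (C a : R) (f : R -> R) :
  admissible C f -> halfline_int (fun y => a * f y) = a * halfline_int f.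
Proof.
intros Hf; apply halfline_int_unique.
apply is_lim_seq_ext with (fun n => a * cut f n).
- intros n; unfold cut; symmetry.
  pose proof (INR_S_pos n).
  apply (RInt_scal (V := R_CompleteNormedModule) f).
  apply ex_RInt_positive; try apply Hf; auto with real.
- apply (is_lim_seq_scal_l _ a (halfline_int f)); eapply halfline_int_lim; eassumption.
Qed.

Lemma halfline_int_minus (C D : R) (f g : R -> R) :
  admissible C f -> admissible D g ->
  halfline_int (fun y => f y - g y) = halfline_int f - halfline_int g.
Proof.
intros Hf Hg.
rewrite (halfline_int_ext _ (fun y => f y + (-1) * g y)) by (intros; ring).
rewrite (halfline_int_plus C (Rabs (-1) * D)), (halfline_int_scal D); auto; [ring|].
now apply admissible_scal.
Qed.

Lemma admissible_minus (C D : R) (f g : R -> R) :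
  admissible C f -> admissible D g -> admissible (C + D) (fun y => f y - g y).
Proof.
intros Hf Hg.
apply (admissible_ext _ (fun y => f y + (-1) * g y)); [intros; ring|].
apply admissible_plus; auto.
replace D with (Rabs (-1) * D) by (rewrite Rabs_left by lra; ring).
now apply admissible_scal.
Qed.

Lemma cut_le (C D : R) (f g : R -> R) (n : nat) :
  admissible C f -> admissible D g ->
  (forall y, 0 < y -> f y <= g y) -> cut f n <= cut g n.
Proof.
intros Hf Hg H; pose proof (INR_S_pos n).
apply RInt_le; try (apply cut_endpoints).
- apply ex_RInt_positive; try apply Hf; auto with real.
- apply ex_RInt_positive; try apply Hg; auto with real.
- intros x [Hx _]; apply H; apply Rlt_trans with (2 := Hx); auto with real.
Qed.

Lemma halfline_int_le (C D : R) (f g : R -> R) :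
  admissible C f -> admissible D g ->
  (forall y, 0 < y -> f y <= g y) -> halfline_int f <= halfline_int g.
Proof.
intros Hf Hg H.
apply (is_lim_seq_le (cut f) (cut g) (halfline_int f) (halfline_int g)).
- intros n; now apply (cut_le C D).
- now apply (halfline_int_lim C).
- now apply (halfline_int_lim D).
Qed.

(** The factor 4 is a crude bound for PI, the length of the range of [atan]. *)
Lemma halfline_int_abs (C : R) (f : R -> R) :
  admissible C f -> Rabs (halfline_int f) <= 4 * C.
Proof.
intros Hf.
apply (is_lim_seq_le (fun n => Rabs (cut f n)) (fun _ => 4 * C) (Rabs (halfline_int f)) (4 * C)).
- intros n; unfold cut.
  apply Rle_trans with (C * (atan (INR (S n)) - atan (/ INR (S n)))).
  + apply admissible_RInt_bound; auto; [|apply cut_endpoints].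
    apply Rinv_0_lt_compat, INR_S_pos.
  + rewrite Rmult_comm; apply Rmult_le_compat_r.
    (* The majorant at y = 1 shows that [C] is nonnegative. *)
    * destruct Hf as [_ Hd]; pose proof (Hd 1 Rlt_0_1) as H1.
      pose proof (Rabs_pos (f 1)); simpl in H1; lra.
    * pose proof (atan_bound (INR (S n))); pose proof (atan_bound (/ INR (S n))).
      pose proof PI_4; lra.
- apply (is_lim_seq_abs _ (halfline_int f)); now apply (halfline_int_lim C).
- apply is_lim_seq_const.
Qed.

(** Strictness survives the limit because the integral over the fixed interval from 1/2 to 2 is
    positive and every later cut only adds nonnegative pieces to it. *)
Lemma halfline_int_pos (C : R) (f : R -> R) :
  admissible C f -> (forall y, 0 < y -> 0 < f y) -> 0 < halfline_int f.
Proof.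
intros Hf H; pose proof (proj1 Hf) as Hc.
assert (H1 : 0 < cut f 1).
{ unfold cut; simpl; apply RInt_gt_0; [lra | |];
    intros x Hx; [apply H | apply Hc]; lra. }
apply Rlt_le_trans with (1 := H1).
apply (is_lim_seq_le (fun _ => cut f 1) (fun n => cut f (n + 1)) (cut f 1) (halfline_int f)).
- intros n; unfold cut.
  pose proof (INR_S_pos (n + 1)) as Hn; pose proof (INR_S_pos 1) as Hn1.
  assert (Hle : INR 2 <= INR (S (n + 1))) by (apply le_INR; lia).
  assert (Hle' : / INR (S (n + 1)) <= / INR 2) by (apply Rinv_le_contravar; auto).
  pose proof (Rinv_0_lt_compat _ Hn); pose proof (Rinv_0_lt_compat _ Hn1).
  rewrite <- (RInt_Chasles (V := R_CompleteNormedModule) f (/ INR (S (n + 1))) (/ INR 2) (INR (S (n + 1))));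
    [|apply ex_RInt_positive; auto ..].
  rewrite <- (RInt_Chasles (V := R_CompleteNormedModule) f (/ INR 2) (INR 2) (INR (S (n + 1))));
    [|apply ex_RInt_positive; auto ..].
  assert (0 <= RInt f (/ INR (S (n + 1))) (/ INR 2)).
  { apply RInt_ge_0; auto; [apply ex_RInt_positive; auto|].
    intros x Hx; apply Rlt_le, H; lra. }
  assert (0 <= RInt f (INR 2) (INR (S (n + 1)))).
  { apply RInt_ge_0; auto; [apply ex_RInt_positive; auto|].
    intros x Hx; apply Rlt_le, H; lra. }
  unfold plus; simpl plus; simpl in *; lra.
- apply is_lim_seq_const.
- apply (is_lim_seq_incr_n (cut f) 1), (halfline_int_lim C f Hf).
Qed.

Lemma halfline_int_abs_le (C D : R) (f g : R -> R) :
  admissible C f -> admissible D g ->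
  (forall y, 0 < y -> Rabs (f y) <= g y) -> Rabs (halfline_int f) <= halfline_int g.
Proof.
intros Hf Hg H; apply Rabs_le; split.
- replace (- halfline_int g) with (halfline_int (fun y => -1 * g y))
    by (rewrite (halfline_int_scal D); auto; ring).
  apply (halfline_int_le (Rabs (-1) * D) C); auto; [now apply admissible_scal|].
  intros y Hy; pose proof (H y Hy) as H1; apply Rabs_le_between in H1; lra.
- apply (halfline_int_le C D); auto.
  intros y Hy; apply Rle_trans with (2 := H y Hy), Rle_abs.
Qed.

(** * Termwise integration of dominated series *)

Lemma ex_series_dominated (M : nat -> R) (f : nat -> R -> R) (y : R) :
  (forall k, admissible (M k) (f k)) -> ex_series M -> 0 < y ->
  ex_series (fun k => f k y).
Proof.
intros Hf HM Hy.
apply (ex_series_le (K := R_AbsRing) (V := R_CompleteNormedModule) _ (fun k => M k * / (1 + y ^ 2))).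
- intros k; apply (proj2 (Hf k) y Hy).
- now apply ex_series_scal_r.
Qed.

(** The weight [1 / (1 + y ^ 2)] is kept in the tail. The tail is thus admissible with a constant
    tending to 0, which yields both uniform convergence and convergence of the integrals. *)
Lemma series_tail_bound (M : nat -> R) (f : nat -> R -> R) (y : R) (n : nat) :
  (forall k, admissible (M k) (f k)) -> ex_series M -> 0 < y ->
  Rabs (Series (fun k => f k y) - sum_n (fun k => f k y) n) <=
  (Series M - sum_n M n) / (1 + y ^ 2).
Proof.
intros Hf HM Hy.
assert (Hfin : forall m, Rabs (sum_n (fun k => f k y) (n + m) - sum_n (fun k => f k y) n)
  <= (sum_n M (n + m) - sum_n M n) / (1 + y ^ 2)).
{ induction m as [|m IH].
  - rewrite Nat.add_0_r, !Rminus_diag, Rabs_R0; unfold Rdiv; lra.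
  - rewrite Nat.add_succ_r, !sum_Sn; unfold plus; simpl.
    replace (_ + f (S (n + m)) y - _) with
      ((sum_n (fun k => f k y) (n + m) - sum_n (fun k => f k y) n) + f (S (n + m)) y) by ring.
    apply Rle_trans with (1 := Rabs_triang _ _).
    pose proof (proj2 (Hf (S (n + m))) y Hy) as H; simpl in H, IH.
    unfold Rdiv in *.
    replace ((sum_n M (n + m) + M (S (n + m)) - sum_n M n) * / (1 + y * (y * 1))) with
      ((sum_n M (n + m) - sum_n M n) * / (1 + y * (y * 1)) + M (S (n + m)) * / (1 + y * (y * 1)))
      by ring.
    lra. }
apply (is_lim_seq_le
  (fun m => Rabs (sum_n (fun k => f k y) (n + m) - sum_n (fun k => f k y) n))
  (fun m => (sum_n M (n + m) - sum_n M n) / (1 + y ^ 2))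
  (Rabs (Series (fun k => f k y) - sum_n (fun k => f k y) n))
  ((Series M - sum_n M n) / (1 + y ^ 2)) Hfin).
- apply (is_lim_seq_abs _ (Series (fun k => f k y) - sum_n (fun k => f k y) n)).
  apply is_lim_seq_minus'; [|apply is_lim_seq_const].
  apply is_lim_seq_ext with (fun m => sum_n (fun k => f k y) (m + n)).
  { intros m; now rewrite Nat.add_comm. }
  apply (is_lim_seq_incr_n (sum_n (fun k => f k y)) n).
  apply Series_correct, (ex_series_dominated M); auto.
- apply (is_lim_seq_scal_r _ (/ (1 + y ^ 2)) (Series M - sum_n M n)).
  apply is_lim_seq_minus'; [|apply is_lim_seq_const].
  apply is_lim_seq_ext with (fun m => sum_n M (m + n)).
  { intros m; now rewrite Nat.add_comm. }
  apply (is_lim_seq_incr_n (sum_n M) n); now apply Series_correct.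
Qed.

Lemma admissible_sum_n (M : nat -> R) (f : nat -> R -> R) (n : nat) :
  (forall k, admissible (M k) (f k)) ->
  admissible (sum_n M n) (fun y => sum_n (fun k => f k y) n).
Proof.
intros Hf; induction n as [|n IH].
- rewrite sum_O; apply admissible_ext with (f 0%nat); auto.
  intros; now rewrite sum_O.
- rewrite sum_Sn; apply admissible_ext with (fun y => sum_n (fun k => f k y) n + f (S n) y).
  { intros; now rewrite sum_Sn. }
  now apply admissible_plus.
Qed.

Lemma halfline_int_sum_n (M : nat -> R) (f : nat -> R -> R) (n : nat) :
  (forall k, admissible (M k) (f k)) ->
  halfline_int (fun y => sum_n (fun k => f k y) n) = sum_n (fun k => halfline_int (f k)) n.
Proof.
intros Hf; induction n as [|n IH].
- rewrite sum_O; apply halfline_int_ext; intros; now rewrite sum_O.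
- rewrite sum_Sn, <- IH; unfold plus; simpl.
  rewrite <- (halfline_int_plus (sum_n M n) (M (S n))); auto; [|now apply admissible_sum_n].
  apply halfline_int_ext; intros; now rewrite sum_Sn.
Qed.

Lemma is_lim_seq_tail (M : nat -> R) :
  ex_series M -> is_lim_seq (fun n => Series M - sum_n M n) 0.
Proof.
intros HM.
replace (Finite 0) with (Finite (Series M - Series M)) by (f_equal; ring).
apply is_lim_seq_minus'; [apply is_lim_seq_const | now apply Series_correct].
Qed.

Lemma admissible_series (M : nat -> R) (f : nat -> R -> R) :
  (forall k, admissible (M k) (f k)) -> ex_series M ->
  admissible (Series M) (fun y => Series (fun k => f k y)).
Proof.
intros Hf HM; split.
- intros y Hy; apply continuity_pt_filterlim.
  apply (CVU_cont_open (fun n y => sum_n (fun k => f k y) n) (fun y => 0 < y)); auto.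
  + apply open_gt.
  + intros eps.
    pose proof (is_lim_seq_tail M HM) as Ht.
    apply is_lim_seq_spec in Ht; destruct (Ht eps) as [N HN].
    exists N; intros n Hn x Hx.
    rewrite Rabs_minus_sym.
    apply Rle_lt_trans with (1 := series_tail_bound M f x n Hf HM Hx).
    specialize (HN n Hn); rewrite Rminus_0_r in HN.
    apply Rle_lt_trans with (2 := HN).
    apply Rle_trans with (2 := Rle_abs _).
    assert (0 <= (Series M - sum_n M n) / (1 + x ^ 2)).
    { apply Rle_trans with (2 := series_tail_bound M f x n Hf HM Hx); apply Rabs_pos. }
    assert (1 <= 1 + x ^ 2) by nra.
    assert (E : Series M - sum_n M n = (Series M - sum_n M n) / (1 + x ^ 2) * (1 + x ^ 2))
      by (field; nra).
    nra.
  + intros n x Hx; apply continuity_pt_filterlim.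
    apply (proj1 (admissible_sum_n M f n Hf) x Hx).
- intros y Hy.
  apply (is_lim_seq_le (fun n => Rabs (sum_n (fun k => f k y) n)) (fun n => sum_n M n / (1 + y ^ 2))
    (Rabs (Series (fun k => f k y))) (Series M / (1 + y ^ 2))).
  + intros n; apply (proj2 (admissible_sum_n M f n Hf) y Hy).
  + apply (is_lim_seq_abs _ (Series (fun k => f k y))).
    apply Series_correct, (ex_series_dominated M); auto.
  + apply (is_lim_seq_scal_r _ (/ (1 + y ^ 2)) (Series M)); now apply Series_correct.
Qed.

(** The error of a partial sum is the integral of an admissible tail, hence at most four times the
    tail of [M]. *)
Lemma halfline_int_series (M : nat -> R) (f : nat -> R -> R) :
  (forall k, admissible (M k) (f k)) -> ex_series M ->
  is_series (fun k => halfline_int (f k)) (halfline_int (fun y => Series (fun k => f k y))).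
Proof.
intros Hf HM.
pose proof (admissible_series M f Hf HM) as HF.
set (F := fun y => Series (fun k => f k y)) in *.
assert (Hd : forall n, Rabs (sum_n (fun k => halfline_int (f k)) n - halfline_int F)
  <= 4 * (Series M - sum_n M n)).
{ intros n; rewrite <- (halfline_int_sum_n M); auto.
  rewrite Rabs_minus_sym, <- (halfline_int_minus (Series M) (sum_n M n)); auto;
    [|now apply admissible_sum_n].
  apply halfline_int_abs; split.
  - apply (admissible_minus (Series M) (sum_n M n)); auto; now apply admissible_sum_n.
  - intros y Hy; now apply series_tail_bound. }
change (is_lim_seq (sum_n (fun k => halfline_int (f k))) (halfline_int F)).
apply is_lim_seq_ext with
  (fun n => (sum_n (fun k => halfline_int (f k)) n - halfline_int F) + halfline_int F).
{ intros; ring. }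
replace (Finite (halfline_int F)) with (Finite (0 + halfline_int F)) by (f_equal; ring).
apply is_lim_seq_plus'; [|apply is_lim_seq_const].
apply is_lim_seq_abs_0.
apply is_lim_seq_le_le with (fun _ => 0) (fun n => 4 * (Series M - sum_n M n)).
- intros n; split; [apply Rabs_pos | apply Hd].
- apply is_lim_seq_const.
- replace (Finite 0) with (Rbar_mult 4 0) by (simpl; f_equal; ring).
  apply is_lim_seq_scal_l; now apply is_lim_seq_tail.
Qed.

(** * Partial fractions of csch and coth *)

(** Weights of a sum over all integers folded onto the nonnegative ones. They make
    [dirichlet_kernel] the usual kernel, the quotient of sin((n + 1/2) x) by sin(x / 2). *)
Definition dirichlet_coef (k : nat) : R := match k with O => 1 | S _ => 2 end.

Definition dirichlet_kernel (n : nat) (x : R) : R :=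
  sum_n (fun k => dirichlet_coef k * cos (INR k * x)) n.

Lemma dirichlet_kernel_sin (n : nat) (x : R) :
  dirichlet_kernel n x * sin (x / 2) = sin ((INR n + / 2) * x).
Proof.
unfold dirichlet_kernel; induction n as [|n IH].
- rewrite sum_O; simpl; rewrite Rmult_0_l, cos_0, !Rmult_1_l; f_equal; field.
- rewrite sum_Sn; unfold plus; simpl plus; simpl dirichlet_coef.
  rewrite Rmult_plus_distr_r, IH, S_INR.
  replace ((INR n + 1 + / 2) * x) with ((INR n + 1) * x + x / 2) by field.
  replace ((INR n + / 2) * x) with ((INR n + 1) * x - x / 2) by field.
  rewrite sin_plus, sin_minus; ring.
Qed.

Lemma continuous_dirichlet_kernel (n : nat) (x : R) : continuous (dirichlet_kernel n) x.
Proof.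
unfold dirichlet_kernel; induction n as [|n IH].
- apply continuous_ext with (fun x => dirichlet_coef 0 * cos (INR 0 * x)).
  + intros; now rewrite sum_O.
  + apply (ex_derive_continuous (K := R_AbsRing) (V := R_NormedModule)); now auto_derive.
- apply continuous_ext with
    (fun x => sum_n (fun k => dirichlet_coef k * cos (INR k * x)) n
              + dirichlet_coef (S n) * cos (INR (S n) * x)).
  + intros; now rewrite sum_Sn.
  + apply (continuous_plus (V := R_NormedModule)); auto.
    apply (ex_derive_continuous (K := R_AbsRing) (V := R_NormedModule)); now auto_derive.
Qed.

Lemma ex_RInt_continuous_everywhere (f : R -> R) (a b : R) :
  (forall x, continuous f x) -> ex_RInt f a b.
Proof. intros H; apply (ex_RInt_continuous (V := R_CompleteNormedModule)); auto. Qed.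

Lemma RInt_dirichlet (f : R -> R) (n : nat) :
  (forall x, continuous f x) ->
  RInt (fun x => f x * dirichlet_kernel n x) 0 PI =
  sum_n (fun k => dirichlet_coef k * RInt (fun x => f x * cos (INR k * x)) 0 PI) n.
Proof.
intros Hf.
assert (Hcos : forall k x, continuous (fun x => f x * cos (INR k * x)) x).
{ intros k x; apply (continuous_mult (K := R_AbsRing) f); auto.
  apply (ex_derive_continuous (K := R_AbsRing) (V := R_NormedModule)); now auto_derive. }
assert (Hsc : forall k, RInt (fun x => dirichlet_coef k * (f x * cos (INR k * x))) 0 PI =
  dirichlet_coef k * RInt (fun x => f x * cos (INR k * x)) 0 PI).
{ intros k; apply (RInt_scal (V := R_CompleteNormedModule)).
  now apply ex_RInt_continuous_everywhere. }
induction n as [|n IH].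
- rewrite sum_O, <- Hsc; apply (RInt_ext (V := R_CompleteNormedModule)).
  intros x _; unfold dirichlet_kernel; rewrite sum_O; simpl; ring.
- rewrite sum_Sn, <- IH, <- Hsc.
  rewrite <- (RInt_plus (V := R_CompleteNormedModule)).
  + apply (RInt_ext (V := R_CompleteNormedModule)).
    intros x _; unfold dirichlet_kernel; rewrite sum_Sn; unfold plus; simpl; ring.
  + apply ex_RInt_continuous_everywhere; intros x.
    apply (continuous_mult (K := R_AbsRing) f); auto; apply continuous_dirichlet_kernel.
  + apply ex_RInt_continuous_everywhere; intros x.
    apply (continuous_mult (K := R_AbsRing) (fun _ => dirichlet_coef (S n))); auto.
    apply continuous_const.
Qed.

(* Riemann-Lebesgue for a monotone amplitude g = f / sin (x / 2): integrating by
   parts leaves g' times a cosine, and the integral of |g'| = g' telescopes. *)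
Lemma dirichlet_bound_away_from_0 (f g dg : R -> R) (n : nat) (d : R) :
  (forall x, continuous f x) ->
  (forall x, 0 < x <= PI -> is_derive g x (dg x)) ->
  (forall x, 0 < x <= PI -> continuous dg x) ->
  (forall x, 0 < x <= PI -> 0 <= g x /\ 0 <= dg x) ->
  (forall x, 0 < x <= PI -> f x = g x * sin (x / 2)) ->
  0 < d < PI ->
  Rabs (RInt (fun x => f x * dirichlet_kernel n x) d PI) <= 2 * g PI / (INR n + / 2).
Proof.
intros Hf Hg Hdg Hpos Hfg Hd.
set (m := INR n + / 2).
assert (Hm : 0 < m) by (unfold m; pose proof (pos_INR n); lra).
assert (Hr : forall x, Rmin d PI <= x <= Rmax d PI -> 0 < x <= PI).
{ intros x; rewrite Rmin_left, Rmax_right by lra; lra. }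
assert (Hcg : forall x, 0 < x <= PI -> continuous g x).
{ intros x Hx; apply (ex_derive_continuous (K := R_AbsRing) (V := R_NormedModule)).
  eexists; now apply Hg. }
assert (Hctrig : forall x, continuous (fun x => cos (m * x) / m) x).
{ intros x; apply (ex_derive_continuous (K := R_AbsRing) (V := R_NormedModule)).
  auto_derive; lra. }
assert (Hcsin : forall x, continuous (fun x => sin (m * x)) x).
{ intros x; apply (ex_derive_continuous (K := R_AbsRing) (V := R_NormedModule)).
  now auto_derive. }
assert (I1 : is_RInt (fun x => g x * sin (m * x) - dg x * (cos (m * x) / m)) d PI
  (- g PI * (cos (m * PI) / m) - - g d * (cos (m * d) / m))).
{ apply (is_RInt_derive (V := R_CompleteNormedModule) (fun x => - g x * (cos (m * x) / m))).
  - intros x Hx; apply Hr in Hx.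
    pose proof (Hg x Hx) as Hgx.
    auto_derive.
    + eexists; exact Hgx.
    + replace (Derive (fun x => g x) x) with (dg x) by (symmetry; apply is_derive_unique, Hgx); field; lra.
  - intros x Hx; apply Hr in Hx.
    apply (continuous_minus (V := R_NormedModule) (fun x => g x * sin (m * x))
      (fun x => dg x * (cos (m * x) / m))).
    + apply (continuous_mult (K := R_AbsRing) g); auto.
    + apply (continuous_mult (K := R_AbsRing) dg); auto. }
assert (E2 : ex_RInt (fun x => dg x * (cos (m * x) / m)) d PI).
{ apply (ex_RInt_continuous (V := R_CompleteNormedModule)); intros x Hx; apply Hr in Hx.
  apply (continuous_mult (K := R_AbsRing) dg); auto. }
assert (I3 : is_RInt dg d PI (g PI - g d)).
{ apply (is_RInt_derive (V := R_CompleteNormedModule) g).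
  - intros x Hx; apply Hg, Hr, Hx.
  - intros x Hx; apply Hdg, Hr, Hx. }
assert (E : RInt (fun x => f x * dirichlet_kernel n x) d PI =
  (- g PI * (cos (m * PI) / m) - - g d * (cos (m * d) / m))
  + RInt (fun x => dg x * (cos (m * x) / m)) d PI).
{ apply is_RInt_unique.
  apply (is_RInt_ext (V := R_NormedModule)
    (fun x => (g x * sin (m * x) - dg x * (cos (m * x) / m)) + dg x * (cos (m * x) / m))).
  - intros x; rewrite Rmin_left, Rmax_right by lra; intros Hx.
    real_eq.
    rewrite Hfg by lra; rewrite Rmult_assoc, (Rmult_comm (sin (x / 2))), dirichlet_kernel_sin.
    fold m; ring.
  - apply (is_RInt_plus (V := R_NormedModule)); auto.
    now apply (RInt_correct (V := R_CompleteNormedModule)). }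
assert (Hcos : forall x, Rabs (cos (m * x) / m) <= / m).
{ intros x; unfold Rdiv; rewrite Rabs_mult, (Rabs_right (/ m)).
  - pose proof (COS_bound (m * x)); pose proof (Rinv_0_lt_compat _ Hm).
    assert (Rabs (cos (m * x)) <= 1) by (apply Rabs_le; lra); nra.
  - apply Rle_ge, Rlt_le, Rinv_0_lt_compat; auto. }
assert (B2 : Rabs (RInt (fun x => dg x * (cos (m * x) / m)) d PI) <= / m * (g PI - g d)).
{ apply Rle_trans with (1 := abs_RInt_le _ d PI (Rlt_le _ _ (proj2 Hd)) E2).
  rewrite <- (is_RInt_unique _ _ _ _ I3).
  replace (/ m * RInt dg d PI) with (RInt (fun x => / m * dg x) d PI).
  - apply RInt_le; try lra.
    + apply (ex_RInt_continuous (V := R_CompleteNormedModule)); intros x Hx; apply Hr in Hx.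
      apply (continuous_comp (fun x => dg x * (cos (m * x) / m)) Rabs).
      * apply (continuous_mult (K := R_AbsRing) dg); auto.
      * apply continuous_Rabs.
    + apply (ex_RInt_scal (V := R_NormedModule)); eexists; exact I3.
    + intros x Hx; rewrite Rabs_mult, Rabs_right by (apply Rle_ge, Hpos; lra).
      rewrite Rmult_comm; apply Rmult_le_compat_r; [apply Hpos; lra | apply Hcos].
  - apply (RInt_scal (V := R_CompleteNormedModule)); eexists; exact I3. }
rewrite E.
apply Rle_trans with (1 := Rabs_triang _ _).
assert (B1 : Rabs (- g PI * (cos (m * PI) / m) - - g d * (cos (m * d) / m)) <= / m * (g PI + g d)).
{ apply Rle_trans with (1 := Rabs_triang _ _).
  rewrite Rabs_Ropp, !Rabs_mult, !Rabs_Ropp.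
  destruct (Hpos PI ltac:(lra)) as [P1 _]; destruct (Hpos d ltac:(lra)) as [P2 _].
  rewrite (Rabs_right (g PI)), (Rabs_right (g d)) by lra.
  pose proof (Hcos PI); pose proof (Hcos d); nra. }
unfold Rdiv; lra.
Qed.

(** The amplitude [f x / sin (x / 2)] has a division by zero at 0, so integrals starting at 0 are
    reached through integrals starting at [/ INR (S j)]. *)
Lemma RInt_continuous_lower_bound (h : R -> R) (b : R) :
  (forall x, continuous h x) -> is_lim_seq (fun j => RInt h (/ INR (S j)) b) (RInt h 0 b).
Proof.
intros Hh.
apply is_lim_seq_ext with (fun j => RInt h 0 b - RInt h 0 (/ INR (S j))).
{ intros j.
  rewrite <- (RInt_Chasles (V := R_CompleteNormedModule) h 0 (/ INR (S j)) b)
    by (apply ex_RInt_continuous_everywhere; auto).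
  unfold plus; simpl; real_eq; ring. }
replace (Finite (RInt h 0 b)) with (Finite (RInt h 0 b - RInt h 0 0))
  by (rewrite RInt_point; unfold zero; simpl; f_equal; ring).
apply is_lim_seq_minus'; [apply is_lim_seq_const|].
apply (is_lim_seq_continuous (fun t => RInt h 0 t)).
- apply continuity_pt_filterlim.
  apply (ex_derive_continuous (K := R_AbsRing) (V := R_NormedModule)).
  exists (h 0); apply (is_derive_RInt h _ 0); auto.
  exists (mkposreal 1 Rlt_0_1); intros y _.
  now apply (RInt_correct (V := R_CompleteNormedModule)), ex_RInt_continuous_everywhere.
- apply is_lim_seq_ext with (fun j => / (INR j + 1)).
  { intros j; now rewrite S_INR. }
  replace (Finite 0) with (Rbar_inv p_infty) by reflexivity.
  apply is_lim_seq_inv; [|discriminate].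
  apply (is_lim_seq_plus _ _ p_infty 1).
  + apply is_lim_seq_INR.
  + apply is_lim_seq_const.
  + reflexivity.
Qed.

(** The bound for the integral from d to PI does not depend on d. It therefore persists for d = 0,
    and it decays like 1 / n. *)
Lemma dirichlet_vanish (f g dg : R -> R) :
  (forall x, continuous f x) ->
  (forall x, 0 < x <= PI -> is_derive g x (dg x)) ->
  (forall x, 0 < x <= PI -> continuous dg x) ->
  (forall x, 0 < x <= PI -> 0 <= g x /\ 0 <= dg x) ->
  (forall x, 0 < x <= PI -> f x = g x * sin (x / 2)) ->
  is_lim_seq (fun n => RInt (fun x => f x * dirichlet_kernel n x) 0 PI) 0.
Proof.
intros Hf Hg Hdg Hpos Hfg; pose proof PI2_1 as HPI.
assert (B : forall n, Rabs (RInt (fun x => f x * dirichlet_kernel n x) 0 PI)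
  <= 2 * g PI / (INR n + / 2)).
{ intros n.
  apply (is_lim_seq_le
    (fun j => Rabs (RInt (fun x => f x * dirichlet_kernel n x) (/ INR (S j)) PI))
    (fun _ => 2 * g PI / (INR n + / 2))
    (Rabs (RInt (fun x => f x * dirichlet_kernel n x) 0 PI)) (2 * g PI / (INR n + / 2))).
  - intros j; apply dirichlet_bound_away_from_0 with dg; auto.
    split; [apply Rinv_0_lt_compat, INR_S_pos|].
    apply Rle_lt_trans with 1; [|lra].
    rewrite <- Rinv_1; apply Rinv_le_contravar; [lra | apply INR_S_ge1].
  - apply (is_lim_seq_abs _ (RInt (fun x => f x * dirichlet_kernel n x) 0 PI)).
    apply RInt_continuous_lower_bound; intros x.
    apply (continuous_mult (K := R_AbsRing) f); auto; apply continuous_dirichlet_kernel.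
  - apply is_lim_seq_const. }
apply is_lim_seq_abs_0.
apply is_lim_seq_le_le with (fun _ => 0) (fun n => 2 * g PI / (INR n + / 2)); auto.
- intros n; split; [apply Rabs_pos | auto].
- apply is_lim_seq_const.
- replace (Finite 0) with (Rbar_mult (2 * g PI) (Rbar_inv p_infty)) by (simpl; f_equal; ring).
  apply is_lim_seq_scal_l, is_lim_seq_inv; [|discriminate].
  apply (is_lim_seq_plus _ _ p_infty (/ 2)).
  + apply is_lim_seq_INR.
  + apply is_lim_seq_const.
  + reflexivity.
Qed.

(** * Hyperbolic functions as monotone amplitudes *)

Lemma sinh_pos (x : R) : 0 < x -> 0 < sinh x.
Proof. intros H; rewrite <- sinh_0; now apply sinh_lt. Qed.

Lemma sinh_nonneg (x : R) : 0 <= x -> 0 <= sinh x.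
Proof.
intros [H|H]; [left; now apply sinh_pos | rewrite <- H, sinh_0; lra].
Qed.

Lemma cosh_ge_1 (x : R) : 1 <= cosh x.
Proof.
unfold cosh; rewrite exp_Ropp; pose proof (exp_pos x) as H.
assert (E : (exp x + / exp x) / 2 - 1 = (exp x - 1) ^ 2 / (2 * exp x)) by (field; lra).
assert (0 <= (exp x - 1) ^ 2 / (2 * exp x)).
{ apply Rdiv_le_0_compat; [apply pow2_ge_0 | lra]. }
lra.
Qed.

Lemma nonneg_of_derive (f df : R -> R) (b : R) :
  f 0 = 0 -> (forall x, 0 <= x <= b -> is_derive f x (df x)) ->
  (forall x, 0 <= x <= b -> 0 <= df x) -> 0 <= b -> 0 <= f b.
Proof.
intros H0 Hd Hp Hb.
destruct (MVT_gen f 0 b df) as [c [Hc E]].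
- rewrite Rmin_left, Rmax_right by lra; intros; apply Hd; lra.
- rewrite Rmin_left, Rmax_right by lra; intros x Hx.
  apply continuity_pt_filterlim, (ex_derive_continuous (K := R_AbsRing) (V := R_NormedModule)).
  eexists; apply Hd; lra.
- rewrite Rmin_left, Rmax_right in Hc by lra.
  specialize (Hp c Hc); nra.
Qed.

Lemma half_angle_pos (x : R) : 0 < x <= PI -> 0 < sin (x / 2).
Proof. intros H; apply sin_gt_0; lra. Qed.

(** This is the numerator of the derivative of (cosh(a x) - 1) / sin(x / 2). It vanishes at 0, and
    in its own derivative the mixed terms cancel, leaving nonnegative ones. *)
Lemma cosh_quotient_increasing (a b : R) :
  0 < a -> 0 <= b <= PI ->
  0 <= a * sinh (a * b) * sin (b / 2) - (cosh (a * b) - 1) * (cos (b / 2) / 2).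
Proof.
intros Ha Hb.
apply (nonneg_of_derive
  (fun x => a * sinh (a * x) * sin (x / 2) - (cosh (a * x) - 1) * (cos (x / 2) / 2))
  (fun x => a ^ 2 * cosh (a * x) * sin (x / 2) + (cosh (a * x) - 1) * sin (x / 2) / 4)).
- unfold Rdiv; rewrite Rmult_0_r, Rmult_0_l, sinh_0, cosh_0; ring.
- intros x Hx; auto_derive; auto; unfold Rdiv; field.
- intros x Hx; pose proof (cosh_ge_1 (a * x)).
  assert (0 <= sin (x / 2)) by (apply sin_ge_0; lra).
  assert (0 <= a ^ 2 * cosh (a * x)) by nra.
  assert (0 <= (a ^ 2 * cosh (a * x)) * sin (x / 2)) by (apply Rmult_le_pos; auto).
  nra.
- lra.
Qed.

(** The same cancellation, for the quotient of sinh(a x) by sin(x / 2). *)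
Lemma sinh_quotient_increasing (a b : R) :
  0 < a -> 0 <= b <= PI ->
  0 <= a * cosh (a * b) * sin (b / 2) - sinh (a * b) * (cos (b / 2) / 2).
Proof.
intros Ha Hb.
apply (nonneg_of_derive
  (fun x => a * cosh (a * x) * sin (x / 2) - sinh (a * x) * (cos (x / 2) / 2))
  (fun x => a ^ 2 * sinh (a * x) * sin (x / 2) + sinh (a * x) * sin (x / 2) / 4)).
- unfold Rdiv; rewrite Rmult_0_r, Rmult_0_l, sinh_0, sin_0; ring.
- intros x Hx; auto_derive; auto; unfold Rdiv; field.
- intros x Hx.
  assert (0 <= sinh (a * x)) by (apply sinh_nonneg; nra).
  assert (0 <= sin (x / 2)) by (apply sin_ge_0; lra).
  assert (0 <= sinh (a * x) * sin (x / 2)) by (apply Rmult_le_pos; auto).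
  nra.
- lra.
Qed.

(** Subtracting the value 1 at the origin keeps the quotient by sin(x / 2) bounded; the constant 1
    contributes exactly PI through [RInt_dirichlet_kernel]. *)
Lemma dirichlet_cosh_vanish (a : R) : 0 < a ->
  is_lim_seq (fun n => RInt (fun x => (cosh (a * x) - 1) * dirichlet_kernel n x) 0 PI) 0.
Proof.
intros Ha.
apply (dirichlet_vanish (fun x => cosh (a * x) - 1) (fun x => (cosh (a * x) - 1) / sin (x / 2))
  (fun x => (a * sinh (a * x) * sin (x / 2) - (cosh (a * x) - 1) * (cos (x / 2) / 2))
            / sin (x / 2) ^ 2)).
- intros x; apply (ex_derive_continuous (K := R_AbsRing) (V := R_NormedModule)).
  now auto_derive.
- intros x Hx; pose proof (half_angle_pos x Hx); auto_derive; [auto with real | unfold Rdiv in *; field; lra].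
- intros x Hx; pose proof (half_angle_pos x Hx).
  apply (ex_derive_continuous (K := R_AbsRing) (V := R_NormedModule)).
  auto_derive; apply Rgt_not_eq; nra.
- intros x Hx; pose proof (half_angle_pos x Hx); pose proof (cosh_ge_1 (a * x)).
  split; apply Rdiv_le_0_compat; try lra; [|nra].
  apply cosh_quotient_increasing; lra.
- intros x Hx; pose proof (half_angle_pos x Hx); field; lra.
Qed.

Lemma dirichlet_sinh_vanish (a : R) : 0 < a ->
  is_lim_seq (fun n => RInt (fun x => sinh (a * x) * dirichlet_kernel n x) 0 PI) 0.
Proof.
intros Ha.
apply (dirichlet_vanish (fun x => sinh (a * x)) (fun x => sinh (a * x) / sin (x / 2))
  (fun x => (a * cosh (a * x) * sin (x / 2) - sinh (a * x) * (cos (x / 2) / 2))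
            / sin (x / 2) ^ 2)).
- intros x; apply (ex_derive_continuous (K := R_AbsRing) (V := R_NormedModule)).
  now auto_derive.
- intros x Hx; pose proof (half_angle_pos x Hx); auto_derive; [auto with real | unfold Rdiv in *; field; lra].
- intros x Hx; pose proof (half_angle_pos x Hx).
  apply (ex_derive_continuous (K := R_AbsRing) (V := R_NormedModule)).
  auto_derive; apply Rgt_not_eq; nra.
- intros x Hx; pose proof (half_angle_pos x Hx).
  assert (0 <= sinh (a * x)) by (apply sinh_nonneg; nra).
  split; apply Rdiv_le_0_compat; try lra; [|nra].
  apply sinh_quotient_increasing; lra.
- intros x Hx; pose proof (half_angle_pos x Hx); field; lra.
Qed.

(** * Fourier cosine coefficients of cosh and sinh on the interval from 0 to PI *)

Lemma cos_sin_INR_PI (k : nat) : cos (INR k * PI) = (-1) ^ k /\ sin (INR k * PI) = 0.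
Proof.
induction k as [|k [IH1 IH2]].
- simpl; rewrite Rmult_0_l, cos_0, sin_0; auto.
- rewrite S_INR, Rmult_plus_distr_r, Rmult_1_l, neg_cos, neg_sin, IH1, IH2; simpl; split; ring.
Qed.

Lemma RInt_cosh_cos (a : R) (k : nat) : 0 < a ->
  RInt (fun x => cosh (a * x) * cos (INR k * x)) 0 PI =
  (-1) ^ k * (a * sinh (PI * a)) / (a ^ 2 + INR k ^ 2).
Proof.
intros Ha; pose proof (pos_INR k).
apply is_RInt_unique.
set (F := fun x => (a * sinh (a * x) * cos (INR k * x) + INR k * cosh (a * x) * sin (INR k * x))
  / (a ^ 2 + INR k ^ 2)).
replace ((-1) ^ k * (a * sinh (PI * a)) / (a ^ 2 + INR k ^ 2)) with (minus (F PI) (F 0)).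
- apply (is_RInt_derive (V := R_CompleteNormedModule) F).
  + intros x _; unfold F; auto_derive; [nra | field; nra].
  + intros x _; apply (ex_derive_continuous (K := R_AbsRing) (V := R_NormedModule)).
    now auto_derive.
- change (minus (F PI) (F 0)) with (F PI - F 0); unfold F.
  destruct (cos_sin_INR_PI k) as [-> ->].
  rewrite !Rmult_0_r, sinh_0, sin_0, (Rmult_comm PI a).
  real_eq; field; nra.
Qed.

Lemma RInt_sinh_cos (a : R) (k : nat) : 0 < a ->
  RInt (fun x => sinh (a * x) * cos (INR k * x)) 0 PI =
  a * (cosh (PI * a) * (-1) ^ k - 1) / (a ^ 2 + INR k ^ 2).
Proof.
intros Ha; pose proof (pos_INR k).
apply is_RInt_unique.
set (F := fun x => (a * cosh (a * x) * cos (INR k * x) + INR k * sinh (a * x) * sin (INR k * x))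
  / (a ^ 2 + INR k ^ 2)).
replace (a * (cosh (PI * a) * (-1) ^ k - 1) / (a ^ 2 + INR k ^ 2)) with (minus (F PI) (F 0)).
- apply (is_RInt_derive (V := R_CompleteNormedModule) F).
  + intros x _; unfold F; auto_derive; [nra | field; nra].
  + intros x _; apply (ex_derive_continuous (K := R_AbsRing) (V := R_NormedModule)).
    now auto_derive.
- change (minus (F PI) (F 0)) with (F PI - F 0); unfold F.
  destruct (cos_sin_INR_PI k) as [-> ->].
  rewrite !Rmult_0_r, cosh_0, cos_0, sin_0, (Rmult_comm PI a).
  real_eq; field; nra.
Qed.

Lemma RInt_dirichlet_kernel (n : nat) : RInt (dirichlet_kernel n) 0 PI = PI.
Proof.
rewrite (RInt_ext (V := R_CompleteNormedModule) _ (fun x => 1 * dirichlet_kernel n x))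
  by (intros; symmetry; apply Rmult_1_l).
rewrite (RInt_dirichlet (fun _ => 1)) by (intros; apply continuous_const).
assert (H0 : dirichlet_coef 0 * RInt (fun x => 1 * cos (INR 0 * x)) 0 PI = PI).
{ rewrite (RInt_ext (V := R_CompleteNormedModule) _ (fun _ => 1)).
  - rewrite RInt_const; unfold scal, dirichlet_coef; simpl; unfold mult; simpl; ring.
  - intros x _; simpl; now rewrite Rmult_0_l, cos_0, Rmult_1_l. }
induction n as [|n IH]; [now rewrite sum_O|].
rewrite sum_Sn, IH.
replace (RInt (fun x => 1 * cos (INR (S n) * x)) 0 PI) with 0.
- unfold plus; simpl; ring.
- symmetry; apply is_RInt_unique.
  pose proof (INR_S_pos n) as Hc; pose proof (proj2 (cos_sin_INR_PI (S n))) as Hsin.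
  revert Hc Hsin; generalize (INR (S n)) as c; intros c Hc Hsin.
  set (F := fun x => sin (c * x) / c).
  replace 0 with (minus (F PI) (F 0)) at 2.
  + apply (is_RInt_derive (V := R_CompleteNormedModule) F).
    * intros x _; unfold F; auto_derive; [lra | field; lra].
    * intros x _; apply (ex_derive_continuous (K := R_AbsRing) (V := R_NormedModule)).
      now auto_derive.
  + change (minus (F PI) (F 0)) with (F PI - F 0); unfold F.
    rewrite Hsin, Rmult_0_r, sin_0; real_eq; field; lra.
Qed.

(** The customary expansions are multiplied by a power of Y so that every fraction lies between 0
    and 1 and the term of index 0 is the constant 1. *)
Definition csch_partial (Y : R) (n : nat) : R :=
  sum_n (fun k => dirichlet_coef k * (-1) ^ k * (Y ^ 2 / (Y ^ 2 + INR k ^ 2))) n.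

Definition coth_partial (Y : R) (n : nat) : R :=
  sum_n (fun k => dirichlet_coef k * (Y ^ 2 / (Y ^ 2 + INR k ^ 2))) n.

(** The Fourier series of cosh(Y x) on the interval from -PI to PI, evaluated at x = 0: its
    coefficients carry the factor sinh(PI Y), and its value there is 1. *)
Lemma csch_partial_fraction (Y : R) : 0 < Y ->
  is_lim_seq (csch_partial Y) (PI * Y / sinh (PI * Y)).
Proof.
intros HY.
assert (Hs : 0 < sinh (PI * Y)) by (apply sinh_pos; pose proof PI_RGT_0; nra).
apply is_lim_seq_ext with (fun n => Y / sinh (PI * Y) *
  (PI + RInt (fun x => (cosh (Y * x) - 1) * dirichlet_kernel n x) 0 PI)).
- intros n.
  assert (E : PI + RInt (fun x => (cosh (Y * x) - 1) * dirichlet_kernel n x) 0 PI =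
    RInt (fun x => cosh (Y * x) * dirichlet_kernel n x) 0 PI).
  { rewrite <- (RInt_dirichlet_kernel n) at 1.
    rewrite <- (RInt_plus (V := R_CompleteNormedModule)).
    - apply (RInt_ext (V := R_CompleteNormedModule)); intros x _; unfold plus; simpl; ring.
    - apply ex_RInt_continuous_everywhere; intros; apply continuous_dirichlet_kernel.
    - apply ex_RInt_continuous_everywhere; intros x.
      apply (continuous_mult (K := R_AbsRing) (fun x => cosh (Y * x) - 1)).
      + apply (ex_derive_continuous (K := R_AbsRing) (V := R_NormedModule)); now auto_derive.
      + apply continuous_dirichlet_kernel. }
  rewrite E, (RInt_dirichlet (fun x => cosh (Y * x))).
  2: { intros x; apply (ex_derive_continuous (K := R_AbsRing) (V := R_NormedModule)).
       now auto_derive. }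
  unfold csch_partial.
  rewrite <- (sum_n_mult_l (K := R_AbsRing)).
  apply sum_n_ext; intros k; rewrite RInt_cosh_cos by auto.
  unfold mult; simpl; real_eq; pose proof (pos_INR k); field; nra.
- replace (PI * Y / sinh (PI * Y)) with (Y / sinh (PI * Y) * (PI + 0)) by (field; lra).
  apply (is_lim_seq_scal_l _ _ (PI + 0)).
  apply is_lim_seq_plus'; [apply is_lim_seq_const | now apply dirichlet_cosh_vanish].
Qed.

(** The even extension of sinh(Y x) vanishes at 0. Its cosine coefficients combine a csch term times
    cosh(PI Y) with a coth term, so its Fourier series at 0 expresses the coth sum through the csch
    sum. *)
Lemma coth_partial_fraction (Y : R) : 0 < Y ->
  is_lim_seq (coth_partial Y) (PI * Y * cosh (PI * Y) / sinh (PI * Y)).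
Proof.
intros HY.
assert (Hs : 0 < sinh (PI * Y)) by (apply sinh_pos; pose proof PI_RGT_0; nra).
apply is_lim_seq_ext with (fun n => cosh (PI * Y) * csch_partial Y n
  - Y * RInt (fun x => sinh (Y * x) * dirichlet_kernel n x) 0 PI).
- intros n; rewrite (RInt_dirichlet (fun x => sinh (Y * x))).
  2: { intros x; apply (ex_derive_continuous (K := R_AbsRing) (V := R_NormedModule)).
       now auto_derive. }
  unfold csch_partial, coth_partial.
  induction n as [|n IH].
  + rewrite !sum_O, RInt_sinh_cos by auto; simpl; field; nra.
  + rewrite !sum_n_S, <- IH, RInt_sinh_cos by auto.
    pose proof (INR_S_pos n) as Hc; revert Hc; generalize (INR (S n)) as c; intros c Hc.
    field; nra.
- replace (PI * Y * cosh (PI * Y) / sinh (PI * Y)) with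
    (cosh (PI * Y) * (PI * Y / sinh (PI * Y)) - Y * 0) by (field; lra).
  apply is_lim_seq_minus'.
  + apply (is_lim_seq_scal_l _ _ (PI * Y / sinh (PI * Y))); now apply csch_partial_fraction.
  + apply (is_lim_seq_scal_l _ _ 0); now apply dirichlet_sinh_vanish.
Qed.

(** * Alternating harmonic sums as integrals *)

Lemma admissible_mult (B C : R) (g f : R -> R) :
  (forall y, 0 < y -> continuous g y) -> (forall y, 0 < y -> Rabs (g y) <= B) ->
  admissible C f -> admissible (B * C) (fun y => g y * f y).
Proof.
intros Hg HB [Hc Hd]; split; intros y Hy.
- apply (continuous_mult (K := R_AbsRing) g f); auto.
- rewrite Rabs_mult; unfold Rdiv; rewrite Rmult_assoc.
  apply Rmult_le_compat; auto using Rabs_pos; now apply Hd.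
Qed.

Lemma continuous_of_ex_derive (f : R -> R) (y : R) : ex_derive f y -> continuous f y.
Proof. apply (ex_derive_continuous (K := R_AbsRing) (V := R_NormedModule)). Qed.

Lemma admissible_inv (x : R) : 0 < x ->
  admissible (1 + / x ^ 2) (fun y => / (x ^ 2 + y ^ 2)).
Proof.
intros Hx; assert (0 < x ^ 2) by (apply pow_lt; lra).
split; intros y Hy.
- apply continuous_of_ex_derive; auto_derive; nra.
- rewrite Rabs_right by (apply Rle_ge, Rlt_le, Rinv_0_lt_compat; nra).
  apply Rmult_le_reg_r with (x ^ 2 + y ^ 2); [nra|].
  rewrite Rinv_l by nra.
  unfold Rdiv; rewrite Rmult_assoc, (Rmult_comm (/ (1 + y ^ 2))), <- Rmult_assoc.
  apply Rmult_le_reg_r with (1 + y ^ 2); [nra|].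
  rewrite Rmult_assoc, Rinv_l by nra.
  assert (0 < / x ^ 2) by (apply Rinv_0_lt_compat; auto).
  assert (/ x ^ 2 * x ^ 2 = 1) by (apply Rinv_l; lra).
  nra.
Qed.

Lemma halfline_int_antiderivative (F f : R -> R) (l0 l : R) :
  (forall y, 0 < y -> is_derive F y (f y)) -> (forall y, 0 < y -> continuous f y) ->
  is_lim_seq (fun n => F (/ INR (S n))) l0 -> is_lim_seq (fun n => F (INR (S n))) l ->
  halfline_int f = l - l0.
Proof.
intros HF Hf H0 H1; apply halfline_int_unique.
apply is_lim_seq_ext with (fun n => F (INR (S n)) - F (/ INR (S n))).
- intros n; symmetry; unfold cut; apply is_RInt_unique.
  pose proof (INR_S_pos n) as Hn; pose proof (Rinv_0_lt_compat _ Hn).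
  apply (is_RInt_derive (V := R_CompleteNormedModule) F f);
    intros x [Hx _]; [apply HF | apply Hf];
    apply Rlt_le_trans with (2 := Hx); now apply Rmin_glb_lt.
- now apply is_lim_seq_minus'.
Qed.

Lemma is_lim_seq_inv_S : is_lim_seq (fun n => / INR (S n)) 0.
Proof.
replace (Finite 0) with (Rbar_inv p_infty) by reflexivity.
apply is_lim_seq_inv; [|discriminate].
apply (is_lim_seq_incr_1 INR), is_lim_seq_INR.
Qed.

Lemma is_lim_seq_at_0 (F : R -> R) : continuous F 0 ->
  is_lim_seq (fun n => F (/ INR (S n))) (F 0).
Proof.
intros H; apply (is_lim_seq_continuous F); [now apply continuity_pt_filterlim|].
apply is_lim_seq_inv_S.
Qed.

Lemma is_lim_seq_atan (x : R) : 0 < x ->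
  is_lim_seq (fun n => atan (INR (S n) / x)) (PI / 2).
Proof.
intros Hx.
apply is_lim_seq_ext with (fun n => PI / 2 - atan (x * / INR (S n))).
- intros n; pose proof (INR_S_pos n) as Hn.
  assert (0 < INR (S n) / x) by (apply Rdiv_lt_0_compat; auto).
  replace (x * / INR (S n)) with (/ (INR (S n) / x)) by (field; lra).
  rewrite atan_inv; auto; ring.
- replace (Finite (PI / 2)) with (Finite (PI / 2 - atan (x * 0)))
    by (rewrite Rmult_0_r, atan_0; f_equal; ring).
  apply is_lim_seq_minus'; [apply is_lim_seq_const|].
  apply (is_lim_seq_at_0 (fun t => atan (x * t))).
  apply continuous_of_ex_derive; now auto_derive.
Qed.

Definition lorentz (k y : R) : R := y ^ 2 / (y ^ 2 + k ^ 2).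

Lemma lorentz_bounds (k y : R) : 0 < y -> 0 <= lorentz k y <= 1.
Proof.
intros Hy; unfold lorentz; assert (0 < y ^ 2) by (apply pow_lt; lra).
assert (0 <= k ^ 2) by apply pow2_ge_0.
split.
- apply Rdiv_le_0_compat; lra.
- apply Rmult_le_reg_r with (y ^ 2 + k ^ 2); [lra|].
  unfold Rdiv; rewrite Rmult_assoc, Rinv_l; lra.
Qed.

Lemma continuous_lorentz (k y : R) : 0 < y -> continuous (lorentz k) y.
Proof.
intros Hy; unfold lorentz; apply continuous_of_ex_derive; auto_derive.
pose proof (pow2_ge_0 k); nra.
Qed.

Lemma admissible_lorentz (k x : R) : 0 < x ->
  admissible (1 * (1 + / x ^ 2)) (fun y => lorentz k y * / (x ^ 2 + y ^ 2)).
Proof.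
intros Hx; apply admissible_mult.
- intros; now apply continuous_lorentz.
- intros y Hy; pose proof (lorentz_bounds k y Hy); apply Rabs_le; lra.
- now apply admissible_inv.
Qed.

Lemma is_lim_seq_rational_decay (x : R) :
  is_lim_seq (fun n => INR (S n) / (x ^ 2 + INR (S n) ^ 2)) 0.
Proof.
apply is_lim_seq_le_le with (fun _ => 0) (fun n => / INR (S n)).
- intros n; pose proof (INR_S_pos n) as Hn; pose proof (pow2_ge_0 x).
  split; [apply Rdiv_le_0_compat; nra|].
  apply Rmult_le_reg_r with (x ^ 2 + INR (S n) ^ 2); [nra|].
  unfold Rdiv; rewrite Rmult_assoc, Rinv_l by nra.
  apply Rmult_le_reg_l with (INR (S n)); auto.
  replace (INR (S n) * (/ INR (S n) * (x ^ 2 + INR (S n) ^ 2))) with (x ^ 2 + INR (S n) ^ 2)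
    by (field; lra).
  nra.
- apply is_lim_seq_const.
- apply is_lim_seq_inv_S.
Qed.

(** Partial fractions in y^2 give a combination of two arctangents. They degenerate for k = 0, where
    [y / k] is a division by zero, and for k = x, where the pole is double; hence the three
    cases. *)
Lemma halfline_int_lorentz (k x : R) : 0 < x -> 0 <= k ->
  halfline_int (fun y => lorentz k y * / (x ^ 2 + y ^ 2)) = PI / (2 * (x + k)).
Proof.
intros Hx Hk.
assert (Hc := proj1 (admissible_lorentz k x Hx)).
destruct (Req_dec k 0) as [->|Hk0]; [|destruct (Req_dec k x) as [->|Hkx]].
- rewrite (halfline_int_antiderivative (fun y => atan (y / x) / x) _ 0 (PI / 2 / x)); auto.
  + field; lra.
  + intros y Hy; unfold lorentz; auto_derive; [lra | field]; repeat split; nra.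
  + replace 0 with (atan (0 / x) / x) by (unfold Rdiv; rewrite Rmult_0_l, atan_0; ring).
    apply (is_lim_seq_at_0 (fun y => atan (y / x) / x)).
    apply continuous_of_ex_derive; auto_derive; lra.
  + apply (is_lim_seq_scal_r _ (/ x) (PI / 2)); now apply is_lim_seq_atan.
- rewrite (halfline_int_antiderivative
    (fun y => / 2 * (atan (y / x) * / x - y / (x ^ 2 + y ^ 2))) _ 0 (/ 2 * (PI / 2 * / x - 0))); auto.
  + field; lra.
  + intros y Hy; unfold lorentz; auto_derive; [repeat split; nra | field]; repeat split; nra.
  + replace 0 with (/ 2 * (atan (0 / x) * / x - 0 / (x ^ 2 + 0 ^ 2)))
      by (unfold Rdiv; rewrite !Rmult_0_l, atan_0; ring).
    apply (is_lim_seq_at_0 (fun y => / 2 * (atan (y / x) * / x - y / (x ^ 2 + y ^ 2)))).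
    apply continuous_of_ex_derive; auto_derive; repeat split; nra.
  + apply (is_lim_seq_scal_l _ (/ 2) (PI / 2 * / x - 0)).
    apply is_lim_seq_minus'; [|apply is_lim_seq_rational_decay].
    apply (is_lim_seq_scal_r _ (/ x) (PI / 2)); now apply is_lim_seq_atan.
- assert (0 < k) by lra.
  assert (Hd : x ^ 2 - k ^ 2 <> 0) by (intros E; assert ((x - k) * (x + k) = 0) as [|]%Rmult_integral by lra; lra).
  set (c := / (x ^ 2 - k ^ 2)).
  rewrite (halfline_int_antiderivative
    (fun y => c * (x * atan (y / x) - k * atan (y / k))) _ 0 (c * (x * (PI / 2) - k * (PI / 2)))); auto.
  + unfold c; field; split; [lra|].
    intros E; apply Hd; assert (E' : x - k = 0) by nra; nra.
  + intros y Hy; unfold lorentz, c; auto_derive; [repeat split; lra | field]; repeat split; nra.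
  + replace 0 with (c * (x * atan (0 / x) - k * atan (0 / k)))
      by (unfold Rdiv; rewrite !Rmult_0_l, atan_0; ring).
    apply (is_lim_seq_at_0 (fun y => c * (x * atan (y / x) - k * atan (y / k)))).
    apply continuous_of_ex_derive; auto_derive; repeat split; lra.
  + apply (is_lim_seq_scal_l _ c (x * (PI / 2) - k * (PI / 2))).
    apply is_lim_seq_minus'.
    * apply (is_lim_seq_scal_l _ x (PI / 2)); now apply is_lim_seq_atan.
    * apply (is_lim_seq_scal_l _ k (PI / 2)); now apply is_lim_seq_atan.
Qed.

Lemma sinh_ge (t : R) : 0 <= t -> t <= sinh t.
Proof.
intros Ht; assert (0 <= sinh t - t); [|lra].
apply (nonneg_of_derive (fun x => sinh x - x) (fun x => cosh x - 1)).
- rewrite sinh_0; ring.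
- intros x _; auto_derive; auto; ring.
- intros x _; pose proof (cosh_ge_1 x); lra.
- auto.
Qed.

Definition csch_weight (y : R) : R := y / sinh (PI * y).

Lemma sinh_PI_pos (y : R) : 0 < y -> 0 < sinh (PI * y).
Proof. intros Hy; apply sinh_pos; pose proof PI_RGT_0; nra. Qed.

Lemma csch_weight_pos (y : R) : 0 < y -> 0 < csch_weight y.
Proof. intros Hy; apply Rdiv_lt_0_compat; auto; now apply sinh_PI_pos. Qed.

Lemma csch_weight_le_1 (y : R) : 0 < y -> csch_weight y <= 1.
Proof.
intros Hy; pose proof (sinh_PI_pos y Hy); pose proof PI2_1.
unfold csch_weight; apply Rmult_le_reg_r with (sinh (PI * y)); auto.
unfold Rdiv; rewrite Rmult_assoc, Rinv_l by lra.
pose proof (sinh_ge (PI * y)); nra.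
Qed.

Lemma continuous_csch_weight (y : R) : 0 < y -> continuous csch_weight y.
Proof.
intros Hy; apply continuous_of_ex_derive; unfold csch_weight; auto_derive.
pose proof (sinh_PI_pos y Hy); lra.
Qed.

Lemma admissible_csch_weight_mult (C : R) (f : R -> R) :
  admissible C f -> admissible C (fun y => csch_weight y * f y).
Proof.
intros Hf; rewrite <- (Rmult_1_l C); apply admissible_mult; auto.
- apply continuous_csch_weight.
- intros y Hy; pose proof (csch_weight_le_1 y Hy); pose proof (csch_weight_pos y Hy).
  apply Rabs_le; lra.
Qed.

Lemma sqr_m1_pow (n : nat) : (-1) ^ n * (-1) ^ n = 1.
Proof.
rewrite <- Rpow_mult_distr; replace (-1 * -1) with 1 by ring; apply pow1.
Qed.

(** Leibniz's criterion. If d(n) denotes the signed half of the block of terms after index n, then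
    [d(n) = q (S n) - d(n + 1)]. Peeling off the first term changes n, so the induction on the
    length is uniform in n. *)
Lemma alternating_partial_bound (q : nat -> R) (m n : nat) :
  (forall k, 0 <= q k) -> (forall k, q (S k) <= q k) ->
  0 <= (-1) ^ S n * (sum_n (fun k => dirichlet_coef k * (-1) ^ k * q k) (n + m)
                     - sum_n (fun k => dirichlet_coef k * (-1) ^ k * q k) n) / 2 <= q (S n).
Proof.
intros H0 Hdec; revert n; induction m as [|m IH]; intros n.
- rewrite Nat.add_0_r, Rminus_diag; unfold Rdiv; rewrite Rmult_0_r, Rmult_0_l; split; auto; lra.
- specialize (IH (S n)); rewrite Nat.add_succ_r; simpl Nat.add in IH.
  set (u := fun k => dirichlet_coef k * (-1) ^ k * q k) in *.
  assert (E : sum_n u (S n) = sum_n u n + 2 * (-1) ^ S n * q (S n)) by apply sum_n_S.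
  rewrite E in IH; change ((-1) ^ S (S n)) with (-1 * (-1) ^ S n) in IH.
  pose proof (Hdec (S n)); pose proof (sqr_m1_pow (S n)) as H1.
  set (s := (-1) ^ S n) in *.
  assert (E' : s * (sum_n u (S (n + m)) - sum_n u n) / 2 =
    q (S n) * (s * s) - -1 * s * (sum_n u (S (n + m)) - (sum_n u n + 2 * s * q (S n))) / 2
    - q (S n) * (s * s) + q (S n) * (s * s)) by field.
  rewrite H1 in E'.
  lra.
Qed.

Lemma lorentz_decreasing (j k y : R) : 0 < y -> 0 <= j <= k -> lorentz k y <= lorentz j y.
Proof.
intros Hy Hjk; unfold lorentz; apply Rmult_le_compat_l; [apply pow2_ge_0|].
assert (0 < y ^ 2) by (apply pow_lt; lra).
apply Rinv_le_contravar; nra.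
Qed.

Lemma csch_tail_bound (y : R) (n : nat) : 0 < y ->
  Rabs (PI * csch_weight y - csch_partial y n) <= 2 * lorentz (INR (S n)) y.
Proof.
intros Hy.
assert (Hm : forall m, Rabs (csch_partial y (m + n) - csch_partial y n)
  <= 2 * lorentz (INR (S n)) y).
{ intros m.
  pose proof (alternating_partial_bound (fun k => lorentz (INR k) y) m n) as H.
  destruct H as [H1 H2].
  - intros k; now apply lorentz_bounds.
  - intros k; apply lorentz_decreasing; auto; split; [apply pos_INR | apply le_INR; lia].
  - rewrite Nat.add_comm; unfold csch_partial; fold (lorentz).
    change (fun k => dirichlet_coef k * (-1) ^ k * (y ^ 2 / (y ^ 2 + INR k ^ 2)))
      with (fun k => dirichlet_coef k * (-1) ^ k * lorentz (INR k) y).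
    set (d := sum_n _ (n + m) - sum_n _ n) in *.
    replace d with ((-1) ^ S n * ((-1) ^ S n * d)) by (rewrite <- Rmult_assoc, sqr_m1_pow; ring).
    rewrite Rabs_mult, pow_1_abs, Rmult_1_l.
    apply Rabs_le; lra. }
apply (is_lim_seq_le (fun m => Rabs (csch_partial y (m + n) - csch_partial y n))
  (fun _ => 2 * lorentz (INR (S n)) y) (Rabs (PI * csch_weight y - csch_partial y n))
  (2 * lorentz (INR (S n)) y)); auto; [|apply is_lim_seq_const].
apply (is_lim_seq_abs _ (PI * csch_weight y - csch_partial y n)).
apply is_lim_seq_minus'; [|apply is_lim_seq_const].
apply (is_lim_seq_incr_n (csch_partial y) n).
replace (PI * csch_weight y) with (PI * y / sinh (PI * y)) by (unfold csch_weight, Rdiv; ring).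
now apply csch_partial_fraction.
Qed.

Definition csch_int (x : R) : R :=
  halfline_int (fun y => csch_weight y * / (x ^ 2 + y ^ 2)).

Lemma halfline_int_lorentz_sum (c : nat -> R) (x : R) (n : nat) : 0 < x ->
  halfline_int (fun y => sum_n (fun k => c k * lorentz (INR k) y) n * / (x ^ 2 + y ^ 2)) =
  sum_n (fun k => c k * (PI / (2 * (x + INR k)))) n /\
  exists C, admissible C (fun y => sum_n (fun k => c k * lorentz (INR k) y) n * / (x ^ 2 + y ^ 2)).
Proof.
intros Hx.
assert (Hadm : forall k, admissible (Rabs (c k) * (1 * (1 + / x ^ 2)))
  (fun y => c k * (lorentz (INR k) y * / (x ^ 2 + y ^ 2)))).
{ intros k; now apply admissible_scal, admissible_lorentz. }
assert (E : forall y, sum_n (fun k => c k * (lorentz (INR k) y * / (x ^ 2 + y ^ 2))) n =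
  sum_n (fun k => c k * lorentz (INR k) y) n * / (x ^ 2 + y ^ 2)).
{ intros y; induction n as [|n IH]; [rewrite !sum_O; real_eq; ring|].
  rewrite !sum_n_S, IH; real_eq; ring. }
split.
- rewrite <- (halfline_int_ext _ _ (fun y _ => E y)).
  rewrite (halfline_int_sum_n _ (fun k y => c k * (lorentz (INR k) y * / (x ^ 2 + y ^ 2))) n Hadm).
  apply sum_n_ext; intros k.
  rewrite (halfline_int_scal (1 * (1 + / x ^ 2))) by now apply admissible_lorentz.
  rewrite halfline_int_lorentz; auto using pos_INR.
- eexists; apply (admissible_ext _ _ _ (fun y _ => E y)).
  exact (admissible_sum_n _ _ n Hadm).
Qed.

Lemma csch_int_series (x : R) : 0 < x ->
  is_lim_seq (sum_n (fun k => dirichlet_coef k * (-1) ^ k * / (2 * (x + INR k)))) (csch_int x).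
Proof.
intros Hx; pose proof PI_RGT_0 as HPI.
set (a := sum_n (fun k => dirichlet_coef k * (-1) ^ k * / (2 * (x + INR k)))).
assert (B : forall n, Rabs (csch_int x - a n) <= / INR (S n)).
{ intros n.
  destruct (halfline_int_lorentz_sum (fun k => dirichlet_coef k * (-1) ^ k) x n Hx) as [E [C HC]].
  change (fun y => sum_n (fun k => dirichlet_coef k * (-1) ^ k * lorentz (INR k) y) n
    * / (x ^ 2 + y ^ 2)) with (fun y => csch_partial y n * / (x ^ 2 + y ^ 2)) in E, HC.
  assert (HW : admissible (1 + / x ^ 2) (fun y => csch_weight y * / (x ^ 2 + y ^ 2)))
    by now apply admissible_csch_weight_mult, admissible_inv.
  assert (E1 : PI * csch_int x - PI * a n = halfline_int
    (fun y => PI * (csch_weight y * / (x ^ 2 + y ^ 2)) - csch_partial y n * / (x ^ 2 + y ^ 2))).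
  { rewrite (halfline_int_minus (Rabs PI * (1 + / x ^ 2)) C); auto; [|now apply admissible_scal].
    rewrite (halfline_int_scal (1 + / x ^ 2)), E by auto; unfold csch_int, a; f_equal.
    rewrite <- (sum_n_mult_l (K := R_AbsRing)); apply sum_n_ext; intros k.
    unfold mult; simpl; real_eq; pose proof (pos_INR k); field; lra. }
  assert (HD : admissible (Rabs PI * (1 + / x ^ 2) + C)
    (fun y => PI * (csch_weight y * / (x ^ 2 + y ^ 2)) - csch_partial y n * / (x ^ 2 + y ^ 2)))
    by (apply admissible_minus; auto; now apply admissible_scal).
  assert (HL := admissible_lorentz (INR (S n)) x Hx).
  assert (HI := halfline_int_lorentz (INR (S n)) x Hx (pos_INR _)).
  assert (Hpt : forall y, 0 < y ->
    Rabs (PI * (csch_weight y * / (x ^ 2 + y ^ 2)) - csch_partial y n * / (x ^ 2 + y ^ 2))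
    <= 2 * (lorentz (INR (S n)) y * / (x ^ 2 + y ^ 2))).
  { intros y Hy; pose proof (csch_tail_bound y n Hy).
    replace (PI * (csch_weight y * / (x ^ 2 + y ^ 2)) - csch_partial y n * / (x ^ 2 + y ^ 2))
      with ((PI * csch_weight y - csch_partial y n) * / (x ^ 2 + y ^ 2)) by ring.
    assert (0 < / (x ^ 2 + y ^ 2)) by (apply Rinv_0_lt_compat; nra).
    rewrite Rabs_mult, (Rabs_right (/ _)), <- Rmult_assoc by lra.
    apply Rmult_le_compat_r; lra. }
  assert (HI2 : halfline_int (fun y => 2 * (lorentz (INR (S n)) y * / (x ^ 2 + y ^ 2))) =
    PI / (x + INR (S n))).
  { rewrite (halfline_int_scal _ 2 _ HL), HI; pose proof (pos_INR (S n)); field; lra. }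
  assert (HI2' : halfline_int (fun y => -2 * (lorentz (INR (S n)) y * / (x ^ 2 + y ^ 2))) =
    - (PI / (x + INR (S n)))).
  { rewrite (halfline_int_scal _ (-2) _ HL), HI; pose proof (pos_INR (S n)); field; lra. }
  assert (U : PI * csch_int x - PI * a n <= PI / (x + INR (S n))).
  { rewrite E1, <- HI2; eapply halfline_int_le; [exact HD | exact (admissible_scal _ 2 _ HL) |].
    intros y Hy; apply Rle_trans with (2 := Hpt y Hy), Rle_abs. }
  assert (L : - (PI / (x + INR (S n))) <= PI * csch_int x - PI * a n).
  { rewrite E1, <- HI2'; eapply halfline_int_le; [exact (admissible_scal _ (-2) _ HL) | exact HD |].
    intros y Hy; pose proof (Hpt y Hy) as H; apply Rabs_le_between in H; lra. }
  pose proof (INR_S_pos n) as Hn.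
  assert (K : PI / (x + INR (S n)) <= PI * / INR (S n)).
  { apply Rmult_le_compat_l; [lra|]; apply Rinv_le_contravar; lra. }
  apply Rabs_le; split; apply Rmult_le_reg_l with PI; lra. }
apply is_lim_seq_ext with (fun n => csch_int x - (csch_int x - a n)); [intros; ring|].
replace (Finite (csch_int x)) with (Finite (csch_int x - 0)) by (f_equal; ring).
apply is_lim_seq_minus'; [apply is_lim_seq_const|].
apply is_lim_seq_abs_0, is_lim_seq_le_le with (fun _ => 0) (fun n => / INR (S n)).
- intros n; split; [apply Rabs_pos | apply B].
- apply is_lim_seq_const.
- apply is_lim_seq_inv_S.
Qed.

(* [alt_harmonic x] is the sum over k of (-1)^k / (x + k); the integral form makes
   its divided differences available as integrals too. *)
Definition alt_harmonic (x : R) : R := csch_int x + / (2 * x).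

(** Terms of the series at x and x + 1 with the same denominator have opposite signs, so the sum of
    the two partial sums collapses to its end terms. *)
Lemma alt_harmonic_succ (x : R) : 0 < x -> alt_harmonic x + alt_harmonic (x + 1) = / x.
Proof.
intros Hx.
set (a := fun x => sum_n (fun k => dirichlet_coef k * (-1) ^ k * / (2 * (x + INR k)))).
assert (E : forall n, a x n + a (x + 1) n = / (2 * x) - / (2 * (x + 1)) + (-1) ^ n * / (x + INR (S n))).
{ unfold a; induction n as [|n IH].
  - rewrite !sum_O; simpl; field; lra.
  - rewrite !sum_n_S; cbv beta.
    revert IH.
    generalize (sum_n (fun k => dirichlet_coef k * (-1) ^ k * / (2 * (x + INR k))) n)
      (sum_n (fun k => dirichlet_coef k * (-1) ^ k * / (2 * (x + 1 + INR k))) n).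
    intros u v IH; change R in u, v.
    replace (u + _ + (v + _)) with ((u + v) + (dirichlet_coef (S n) * (-1) ^ S n * / (2 * (x + INR (S n)))
      + dirichlet_coef (S n) * (-1) ^ S n * / (2 * (x + 1 + INR (S n))))) by ring.
    rewrite IH, (S_INR (S n)); change (dirichlet_coef (S n)) with 2.
    change ((-1) ^ S n) with (-1 * (-1) ^ n).
    pose proof (INR_S_pos n) as Hc; revert Hc; generalize (INR (S n)) as c; intros c Hc.
    field; lra. }
assert (L1 := csch_int_series x Hx); assert (L2 := csch_int_series (x + 1) ltac:(lra)).
pose proof (is_lim_seq_plus' _ _ _ _ L1 L2) as L3.
assert (L4 : is_lim_seq (fun n => a x n + a (x + 1) n) (/ (2 * x) - / (2 * (x + 1)))).
{ apply is_lim_seq_ext with (fun n => / (2 * x) - / (2 * (x + 1)) + (-1) ^ n * / (x + INR (S n))).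
  { intros n; now rewrite E. }
  replace (Finite (/ (2 * x) - / (2 * (x + 1)))) with (Finite (/ (2 * x) - / (2 * (x + 1)) + 0))
    by (f_equal; ring).
  apply is_lim_seq_plus'; [apply is_lim_seq_const|].
  apply is_lim_seq_abs_0, is_lim_seq_le_le with (fun _ => 0) (fun n => / INR (S n)).
  - intros n; split; [apply Rabs_pos|].
    pose proof (INR_S_pos n).
    rewrite Rabs_mult, pow_1_abs, Rmult_1_l, Rabs_right.
    + apply Rinv_le_contravar; lra.
    + apply Rle_ge, Rlt_le, Rinv_0_lt_compat; lra.
  - apply is_lim_seq_const.
  - apply is_lim_seq_inv_S. }
apply is_lim_seq_unique in L3; apply is_lim_seq_unique in L4.
unfold a in L4; rewrite L3 in L4; injection L4 as L4.
unfold alt_harmonic.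
replace (csch_int x + / (2 * x) + (csch_int (x + 1) + / (2 * (x + 1)))) with
  ((csch_int x + csch_int (x + 1)) + (/ (2 * x) + / (2 * (x + 1)))) by ring.
rewrite L4; field; lra.
Qed.

Lemma csch_int_pos (x : R) : 0 < x -> 0 < csch_int x.
Proof.
intros Hx; apply (halfline_int_pos (1 + / x ^ 2)).
- now apply admissible_csch_weight_mult, admissible_inv.
- intros y Hy; apply Rmult_lt_0_compat; [now apply csch_weight_pos|].
  apply Rinv_0_lt_compat; nra.
Qed.

(** Positivity of the integral gives the lower bound, and the functional equation turns positivity
    at x + 1 into the upper one. *)
Lemma alt_harmonic_bounds (x : R) : 0 < x -> / (2 * x) < alt_harmonic x < / x.
Proof.
intros Hx.
assert (forall x, 0 < x -> / (2 * x) < alt_harmonic x).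
{ intros z Hz; unfold alt_harmonic; pose proof (csch_int_pos z Hz); lra. }
split; auto.
pose proof (H (x + 1) ltac:(lra)); pose proof (alt_harmonic_succ x Hx).
assert (0 < / (2 * (x + 1))) by (apply Rinv_0_lt_compat; lra).
lra.
Qed.

(** The terms of the tail are compared with 1 / (c (c + 1)), which telescopes. The price is the
    growth y^2 of the bound, so it can only be integrated against a function decaying like
    y^(-4). *)
Lemma coth_tail_bound (y : R) (n : nat) : 0 < y ->
  Rabs (PI * y * cosh (PI * y) / sinh (PI * y) - coth_partial y (S n)) <= 2 * y ^ 2 / INR (S n).
Proof.
intros Hy; assert (Hy2 : 0 < y ^ 2) by (apply pow_lt; lra).
assert (Hm : forall m, 0 <= coth_partial y (m + S n) - coth_partial y (S n)
  <= 2 * y ^ 2 * (/ INR (S n) - / INR (m + S n))).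
{ induction m as [|m IH].
  - simpl Nat.add; rewrite !Rminus_diag; lra.
  - unfold coth_partial in *; change (S m + S n)%nat with (S (m + S n)).
    rewrite sum_n_S; change (dirichlet_coef (S (m + S n))) with 2.
    assert (Hp : 0 < INR (m + S n)) by (apply lt_0_INR; lia).
    rewrite S_INR; revert IH Hp; generalize (INR (m + S n)) as c; intros c IH Hc.
    assert (0 <= y ^ 2 / (y ^ 2 + (c + 1) ^ 2)) by (apply Rdiv_le_0_compat; nra).
    assert (y ^ 2 / (y ^ 2 + (c + 1) ^ 2) <= y ^ 2 * (/ c - / (c + 1))).
    { replace (/ c - / (c + 1)) with (/ (c * (c + 1))) by (field; lra).
      apply Rmult_le_compat_l; [lra|]; apply Rinv_le_contravar; nra. }
    lra. }
assert (Hb : forall m, Rabs (coth_partial y (m + S n) - coth_partial y (S n)) <= 2 * y ^ 2 / INR (S n)).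
{ intros m; destruct (Hm m) as [H1 H2].
  assert (0 < / INR (m + S n)) by (apply Rinv_0_lt_compat, lt_0_INR; lia).
  rewrite Rabs_right by lra; unfold Rdiv; nra. }
apply (is_lim_seq_le (fun m => Rabs (coth_partial y (m + S n) - coth_partial y (S n)))
  (fun _ => 2 * y ^ 2 / INR (S n))
  (Rabs (PI * y * cosh (PI * y) / sinh (PI * y) - coth_partial y (S n)))
  (2 * y ^ 2 / INR (S n)) Hb); [|apply is_lim_seq_const].
apply (is_lim_seq_abs _ (PI * y * cosh (PI * y) / sinh (PI * y) - coth_partial y (S n))).
apply is_lim_seq_minus'; [|apply is_lim_seq_const].
apply (is_lim_seq_incr_n (coth_partial y) (S n)).
now apply coth_partial_fraction.
Qed.

(** Here [exp(-t) / sinh t = coth t - 1] with t = PI y, so this is the integral that couples the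
    coth expansion with a logarithm. *)
Definition exp_csch_int (x : R) : R :=
  halfline_int (fun y => csch_weight y * (exp (- (PI * y)) * / (x ^ 2 + y ^ 2))).

Lemma exp_weight_bounds (y : R) : 0 < y -> 0 < exp (- (PI * y)) < 1.
Proof.
intros Hy; split; [apply exp_pos|].
rewrite <- exp_0; apply exp_increasing; pose proof PI_RGT_0; nra.
Qed.

Lemma admissible_exp_mult (C : R) (f : R -> R) :
  admissible C f -> admissible C (fun y => exp (- (PI * y)) * f y).
Proof.
intros Hf; rewrite <- (Rmult_1_l C); apply admissible_mult; auto.
- intros y Hy; apply continuous_of_ex_derive; now auto_derive.
- intros y Hy; pose proof (exp_weight_bounds y Hy); apply Rabs_le; lra.
Qed.

Lemma halfline_int_log (x : R) : 0 < x ->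
  halfline_int (fun y => y * (/ (x ^ 2 + y ^ 2) - / ((x + 1) ^ 2 + y ^ 2))) = ln (1 + / x) /\
  exists C, admissible C (fun y => y * (/ (x ^ 2 + y ^ 2) - / ((x + 1) ^ 2 + y ^ 2))).
Proof.
intros Hx.
assert (Hc : forall y, 0 < y ->
  continuous (fun y => y * (/ (x ^ 2 + y ^ 2) - / ((x + 1) ^ 2 + y ^ 2))) y).
{ intros y Hy; apply continuous_of_ex_derive; auto_derive; split; nra. }
assert (Hpx : 0 < x ^ 2) by (apply pow_lt; lra).
assert (Hpx1 : 0 < (x + 1) ^ 2) by (apply pow_lt; lra).
split.
- rewrite (halfline_int_antiderivative
    (fun y => / 2 * ln ((x ^ 2 + y ^ 2) / ((x + 1) ^ 2 + y ^ 2))) _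
    (/ 2 * ln ((x ^ 2 + 0 ^ 2) / ((x + 1) ^ 2 + 0 ^ 2))) (/ 2 * ln 1)); auto.
  + replace ((x ^ 2 + 0 ^ 2) / ((x + 1) ^ 2 + 0 ^ 2)) with (/ ((1 + / x) * (1 + / x)))
      by (field; lra).
    assert (0 < / x) by (apply Rinv_0_lt_compat; lra).
    rewrite ln_1, ln_Rinv, ln_mult by nra; field.
  + intros y Hy; auto_derive.
    * split; [nra | split; [|auto]]; apply Rdiv_lt_0_compat; nra.
    * field; repeat split; nra.
  + apply (is_lim_seq_at_0 (fun y => / 2 * ln ((x ^ 2 + y ^ 2) / ((x + 1) ^ 2 + y ^ 2)))).
    apply continuous_of_ex_derive; auto_derive.
    split; [nra | split; [|auto]]; apply Rdiv_lt_0_compat; nra.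
  + apply (is_lim_seq_scal_l _ (/ 2) (ln 1)).
    (* Dividing by the square of the variable turns the limit at infinity into a value at 0. *)
    apply is_lim_seq_ext with
      (fun n => ln (((x * / INR (S n)) ^ 2 + 1) / (((x + 1) * / INR (S n)) ^ 2 + 1))).
    { intros n; pose proof (INR_S_pos n) as Hn; revert Hn; generalize (INR (S n)) as c.
      intros c Hn; f_equal; field; repeat split; nra. }
    replace (ln 1) with (ln (((x * 0) ^ 2 + 1) / (((x + 1) * 0) ^ 2 + 1))) by (f_equal; field).
    apply (is_lim_seq_at_0 (fun t => ln (((x * t) ^ 2 + 1) / (((x + 1) * t) ^ 2 + 1)))).
    apply continuous_of_ex_derive; auto_derive.
    split; [nra | split; [|auto]]; apply Rdiv_lt_0_compat; nra.
- exists (/ (x + 1) * (2 * x + 1) * (1 + / x ^ 2)).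
  apply admissible_ext with
    (fun y => y * (2 * x + 1) / ((x + 1) ^ 2 + y ^ 2) * / (x ^ 2 + y ^ 2)).
  + intros y Hy; field; split; nra.
  + apply admissible_mult.
    * intros y Hy; apply continuous_of_ex_derive; auto_derive; nra.
    * intros y Hy; rewrite Rabs_right.
      -- apply Rmult_le_reg_r with (((x + 1) ^ 2 + y ^ 2) * (x + 1)); [nra|].
         replace (y * (2 * x + 1) / ((x + 1) ^ 2 + y ^ 2) * (((x + 1) ^ 2 + y ^ 2) * (x + 1)))
           with (y * (x + 1) * (2 * x + 1)) by (field; nra).
         replace (/ (x + 1) * (2 * x + 1) * (((x + 1) ^ 2 + y ^ 2) * (x + 1)))
           with (((x + 1) ^ 2 + y ^ 2) * (2 * x + 1)) by (field; lra).
         apply Rmult_le_compat_r; nra.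
      -- apply Rle_ge, Rdiv_le_0_compat; nra.
    * now apply admissible_inv.
Qed.

(** The integral splits into a part with [y * coth(PI y)] and a part with y, each of which would
    diverge for a single x. The difference [D] decays like y^(-4), which makes both converge and
    absorbs the factor y^2 of [coth_tail_bound]. The coth part telescopes to rational terms, and the
    other part is the logarithm. *)
Lemma exp_csch_int_diff_1 (x : R) : 0 < x ->
  exp_csch_int x - exp_csch_int (x + 1) = / (2 * x) + / (2 * (x + 1)) - ln (1 + / x).
Proof.
intros Hx; pose proof PI_RGT_0 as HPI.
assert (Hx1 : 0 < x + 1) by lra.
set (D := fun y => / (x ^ 2 + y ^ 2) - / ((x + 1) ^ 2 + y ^ 2)).
assert (HDy2 : forall y, 0 < y -> y ^ 2 * D y = (2 * x + 1) * (lorentz (x + 1) y * / (x ^ 2 + y ^ 2))).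
{ intros y Hy; unfold D, lorentz; field; repeat split; nra. }
set (c2 := halfline_int (fun y => y ^ 2 * D y)).
assert (HA2 : admissible (Rabs (2 * x + 1) * (1 * (1 + / x ^ 2))) (fun y => y ^ 2 * D y)).
{ apply (admissible_ext _ (fun y => (2 * x + 1) * (lorentz (x + 1) y * / (x ^ 2 + y ^ 2)))).
  - intros y Hy; now rewrite HDy2.
  - now apply admissible_scal, admissible_lorentz. }
destruct (halfline_int_log x Hx) as [Hlog [CL HL]]; fold D in Hlog, HL.
assert (HE : forall z, 0 < z -> admissible (1 + / z ^ 2)
  (fun y => csch_weight y * (exp (- (PI * y)) * / (z ^ 2 + y ^ 2)))).
{ intros z Hz; now apply admissible_csch_weight_mult, admissible_exp_mult, admissible_inv. }
assert (Ed : exp_csch_int x - exp_csch_int (x + 1) =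
  halfline_int (fun y => csch_weight y * exp (- (PI * y)) * D y)).
{ unfold exp_csch_int; rewrite <- (halfline_int_minus _ _ _ _ (HE x Hx) (HE (x + 1) Hx1)).
  apply halfline_int_ext; intros; unfold D; ring. }
assert (HEd : exists C, admissible C (fun y => csch_weight y * exp (- (PI * y)) * D y)).
{ eexists; eapply admissible_ext; [|exact (admissible_minus _ _ _ _ (HE x Hx) (HE (x + 1) Hx1))].
  intros; unfold D; ring. }
destruct HEd as [CE HEd].
set (v := / (2 * x) + / (2 * (x + 1)) - ln (1 + / x)).
assert (B : forall n, Rabs (PI * (exp_csch_int x - exp_csch_int (x + 1)) -
  PI * (v - / (x + INR (S (S n))))) <= 2 * c2 * / INR (S n)).
{ intros n.
  destruct (halfline_int_lorentz_sum dirichlet_coef x (S n) Hx) as [E1 [C1 H1]].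
  destruct (halfline_int_lorentz_sum dirichlet_coef (x + 1) (S n) Hx1) as [E2 [C2 H2]].
  change (fun y => sum_n (fun k => dirichlet_coef k * lorentz (INR k) y) (S n)
    * / (x ^ 2 + y ^ 2)) with (fun y => coth_partial y (S n) * / (x ^ 2 + y ^ 2)) in E1, H1.
  change (fun y => sum_n (fun k => dirichlet_coef k * lorentz (INR k) y) (S n)
    * / ((x + 1) ^ 2 + y ^ 2)) with (fun y => coth_partial y (S n) * / ((x + 1) ^ 2 + y ^ 2)) in E2, H2.
  assert (Hsum : sum_n (fun k => dirichlet_coef k * (PI / (2 * (x + INR k)))) (S n) -
    sum_n (fun k => dirichlet_coef k * (PI / (2 * (x + 1 + INR k)))) (S n) =
    PI * (/ (2 * x) + / (2 * (x + 1)) - / (x + INR (S (S n))))).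
  { generalize (S n); clear - Hx; intros m; induction m as [|m IH].
    - rewrite !sum_O; simpl; real_eq; field; lra.
    - rewrite !sum_n_S; cbv beta; revert IH.
      generalize (sum_n (fun k => dirichlet_coef k * (PI / (2 * (x + INR k)))) m)
        (sum_n (fun k => dirichlet_coef k * (PI / (2 * (x + 1 + INR k)))) m).
      intros u w IH; change R in u, w.
      assert (IH' : u = w + PI * (/ (2 * x) + / (2 * (x + 1)) - / (x + INR (S m)))) by lra.
      rewrite IH', (S_INR (S m)); change (dirichlet_coef (S m)) with 2.
      pose proof (INR_S_pos m) as Hc; revert Hc; generalize (INR (S m)) as c; intros c Hc.
      field; lra. }
  pose proof (admissible_minus _ _ _ _ H1 H2) as H3.
  pose proof (halfline_int_minus _ _ _ _ H1 H2) as E3; cbv beta in H3, E3; rewrite E1, E2, Hsum in E3.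
  pose proof (admissible_minus _ _ _ _ H3 (admissible_scal _ PI _ HL)) as H4.
  pose proof (halfline_int_minus _ _ _ _ H3 (admissible_scal _ PI _ HL)) as E4; cbv beta in H4, E4.
  rewrite E3, (halfline_int_scal _ _ _ HL), Hlog in E4.
  pose proof (admissible_minus _ _ _ _ (admissible_scal _ PI _ HEd) H4) as H5.
  pose proof (halfline_int_minus _ _ _ _ (admissible_scal _ PI _ HEd) H4) as E5; cbv beta in H5, E5.
  rewrite E4, (halfline_int_scal _ _ _ HEd), <- Ed in E5.
  replace (PI * (exp_csch_int x - exp_csch_int (x + 1)) - PI * (v - / (x + INR (S (S n))))) with
    (PI * (exp_csch_int x - exp_csch_int (x + 1)) -
     (PI * (/ (2 * x) + / (2 * (x + 1)) - / (x + INR (S (S n)))) - PI * ln (1 + / x)))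
    by (unfold v; ring).
  rewrite <- E5.
  replace (2 * c2 * / INR (S n)) with (2 * / INR (S n) * c2) by ring.
  unfold c2; rewrite <- (halfline_int_scal _ (2 * / INR (S n)) _ HA2).
  apply (halfline_int_abs_le _ _ _ _ H5 (admissible_scal _ (2 * / INR (S n)) _ HA2)).
  intros y Hy.
  assert (HD : 0 < D y).
  { unfold D; assert (/ ((x + 1) ^ 2 + y ^ 2) < / (x ^ 2 + y ^ 2)); [|lra].
    apply Rinv_lt_contravar; [apply Rmult_lt_0_compat|]; nra. }
  pose proof (sinh_PI_pos y Hy) as Hs.
  replace (PI * (csch_weight y * exp (- (PI * y)) * D y) - _) with
    ((PI * y * cosh (PI * y) / sinh (PI * y) - coth_partial y (S n)) * D y).
  - rewrite Rabs_mult, (Rabs_right (D y)) by lra.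
    pose proof (coth_tail_bound y n Hy).
    replace (2 * / INR (S n) * (y ^ 2 * D y)) with (2 * y ^ 2 / INR (S n) * D y)
      by (unfold Rdiv; ring).
    apply Rmult_le_compat_r; lra.
  - assert (Ex : exp (- (PI * y)) = cosh (PI * y) - sinh (PI * y))
      by (unfold cosh, sinh; field).
    rewrite Ex; unfold csch_weight; unfold D; field; repeat split; nra. }
assert (L1 : is_lim_seq (fun n => PI * (v - / (x + INR (S (S n))))) (PI * v)).
{ replace (PI * v) with (PI * (v - 0)) by ring.
  apply (is_lim_seq_scal_l _ PI (v - 0)), is_lim_seq_minus'; [apply is_lim_seq_const|].
  apply is_lim_seq_le_le with (fun _ => 0) (fun n => / INR (S n)).
  - intros n; pose proof (INR_S_pos n); rewrite (S_INR (S n)).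
    split; [apply Rlt_le, Rinv_0_lt_compat; lra | apply Rinv_le_contravar; lra].
  - apply is_lim_seq_const.
  - apply is_lim_seq_inv_S. }
assert (L2 : is_lim_seq (fun n => PI * (v - / (x + INR (S (S n)))))
  (PI * (exp_csch_int x - exp_csch_int (x + 1)))).
{ set (w := PI * (exp_csch_int x - exp_csch_int (x + 1))) in *.
  apply is_lim_seq_ext with (fun n => w - (w - PI * (v - / (x + INR (S (S n)))))); [intros; ring|].
  replace (Finite w) with (Finite (w - 0)) by (f_equal; ring).
  apply is_lim_seq_minus'; [apply is_lim_seq_const|].
  apply is_lim_seq_abs_0, is_lim_seq_le_le with (fun _ => 0) (fun n => 2 * c2 * / INR (S n)).
  - intros n; split; [apply Rabs_pos | apply B].
  - apply is_lim_seq_const.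
  - replace (Finite 0) with (Rbar_mult (2 * c2) 0) by (simpl; f_equal; ring).
    apply is_lim_seq_scal_l, is_lim_seq_inv_S. }
apply is_lim_seq_unique in L1; apply is_lim_seq_unique in L2.
rewrite L1 in L2; injection L2 as L2.
apply Rmult_eq_reg_l with PI; [symmetry; exact L2 | lra].
Qed.

Lemma exp_csch_int_diff (x : R) : 0 < x ->
  exp_csch_int x - exp_csch_int (x + 2) =
  / (2 * x) + / (x + 1) + / (2 * (x + 2)) - ln (1 + 2 / x).
Proof.
intros Hx.
pose proof (exp_csch_int_diff_1 x Hx) as H1.
pose proof (exp_csch_int_diff_1 (x + 1) ltac:(lra)) as H2.
replace (x + 1 + 1) with (x + 2) in H2 by ring.
assert (0 < / x) by (apply Rinv_0_lt_compat; lra).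
assert (0 < / (x + 1)) by (apply Rinv_0_lt_compat; lra).
assert (E : ln (1 + 2 / x) = ln (1 + / x) + ln (1 + / (x + 1))).
{ rewrite <- ln_mult by lra; f_equal; field; lra. }
assert (E2 : / (x + 1) = / (2 * (x + 1)) + / (2 * (x + 1))) by (field; lra).
lra.
Qed.

(** * Divided differences of the alternating harmonic function *)

Definition csch_int2 (x m : R) : R :=
  halfline_int (fun y => csch_weight y * (/ (x ^ 2 + y ^ 2) * / (m ^ 2 + y ^ 2))).

(* The divided difference of [alt_harmonic], written so that it keeps its meaning
   on the diagonal. *)
Definition alt_harmonic2 (x m : R) : R := (x + m) * csch_int2 x m + / (2 * x * m).

Lemma inv_sqr_bounds (x y : R) : 0 < x -> 0 < y -> 0 < / (x ^ 2 + y ^ 2) <= / x ^ 2.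
Proof.
intros Hx Hy; assert (0 < x ^ 2) by (apply pow_lt; lra).
assert (0 < y ^ 2) by (apply pow_lt; lra).
split; [apply Rinv_0_lt_compat | apply Rinv_le_contravar]; lra.
Qed.

Lemma continuous_inv_sqr (x y : R) : 0 < x -> 0 < y -> continuous (fun y => / (x ^ 2 + y ^ 2)) y.
Proof. intros Hx; now apply admissible_inv. Qed.

Lemma admissible_inv2 (x m : R) : 0 < x -> 0 < m ->
  admissible (/ x ^ 2 * (1 + / m ^ 2)) (fun y => / (x ^ 2 + y ^ 2) * / (m ^ 2 + y ^ 2)).
Proof.
intros Hx Hm; apply admissible_mult.
- intros; now apply continuous_inv_sqr.
- intros y Hy; pose proof (inv_sqr_bounds x y Hx Hy); rewrite Rabs_right; lra.
- now apply admissible_inv.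
Qed.

Lemma csch_int2_sym (x m : R) : csch_int2 x m = csch_int2 m x.
Proof. apply halfline_int_ext; intros; ring. Qed.

Lemma alt_harmonic2_sym (x m : R) : alt_harmonic2 x m = alt_harmonic2 m x.
Proof.
unfold alt_harmonic2; rewrite csch_int2_sym; f_equal; [ring | f_equal; ring].
Qed.

Lemma alt_harmonic2_mult (x m : R) : 0 < x -> 0 < m ->
  (m - x) * alt_harmonic2 x m = alt_harmonic x - alt_harmonic m.
Proof.
intros Hx Hm.
assert (H : (m ^ 2 - x ^ 2) * csch_int2 x m = csch_int x - csch_int m).
{ unfold csch_int, csch_int2.
  rewrite <- (halfline_int_minus (1 + / x ^ 2) (1 + / m ^ 2))
    by now apply admissible_csch_weight_mult, admissible_inv.
  rewrite <- (halfline_int_scal (/ x ^ 2 * (1 + / m ^ 2)))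
    by now apply admissible_csch_weight_mult, admissible_inv2.
  apply halfline_int_ext; intros y Hy; field; split; nra. }
unfold alt_harmonic2, alt_harmonic.
rewrite Rmult_plus_distr_l, <- Rmult_assoc.
replace ((m - x) * (x + m)) with (m ^ 2 - x ^ 2) by ring.
rewrite H; field; lra.
Qed.

(** The difference of the two integrands contains the factor [x ^ 2 - m ^ 2], and the cofactor is
    admissible uniformly in m between x and x + 1; [K] collects the bounds of the factors. *)
Lemma csch_int2_lim (x : R) : 0 < x ->
  is_lim_seq (fun j => csch_int2 x (x + / INR (S j))) (csch_int2 x x).
Proof.
intros Hx; assert (Hx2 : 0 < x ^ 2) by (apply pow_lt; lra).
set (K := 4 * ((2 * x + 1) * (/ x ^ 2 * (/ x ^ 2 * (1 + / x ^ 2))))).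
assert (B : forall m, x <= m <= x + 1 -> Rabs (csch_int2 x m - csch_int2 x x) <= K * (m - x)).
{ intros m Hm; unfold csch_int2.
  pose proof (admissible_csch_weight_mult _ _ (admissible_inv2 x m Hx ltac:(lra))) as H1.
  pose proof (admissible_csch_weight_mult _ _ (admissible_inv2 x x Hx Hx)) as H2.
  rewrite <- (halfline_int_minus _ _ _ _ H1 H2).
  replace (K * (m - x)) with (4 * ((m - x) * (2 * x + 1) * / x ^ 2 * (/ x ^ 2 * (1 + / x ^ 2))))
    by (unfold K; ring).
  apply halfline_int_abs.
  apply admissible_ext with
    (fun y => (x ^ 2 - m ^ 2) * / (m ^ 2 + y ^ 2)
      * (csch_weight y * (/ (x ^ 2 + y ^ 2) * / (x ^ 2 + y ^ 2)))).
  { intros y Hy; field; repeat split; nra. }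
  apply admissible_mult; auto.
  - intros y Hy; apply (continuous_mult (K := R_AbsRing) (fun _ => x ^ 2 - m ^ 2)).
    + apply continuous_const.
    + apply continuous_inv_sqr; lra.
  - intros y Hy; pose proof (inv_sqr_bounds m y ltac:(lra) Hy) as Hb.
    assert (/ m ^ 2 <= / x ^ 2) by (apply Rinv_le_contravar; nra).
    rewrite Rabs_mult, (Rabs_right (/ _)) by lra.
    apply Rmult_le_compat; [apply Rabs_pos | lra | | lra].
    rewrite Rabs_left1 by nra; nra. }
apply is_lim_seq_ext with
  (fun j => (csch_int2 x (x + / INR (S j)) - csch_int2 x x) + csch_int2 x x); [intros; ring|].
replace (Finite (csch_int2 x x)) with (Finite (0 + csch_int2 x x)) by (f_equal; ring).
apply is_lim_seq_plus'; [|apply is_lim_seq_const].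
apply is_lim_seq_abs_0, is_lim_seq_le_le with (fun _ => 0) (fun j => K * / INR (S j)).
- intros j; split; [apply Rabs_pos|].
  assert (0 < / INR (S j) <= 1).
  { pose proof (INR_S_ge1 j); split; [apply Rinv_0_lt_compat; lra|].
    rewrite <- Rinv_1; apply Rinv_le_contravar; lra. }
  replace (K * / INR (S j)) with (K * ((x + / INR (S j)) - x)) by ring.
  apply B; lra.
- apply is_lim_seq_const.
- replace (Finite 0) with (Rbar_mult K 0) by (simpl; f_equal; ring).
  apply is_lim_seq_scal_l, is_lim_seq_inv_S.
Qed.

Lemma alt_harmonic2_lim (x : R) : 0 < x ->
  is_lim_seq (fun j => alt_harmonic2 x (x + / INR (S j))) (alt_harmonic2 x x).
Proof.
intros Hx; unfold alt_harmonic2; apply is_lim_seq_plus'.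
- apply is_lim_seq_mult'; [|now apply csch_int2_lim].
  replace (x + x) with (x + (x + 0)) by ring.
  apply is_lim_seq_plus'; [apply is_lim_seq_const|].
  apply is_lim_seq_plus'; [apply is_lim_seq_const | apply is_lim_seq_inv_S].
- replace (/ (2 * x * x)) with (/ (2 * x * (x + 0))) by (f_equal; ring).
  apply (is_lim_seq_at_0 (fun t => / (2 * x * (x + t)))).
  apply continuous_of_ex_derive; auto_derive; nra.
Qed.

(** Off the diagonal this is the functional equation of [alt_harmonic] divided by m - x. The
    diagonal is reached by continuity; it does occur later, where both arguments run through the odd
    numbers. *)
Lemma alt_harmonic2_succ (x m : R) : 0 < x -> 0 < m ->
  alt_harmonic2 x m + alt_harmonic2 (x + 1) (m + 1) = / (x * m).
Proof.
intros Hx Hm.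
assert (Hne : forall m, 0 < m -> m <> x ->
  alt_harmonic2 x m + alt_harmonic2 (x + 1) (m + 1) = / (x * m)).
{ clear m Hm; intros m Hm Hmx; apply Rmult_eq_reg_l with (m - x); [|lra].
  pose proof (alt_harmonic2_mult x m Hx Hm) as H1.
  pose proof (alt_harmonic2_mult (x + 1) (m + 1) ltac:(lra) ltac:(lra)) as H2.
  replace (m + 1 - (x + 1)) with (m - x) in H2 by ring.
  pose proof (alt_harmonic_succ x Hx); pose proof (alt_harmonic_succ m Hm).
  replace ((m - x) * / (x * m)) with (/ x - / m) by (field; lra).
  lra. }
destruct (Req_dec m x) as [->|H]; [|now apply Hne].
pose proof (alt_harmonic2_lim x Hx) as L1.
pose proof (alt_harmonic2_lim (x + 1) ltac:(lra)) as L2.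
pose proof (is_lim_seq_plus' _ _ _ _ L1 L2) as L.
assert (L' : is_lim_seq (fun j => alt_harmonic2 x (x + / INR (S j))
  + alt_harmonic2 (x + 1) (x + 1 + / INR (S j))) (/ (x * x))).
{ apply is_lim_seq_ext with (fun j => / (x * (x + / INR (S j)))).
  - intros j; assert (0 < / INR (S j)) by (apply Rinv_0_lt_compat, INR_S_pos).
    rewrite <- Hne by lra; do 2 f_equal; ring.
  - replace (/ (x * x)) with (/ (x * (x + 0))) by (f_equal; ring).
    apply (is_lim_seq_at_0 (fun t => / (x * (x + t)))).
    apply continuous_of_ex_derive; auto_derive; nra. }
apply is_lim_seq_unique in L; apply is_lim_seq_unique in L'.
rewrite L in L'; now injection L'.
Qed.

Lemma alt_harmonic2_bounds (x m : R) : 0 < x -> 0 < m -> 0 < alt_harmonic2 x m < / (x * m).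
Proof.
intros Hx Hm.
assert (Hp : forall x m, 0 < x -> 0 < m -> 0 < alt_harmonic2 x m).
{ clear; intros x m Hx Hm; unfold alt_harmonic2.
  assert (0 < csch_int2 x m).
  { apply (halfline_int_pos (/ x ^ 2 * (1 + / m ^ 2))).
    - now apply admissible_csch_weight_mult, admissible_inv2.
    - intros y Hy; pose proof (csch_weight_pos y Hy).
      pose proof (inv_sqr_bounds x y Hx Hy); pose proof (inv_sqr_bounds m y Hm Hy).
      apply Rmult_lt_0_compat; [lra | apply Rmult_lt_0_compat; lra]. }
  assert (0 < / (2 * x * m)) by (apply Rinv_0_lt_compat; nra).
  nra. }
split; auto.
pose proof (alt_harmonic2_succ x m Hx Hm).
pose proof (Hp (x + 1) (m + 1) ltac:(lra) ltac:(lra)); lra.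
Qed.

(** * The densities *)

(** A universal majorant of order i^(-2). Its sum 1 / n is explicit, which keeps track of the decay
    in n needed for the later summation over levels. *)
Definition telescope (n : R) (i : nat) : R := / (n + 2 * INR i) - / (n + 2 * INR i + 2).

Lemma is_series_telescope (n : R) : 0 < n -> is_series (telescope n) (/ n).
Proof.
intros Hn; change (is_lim_seq (sum_n (telescope n)) (/ n)).
apply is_lim_seq_ext with (fun N => / n - / (n + 2 * INR (S N))).
- intros N; induction N as [|N IH].
  + rewrite sum_O; unfold telescope; simpl; real_eq; field; lra.
  + rewrite sum_n_S, <- IH; unfold telescope; rewrite (S_INR (S N)).
    pose proof (pos_INR (S N)); field; lra.
- replace (Finite (/ n)) with (Finite (/ n - 0)) by (f_equal; ring).
  apply is_lim_seq_minus'; [apply is_lim_seq_const|].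
  apply is_lim_seq_le_le with (fun _ => 0) (fun N => / INR (S N)).
  + intros N; pose proof (INR_S_pos N); split.
    * apply Rlt_le, Rinv_0_lt_compat; lra.
    * apply Rinv_le_contravar; lra.
  + apply is_lim_seq_const.
  + apply is_lim_seq_inv_S.
Qed.

(** The factor 3/2 is sharp: equality holds for n = 1 and i = 0. *)
Lemma inv_sqr_le_telescope (n : R) (i : nat) : 1 <= n ->
  / (n + 2 * INR i) ^ 2 <= 3 / 2 * telescope n i.
Proof.
intros Hn; unfold telescope; pose proof (pos_INR i).
assert (Ha : 1 <= n + 2 * INR i) by lra; revert Ha; generalize (n + 2 * INR i) as a.
intros a Ha.
replace (3 / 2 * (/ a - / (a + 2))) with (/ (a ^ 2) * (3 * a / (a + 2))) by (field; lra).
rewrite <- (Rmult_1_r (/ a ^ 2)) at 1.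
apply Rmult_le_compat_l; [apply Rlt_le, Rinv_0_lt_compat; nra|].
apply Rmult_le_reg_r with (a + 2); [lra|].
unfold Rdiv; rewrite Rmult_assoc, Rinv_l; lra.
Qed.

(* Consecutive terms of the sums over k of (-1)^k (n + k) / ((n + k)^2 + y^2) and
   1 / ((n + k)^2 + y^2) are grouped in pairs, so that the first one converges absolutely. *)
Definition re_term (n y : R) (i : nat) : R :=
  (n + 2 * INR i) / ((n + 2 * INR i) ^ 2 + y ^ 2)
  - (n + 2 * INR i + 1) / ((n + 2 * INR i + 1) ^ 2 + y ^ 2).

Definition sq_term (n y : R) (i : nat) : R :=
  / ((n + 2 * INR i) ^ 2 + y ^ 2) + / ((n + 2 * INR i + 1) ^ 2 + y ^ 2).

(** The real part of the sum of (-1)^k / (n + k + i y), that is, of the alternating harmonic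
    function at the complex point n + i y. *)
Definition alt_harmonic_re (n y : R) : R := Series (re_term n y).
Definition inv_sq_sum (n y : R) : R := Series (sq_term n y).

Lemma re_term_bound (n y : R) (i : nat) : 1 <= n ->
  Rabs (re_term n y i) <= / ((n + 2 * INR i) ^ 2 + y ^ 2).
Proof.
intros Hn; unfold re_term; pose proof (pos_INR i).
assert (Ha : 1 <= n + 2 * INR i) by lra; revert Ha; generalize (n + 2 * INR i) as a.
intros a Ha.
assert (0 < a ^ 2 + y ^ 2) by nra; assert (0 < (a + 1) ^ 2 + y ^ 2) by nra.
replace (a / (a ^ 2 + y ^ 2) - (a + 1) / ((a + 1) ^ 2 + y ^ 2)) with
  (/ (a ^ 2 + y ^ 2) * ((a * (a + 1) - y ^ 2) / ((a + 1) ^ 2 + y ^ 2))) by (field; lra).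
assert (0 < / (a ^ 2 + y ^ 2)) by (apply Rinv_0_lt_compat; lra).
rewrite Rabs_mult, Rabs_right by lra.
rewrite <- (Rmult_1_r (/ (a ^ 2 + y ^ 2))) at 2; apply Rmult_le_compat_l; [lra|].
apply Rabs_le; split; apply Rmult_le_reg_r with ((a + 1) ^ 2 + y ^ 2); try lra;
  unfold Rdiv; rewrite Rmult_assoc, Rinv_l; nra.
Qed.

Lemma sq_term_bound (n y : R) (i : nat) : 1 <= n ->
  0 < sq_term n y i <= 2 * / ((n + 2 * INR i) ^ 2 + y ^ 2).
Proof.
intros Hn; unfold sq_term; pose proof (pos_INR i).
assert (Ha : 1 <= n + 2 * INR i) by lra; revert Ha; generalize (n + 2 * INR i) as a.
intros a Ha.
assert (0 < a ^ 2 + y ^ 2) by nra; assert (0 < (a + 1) ^ 2 + y ^ 2) by nra.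
assert (0 < / (a ^ 2 + y ^ 2)) by (apply Rinv_0_lt_compat; lra).
assert (0 < / ((a + 1) ^ 2 + y ^ 2)) by (apply Rinv_0_lt_compat; lra).
assert (/ ((a + 1) ^ 2 + y ^ 2) <= / (a ^ 2 + y ^ 2)) by (apply Rinv_le_contravar; nra).
lra.
Qed.

Lemma inv_node_le_telescope (n y : R) (i : nat) : 1 <= n ->
  0 < / ((n + 2 * INR i) ^ 2 + y ^ 2) <= 3 / 2 * telescope n i.
Proof.
intros Hn; pose proof (inv_sqr_le_telescope n i Hn) as H.
pose proof (pos_INR i).
assert (Ha : 1 <= n + 2 * INR i) by lra; revert Ha H; generalize (n + 2 * INR i) as a.
intros a Ha H1; split; [apply Rinv_0_lt_compat; nra|].
apply Rle_trans with (2 := H1); apply Rinv_le_contravar; nra.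
Qed.

Lemma is_series_telescope_scal (c n : R) : 0 < n ->
  is_series (fun i => c * telescope n i) (c / n).
Proof. intros Hn; apply (is_series_scal_l c (telescope n) (/ n)); now apply is_series_telescope. Qed.

Lemma ex_series_re_term (n y : R) : 1 <= n -> ex_series (re_term n y).
Proof.
intros Hn.
apply (ex_series_le (K := R_AbsRing) (V := R_CompleteNormedModule) _ (fun i => 3 / 2 * telescope n i)).
- intros i; apply Rle_trans with (1 := re_term_bound n y i Hn).
  now apply inv_node_le_telescope.
- eexists; apply is_series_telescope_scal; lra.
Qed.

Lemma ex_series_sq_term (n y : R) : 1 <= n -> ex_series (sq_term n y).
Proof.
intros Hn.
apply (ex_series_le (K := R_AbsRing) (V := R_CompleteNormedModule) _ (fun i => 3 * telescope n i)).
- intros i; pose proof (sq_term_bound n y i Hn); pose proof (inv_node_le_telescope n y i Hn).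
  unfold norm; simpl; unfold abs; simpl; rewrite Rabs_right; lra.
- eexists; apply is_series_telescope_scal; lra.
Qed.

Lemma alt_harmonic_re_bound (n y : R) : 1 <= n -> Rabs (alt_harmonic_re n y) <= 3 / 2 / n.
Proof.
intros Hn; unfold alt_harmonic_re.
rewrite <- (is_series_unique _ _ (is_series_telescope_scal (3 / 2) n ltac:(lra))).
apply Rle_trans with (Series (fun i => Rabs (re_term n y i))).
- apply Series_Rabs.
  apply (ex_series_le (K := R_AbsRing) (V := R_CompleteNormedModule) _ (fun i => 3 / 2 * telescope n i)).
  + intros i; unfold norm; simpl; unfold abs; simpl; rewrite Rabs_Rabsolu.
    apply Rle_trans with (1 := re_term_bound n y i Hn); now apply inv_node_le_telescope.
  + eexists; apply is_series_telescope_scal; lra.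
- apply Series_le.
  + intros i; split; [apply Rabs_pos|].
    apply Rle_trans with (1 := re_term_bound n y i Hn); now apply inv_node_le_telescope.
  + eexists; apply is_series_telescope_scal; lra.
Qed.

Lemma re_term_shift (n y : R) (i : nat) : re_term n y (S i) = re_term (n + 2) y i.
Proof.
unfold re_term; rewrite S_INR.
replace (n + 2 * (INR i + 1)) with (n + 2 + 2 * INR i) by ring; reflexivity.
Qed.

Lemma sq_term_shift (n y : R) (i : nat) : sq_term n y (S i) = sq_term (n + 2) y i.
Proof.
unfold sq_term; rewrite S_INR.
replace (n + 2 * (INR i + 1)) with (n + 2 + 2 * INR i) by ring; reflexivity.
Qed.

Lemma alt_harmonic_re_step (n y : R) : 1 <= n ->
  alt_harmonic_re n y = n / (n ^ 2 + y ^ 2) - (n + 1) / ((n + 1) ^ 2 + y ^ 2) + alt_harmonic_re (n + 2) y.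
Proof.
intros Hn; unfold alt_harmonic_re at 1; rewrite Series_incr_1 by now apply ex_series_re_term.
f_equal.
- unfold re_term; simpl INR; rewrite Rmult_0_r, Rplus_0_r; reflexivity.
- apply Series_ext; intros; apply re_term_shift.
Qed.

Lemma inv_sq_sum_step (n y : R) : 1 <= n ->
  inv_sq_sum n y = / (n ^ 2 + y ^ 2) + / ((n + 1) ^ 2 + y ^ 2) + inv_sq_sum (n + 2) y.
Proof.
intros Hn; unfold inv_sq_sum at 1; rewrite Series_incr_1 by now apply ex_series_sq_term.
f_equal.
- unfold sq_term; simpl INR; rewrite Rmult_0_r, Rplus_0_r; reflexivity.
- apply Series_ext; intros; apply sq_term_shift.
Qed.

Lemma inv_sq_sum_nonneg (n y : R) : 1 <= n -> 0 <= inv_sq_sum n y.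
Proof.
intros Hn; replace 0 with (Series (fun _ => 0)).
- apply Series_le; [|now apply ex_series_sq_term].
  intros i; pose proof (sq_term_bound n y i Hn); lra.
- apply is_series_unique; change (is_lim_seq (sum_n (fun _ => 0)) 0).
  apply is_lim_seq_ext with (fun _ => 0); [|apply is_lim_seq_const].
  intros k; rewrite sum_n_const; ring.
Qed.

Lemma inv_sq_sum_bounds (n y : R) : 1 <= n -> 0 < inv_sq_sum n y <= 3 / n.
Proof.
intros Hn; split.
- rewrite inv_sq_sum_step by auto.
  pose proof (inv_sq_sum_nonneg (n + 2) y ltac:(lra)).
  assert (0 < / (n ^ 2 + y ^ 2)) by (apply Rinv_0_lt_compat; nra).
  assert (0 < / ((n + 1) ^ 2 + y ^ 2)) by (apply Rinv_0_lt_compat; nra).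
  lra.
- unfold inv_sq_sum.
  rewrite <- (is_series_unique _ _ (is_series_telescope_scal 3 n ltac:(lra))).
  apply Series_le.
  + intros i; pose proof (sq_term_bound n y i Hn); pose proof (inv_node_le_telescope n y i Hn).
    lra.
  + eexists; apply is_series_telescope_scal; lra.
Qed.

(** The constant decays like 1 / n, which together with the decay of [central_ratio j ^ 2] makes the
    superposition over levels summable. *)
Lemma admissible_re (n X : R) : 1 <= n -> 0 < X ->
  admissible (3 / 2 * (1 + / X ^ 2) / n) (fun y => alt_harmonic_re n y * / (X ^ 2 + y ^ 2)).
Proof.
intros Hn HX.
rewrite <- (is_series_unique _ _ (is_series_telescope_scal (3 / 2 * (1 + / X ^ 2)) n ltac:(lra))).
apply admissible_ext with (fun y => Series (fun i => re_term n y i * / (X ^ 2 + y ^ 2))).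
- intros y _; apply Series_scal_r.
- apply admissible_series; [|eexists; apply is_series_telescope_scal; lra].
  intros i.
  replace (3 / 2 * (1 + / X ^ 2) * telescope n i) with (3 / 2 * telescope n i * (1 + / X ^ 2)) by ring.
  apply admissible_mult; [| |now apply admissible_inv].
  + intros y Hy; apply continuous_of_ex_derive; unfold re_term.
    pose proof (pos_INR i); assert (Ha : 1 <= n + 2 * INR i) by lra; revert Ha.
    generalize (n + 2 * INR i) as a; intros a Ha; auto_derive; split; nra.
  + intros y Hy; apply Rle_trans with (1 := re_term_bound n y i Hn).
    now apply inv_node_le_telescope.
Qed.

Lemma admissible_sq (n X : R) : 1 <= n -> 0 < X ->
  admissible (3 * (1 + / X ^ 2) / n) (fun y => inv_sq_sum n y * / (X ^ 2 + y ^ 2)).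
Proof.
intros Hn HX.
rewrite <- (is_series_unique _ _ (is_series_telescope_scal (3 * (1 + / X ^ 2)) n ltac:(lra))).
apply admissible_ext with (fun y => Series (fun i => sq_term n y i * / (X ^ 2 + y ^ 2))).
- intros y _; apply Series_scal_r.
- apply admissible_series; [|eexists; apply is_series_telescope_scal; lra].
  intros i.
  replace (3 * (1 + / X ^ 2) * telescope n i) with (3 * telescope n i * (1 + / X ^ 2)) by ring.
  apply admissible_mult; [| |now apply admissible_inv].
  + intros y Hy; apply continuous_of_ex_derive; unfold sq_term.
    pose proof (pos_INR i); assert (Ha : 1 <= n + 2 * INR i) by lra; revert Ha.
    generalize (n + 2 * INR i) as a; intros a Ha; auto_derive; split; nra.
  + intros y Hy; pose proof (sq_term_bound n y i Hn); pose proof (inv_node_le_telescope n y i Hn).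
    rewrite Rabs_right; lra.
Qed.

(** Series whose terms are merely bounded in y become admissible after division by 1 + y^2; this
    removes the auxiliary factor again. *)
Lemma continuous_undivide (f : R -> R) :
  (forall y, 0 < y -> continuous (fun y => f y * / (1 ^ 2 + y ^ 2)) y) ->
  forall y, 0 < y -> continuous f y.
Proof.
intros H; apply (continuous_positive_ext (fun y => f y * / (1 ^ 2 + y ^ 2) * (1 ^ 2 + y ^ 2))).
- intros y Hy; field; nra.
- intros y Hy; apply (continuous_mult (K := R_AbsRing) (fun y => f y * / (1 ^ 2 + y ^ 2))); auto.
  apply continuous_of_ex_derive; now auto_derive.
Qed.

Lemma continuous_re (n y : R) : 1 <= n -> 0 < y -> continuous (alt_harmonic_re n) y.
Proof.
intros Hn; revert y; apply continuous_undivide.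
intros y Hy; now apply (admissible_re n 1 Hn Rlt_0_1).
Qed.

Lemma continuous_sq (n y : R) : 1 <= n -> 0 < y -> continuous (inv_sq_sum n) y.
Proof.
intros Hn; revert y; apply continuous_undivide.
intros y Hy; now apply (admissible_sq n 1 Hn Rlt_0_1).
Qed.


(** * The difference equation in X *)

Definition level_fun (n X y : R) : R :=
  csch_weight y * ((alt_harmonic_re n y - exp (- (PI * y)) * alt_harmonic n - X * inv_sq_sum n y)
                   * / (X ^ 2 + y ^ 2)).

Definition level_int (n X : R) : R := 2 * halfline_int (level_fun n X).

(** Off the diagonal the last summand is twice the quotient of [alt_harmonic n - alt_harmonic m] by
    m - n. The form chosen remains valid at n = m. *)
Definition kern (n m : R) : R :=
  2 * (alt_harmonic n + alt_harmonic m) / (n + m - 1) + 2 * alt_harmonic2 n m.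

Lemma admissible_level (n X : R) : 1 <= n -> 0 < X ->
  admissible ((5 / 2 + 3 * X) * (1 + / X ^ 2) / n) (level_fun n X).
Proof.
intros Hn HX.
assert (HX2 : 0 < / X ^ 2) by (apply Rinv_0_lt_compat, pow_lt; lra).
assert (Hn1 : 0 < / n) by (apply Rinv_0_lt_compat; lra).
apply admissible_csch_weight_mult.
apply admissible_ext with (fun y => alt_harmonic_re n y * / (X ^ 2 + y ^ 2)
  - alt_harmonic n * (exp (- (PI * y)) * / (X ^ 2 + y ^ 2))
  - X * (inv_sq_sum n y * / (X ^ 2 + y ^ 2))).
- intros; ring.
- pose proof (alt_harmonic_bounds n ltac:(lra)) as [Hb1 Hb2].
  assert (0 < / (2 * n)) by (apply Rinv_0_lt_compat; lra).
  apply admissible_le with (3 / 2 * (1 + / X ^ 2) / n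
    + Rabs (alt_harmonic n) * (1 + / X ^ 2) + Rabs X * (3 * (1 + / X ^ 2) / n)).
  + rewrite !Rabs_right by lra.
    replace ((5 / 2 + 3 * X) * (1 + / X ^ 2) / n) with (3 / 2 * (1 + / X ^ 2) / n
      + / n * (1 + / X ^ 2) + X * (3 * (1 + / X ^ 2) / n)) by (field; split; lra).
    nra.
  + apply admissible_minus; [apply admissible_minus|].
    * now apply admissible_re.
    * now apply admissible_scal, admissible_exp_mult, admissible_inv.
    * now apply admissible_scal, admissible_sq.
Qed.

(** Passing from n to n + 2 removes exactly one pair from each of the two series, so only integrals
    with one or two quadratic factors remain. *)
Lemma level_int_step (n X : R) : 1 <= n -> 0 < X ->
  level_int n X - level_int (n + 2) X =
  2 * ((n - X) * csch_int2 X n - (n + 1 + X) * csch_int2 X (n + 1))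
  - 2 * (/ n - / (n + 1)) * exp_csch_int X.
Proof.
intros Hn HX; unfold level_int.
pose proof (admissible_level n X Hn HX) as H1.
pose proof (admissible_level (n + 2) X ltac:(lra) HX) as H2.
rewrite <- Rmult_minus_distr_l, <- (halfline_int_minus _ _ _ _ H1 H2).
pose proof (admissible_csch_weight_mult _ _ (admissible_inv2 X n HX ltac:(lra))) as A1.
pose proof (admissible_csch_weight_mult _ _ (admissible_inv2 X (n + 1) HX ltac:(lra))) as A2.
pose proof (admissible_csch_weight_mult _ _ (admissible_exp_mult _ _ (admissible_inv X HX))) as A3.
pose proof (admissible_scal _ (n - X) _ A1) as B1.
pose proof (admissible_scal _ (n + 1 + X) _ A2) as B2.
pose proof (admissible_scal _ (/ n - / (n + 1)) _ A3) as B3.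
pose proof (admissible_minus _ _ _ _ B1 B2) as B12; cbv beta in B12.
rewrite (halfline_int_ext _ (fun y =>
  (n - X) * (csch_weight y * (/ (X ^ 2 + y ^ 2) * / (n ^ 2 + y ^ 2)))
  - (n + 1 + X) * (csch_weight y * (/ (X ^ 2 + y ^ 2) * / ((n + 1) ^ 2 + y ^ 2)))
  - (/ n - / (n + 1)) * (csch_weight y * (exp (- (PI * y)) * / (X ^ 2 + y ^ 2))))).
- rewrite (halfline_int_minus _ _ _ _ B12 B3), (halfline_int_minus _ _ _ _ B1 B2).
  rewrite (halfline_int_scal _ _ _ A1), (halfline_int_scal _ _ _ A2), (halfline_int_scal _ _ _ A3).
  unfold csch_int2, exp_csch_int; ring.
- intros y Hy; unfold level_fun.
  rewrite (alt_harmonic_re_step n), (inv_sq_sum_step n) by auto.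
  assert (E : alt_harmonic n = / n - / (n + 1) + alt_harmonic (n + 2)).
  { pose proof (alt_harmonic_succ n ltac:(lra)) as S1.
    pose proof (alt_harmonic_succ (n + 1) ltac:(lra)) as S2.
    replace (n + 1 + 1) with (n + 2) in S2 by ring; lra. }
  rewrite E; field; repeat split; nra.
Qed.

(** In the mixed difference the exponential integral enters only through its increment in X, which
    supplies the logarithm. The functional equations reduce everything else to a few independent
    values. *)
Lemma level_int_diff_step (n X : R) : 1 <= n -> 0 < X ->
  (level_int n X - level_int n (X + 2)) - (level_int (n + 2) X - level_int (n + 2) (X + 2)) =
  (2 * alt_harmonic n * ln (1 + 2 / X) - kern n (X + 1))
  - (2 * alt_harmonic (n + 2) * ln (1 + 2 / X) - kern (n + 2) (X + 1)).
Proof.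
intros Hn HX.
pose proof (level_int_step n X Hn HX) as E1.
pose proof (level_int_step n (X + 2) Hn ltac:(lra)) as E2.
pose proof (exp_csch_int_diff X HX) as E3.
pose proof (alt_harmonic_succ X HX) as S1.
pose proof (alt_harmonic_succ (X + 1) ltac:(lra)) as S2.
replace (X + 1 + 1) with (X + 2) in S2 by ring.
pose proof (alt_harmonic_succ n ltac:(lra)) as S3.
pose proof (alt_harmonic_succ (n + 1) ltac:(lra)) as S4.
replace (n + 1 + 1) with (n + 2) in S4 by ring.
(* The factor n - X permits a difference of [alt_harmonic] values over X + n, which never vanishes.
   The terms with factor n + 1 + X must stay divided differences, since X = n + 1 is possible. *)
assert (V1 : (n - X) * csch_int2 X n =
  (alt_harmonic X - alt_harmonic n - (n - X) / (2 * X * n)) / (X + n)).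
{ pose proof (alt_harmonic2_mult X n HX ltac:(lra)) as M; unfold alt_harmonic2 in M.
  rewrite <- M; field; lra. }
assert (V2 : (n - (X + 2)) * csch_int2 (X + 2) n =
  (alt_harmonic (X + 2) - alt_harmonic n - (n - (X + 2)) / (2 * (X + 2) * n)) / (X + 2 + n)).
{ pose proof (alt_harmonic2_mult (X + 2) n ltac:(lra) ltac:(lra)) as M; unfold alt_harmonic2 in M.
  rewrite <- M; field; lra. }
assert (V3 : (n + 1 + X) * csch_int2 X (n + 1) = alt_harmonic2 X (n + 1) - / (2 * X * (n + 1)))
  by (unfold alt_harmonic2; ring).
assert (V4 : (n + 1 + (X + 2)) * csch_int2 (X + 2) (n + 1) =
  alt_harmonic2 (X + 2) (n + 1) - / (2 * (X + 2) * (n + 1))) by (unfold alt_harmonic2; ring).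
pose proof (alt_harmonic2_succ n (X + 1) ltac:(lra) ltac:(lra)) as T1.
replace (X + 1 + 1) with (X + 2) in T1 by ring; rewrite (alt_harmonic2_sym (n + 1)) in T1.
pose proof (alt_harmonic2_succ X (n + 1) ltac:(lra) ltac:(lra)) as T2.
replace (n + 1 + 1) with (n + 2) in T2 by ring; rewrite (alt_harmonic2_sym (X + 1)) in T2.
replace (level_int n X - level_int n (X + 2) - (level_int (n + 2) X - level_int (n + 2) (X + 2)))
  with ((level_int n X - level_int (n + 2) X) - (level_int n (X + 2) - level_int (n + 2) (X + 2)))
  by ring.
rewrite E1, E2, V1, V2, V3, V4.
assert (E3' : exp_csch_int X = exp_csch_int (X + 2) +
  (/ (2 * X) + / (X + 1) + / (2 * (X + 2)) - ln (1 + 2 / X))) by lra.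
rewrite E3'; unfold kern.
assert (S1' : alt_harmonic (X + 1) = / X - alt_harmonic X) by lra.
assert (S2' : alt_harmonic (X + 2) = / (X + 1) - / X + alt_harmonic X) by lra.
assert (S4' : alt_harmonic (n + 2) = / (n + 1) - / n + alt_harmonic n) by lra.
assert (T1' : alt_harmonic2 n (X + 1) = / (n * (X + 1)) - alt_harmonic2 (X + 2) (n + 1)) by lra.
assert (T2' : alt_harmonic2 (n + 2) (X + 1) = / (X * (n + 1)) - alt_harmonic2 X (n + 1)) by lra.
rewrite S1', S2', S4', T1', T2'.
field; repeat split; lra.
Qed.

Lemma level_int_bound (n X : R) : 1 <= n -> 0 < X ->
  Rabs (level_int n X) <= 8 * ((5 / 2 + 3 * X) * (1 + / X ^ 2)) * / n.
Proof.
intros Hn HX; unfold level_int.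
rewrite Rabs_mult, (Rabs_right 2) by lra.
pose proof (halfline_int_abs _ _ (admissible_level n X Hn HX)); unfold Rdiv in *; lra.
Qed.

Lemma kern_bounds (n m : R) : 1 <= n -> 1 <= m -> 0 < kern n m <= 6 / n.
Proof.
intros Hn Hm; unfold kern.
pose proof (alt_harmonic_bounds n ltac:(lra)) as [A1 A2].
pose proof (alt_harmonic_bounds m ltac:(lra)) as [B1 B2].
pose proof (alt_harmonic2_bounds n m ltac:(lra) ltac:(lra)) as [C1 C2].
assert (0 < / (2 * n)) by (apply Rinv_0_lt_compat; lra).
assert (0 < / (2 * m)) by (apply Rinv_0_lt_compat; lra).
assert (Hn1 : 0 < / n <= 1) by (split; [apply Rinv_0_lt_compat | rewrite <- Rinv_1; apply Rinv_le_contravar]; lra).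
assert (Hm1 : 0 < / m <= 1) by (split; [apply Rinv_0_lt_compat | rewrite <- Rinv_1; apply Rinv_le_contravar]; lra).
assert (Hd : 0 < / (n + m - 1) <= / n) by (split; [apply Rinv_0_lt_compat | apply Rinv_le_contravar]; lra).
rewrite Rinv_mult in C2.
unfold Rdiv; split.
- assert (0 < 2 * (alt_harmonic n + alt_harmonic m) * / (n + m - 1)) by (apply Rmult_lt_0_compat; lra).
  lra.
- assert (2 * (alt_harmonic n + alt_harmonic m) * / (n + m - 1) <= 4 * / n)
    by (apply Rmult_le_compat; lra).
  nra.
Qed.

Lemma is_lim_seq_scal_inv (c n : R) : 1 <= n ->
  is_lim_seq (fun i => c * / (n + 2 * INR i)) 0.
Proof.
intros Hn; replace (Finite 0) with (Rbar_mult c 0) by (simpl; f_equal; ring).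
apply is_lim_seq_scal_l.
apply is_lim_seq_le_le with (fun _ => 0) (fun i => / INR (S i)).
- intros i; pose proof (pos_INR i); rewrite S_INR; split.
  + apply Rlt_le, Rinv_0_lt_compat; lra.
  + apply Rinv_le_contravar; lra.
- apply is_lim_seq_const.
- apply is_lim_seq_inv_S.
Qed.

(** The defect [d] is unchanged when n grows by 2, and it is O(1 / n); hence it is 0. *)
Lemma level_int_diff (n X : R) : 1 <= n -> 0 < X ->
  level_int n X - level_int n (X + 2) = 2 * alt_harmonic n * ln (1 + 2 / X) - kern n (X + 1).
Proof.
intros Hn HX.
set (d := fun n => level_int n X - level_int n (X + 2)
  - (2 * alt_harmonic n * ln (1 + 2 / X) - kern n (X + 1))).
assert (Hstep : forall i, d (n + 2 * INR i) = d n).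
{ induction i as [|i IH].
  - simpl; f_equal; ring.
  - rewrite <- IH, S_INR; replace (n + 2 * (INR i + 1)) with (n + 2 * INR i + 2) by ring.
    pose proof (pos_INR i); assert (Ha : 1 <= n + 2 * INR i) by lra; revert Ha.
    generalize (n + 2 * INR i) as a; intros a Ha.
    pose proof (level_int_diff_step a X Ha HX); unfold d; lra. }
set (c := 8 * ((5 / 2 + 3 * X) * (1 + / X ^ 2)) + 8 * ((5 / 2 + 3 * (X + 2)) * (1 + / (X + 2) ^ 2))
  + 2 * Rabs (ln (1 + 2 / X)) + 6).
assert (Hb : forall a, 1 <= a -> Rabs (d a) <= c * / a).
{ intros a Ha; unfold d.
  pose proof (level_int_bound a X Ha HX) as L1.
  pose proof (level_int_bound a (X + 2) Ha ltac:(lra)) as L2.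
  pose proof (kern_bounds a (X + 1) Ha ltac:(lra)) as K; unfold Rdiv in K.
  pose proof (alt_harmonic_bounds a ltac:(lra)) as [A1 A2].
  assert (0 < / (2 * a)) by (apply Rinv_0_lt_compat; lra).
  assert (Hl : Rabs (2 * alt_harmonic a * ln (1 + 2 / X)) <= 2 * Rabs (ln (1 + 2 / X)) * / a).
  { rewrite !Rabs_mult, (Rabs_right 2), (Rabs_right (alt_harmonic a)) by lra.
    pose proof (Rabs_pos (ln (1 + 2 / X))); nra. }
  apply Rabs_le_between in L1; apply Rabs_le_between in L2; apply Rabs_le_between in Hl.
  apply Rabs_le; unfold c; lra. }
assert (Hz : d n = 0); [|unfold d in Hz; lra].
assert (L : is_lim_seq (fun i => d (n + 2 * INR i)) 0).
{ apply is_lim_seq_abs_0, is_lim_seq_le_le with (fun _ => 0) (fun i => c * / (n + 2 * INR i)).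
  - intros i; pose proof (pos_INR i); split; [apply Rabs_pos | apply Hb; lra].
  - apply is_lim_seq_const.
  - now apply is_lim_seq_scal_inv. }
assert (L' : is_lim_seq (fun i => d (n + 2 * INR i)) (d n)).
{ apply is_lim_seq_ext with (fun _ => d n); [intros; now rewrite Hstep | apply is_lim_seq_const]. }
apply is_lim_seq_unique in L; apply is_lim_seq_unique in L'.
rewrite L in L'; injection L'; auto.
Qed.

(** * Positivity of the densities *)

Definition gap (y a : R) : R := alt_harmonic_re a y - exp (- (PI * y)) * alt_harmonic a.

(** The loss of [gap y] between a and a + 2. *)
Definition gap_step (y a : R) : R :=
  a / (a ^ 2 + y ^ 2) - (a + 1) / ((a + 1) ^ 2 + y ^ 2) - exp (- (PI * y)) * (/ a - / (a + 1)).

Lemma gap_rec (y a : R) : 1 <= a -> gap y a = gap_step y a + gap y (a + 2).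
Proof.
intros Ha; unfold gap, gap_step; rewrite alt_harmonic_re_step by auto.
pose proof (alt_harmonic_succ a ltac:(lra)) as S1.
pose proof (alt_harmonic_succ (a + 1) ltac:(lra)) as S2.
replace (a + 1 + 1) with (a + 2) in S2 by ring.
replace (alt_harmonic a) with (/ a - / (a + 1) + alt_harmonic (a + 2)) by lra.
ring.
Qed.

(* In terms of p = a (a + 1) the sign of [gap_step] is that of a quadratic with positive
   leading and negative constant coefficient, so it changes once, from - to +. *)
Lemma gap_step_sign (y a b : R) : 0 < y -> 1 <= a <= b -> 0 <= gap_step y a -> 0 <= gap_step y b.
Proof.
intros Hy Hab.
pose proof (exp_weight_bounds y Hy) as HE; set (E := exp (- (PI * y))) in *.
set (q := fun p => (1 - E) * p ^ 2 - (1 + 2 * E) * y ^ 2 * p - E * (y ^ 2 + y ^ 4)).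
assert (Hq : forall a, 1 <= a -> gap_step y a =
  q (a * (a + 1)) / (a * (a + 1) * ((a ^ 2 + y ^ 2) * ((a + 1) ^ 2 + y ^ 2)))).
{ intros c Hc; unfold gap_step, q; fold E; field; repeat split; nra. }
assert (Hden : forall a, 1 <= a -> 0 < a * (a + 1) * ((a ^ 2 + y ^ 2) * ((a + 1) ^ 2 + y ^ 2))).
{ intros c Hc; repeat apply Rmult_lt_0_compat; nra. }
rewrite !Hq by lra; intros H.
apply Rdiv_le_0_compat; [|apply Hden; lra].
assert (Hqa : 0 <= q (a * (a + 1))).
{ pose proof (Hden a ltac:(lra)) as Hd.
  replace (q (a * (a + 1))) with (q (a * (a + 1)) / (a * (a + 1) * ((a ^ 2 + y ^ 2) * ((a + 1) ^ 2 + y ^ 2)))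
    * (a * (a + 1) * ((a ^ 2 + y ^ 2) * ((a + 1) ^ 2 + y ^ 2)))) by (field; repeat split; nra).
  apply Rmult_le_pos; lra. }
assert (Hp : 0 < a * (a + 1)) by nra.
assert (Hpp : a * (a + 1) <= b * (b + 1)) by nra.
revert Hqa Hp Hpp; generalize (a * (a + 1)) (b * (b + 1)); intros p r Hqa Hp Hpr.
assert (Hc : 0 <= E * (y ^ 2 + y ^ 4)) by (apply Rmult_le_pos; nra).
(* This combination eliminates the linear term of the quadratic; the two remaining contributions are
   nonnegative for p <= r. *)
assert (I : p * q r - r * q p = (1 - E) * (p * r) * (r - p) + E * (y ^ 2 + y ^ 4) * (r - p))
  by (unfold q; ring).
assert (0 <= (1 - E) * (p * r) * (r - p)) by (repeat apply Rmult_le_pos; nra).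
assert (0 <= E * (y ^ 2 + y ^ 4) * (r - p)) by (apply Rmult_le_pos; lra).
assert (0 <= r * q p) by (apply Rmult_le_pos; lra).
assert (0 <= p * q r) by lra.
apply Rmult_le_reg_l with p; lra.
Qed.

Lemma gap_bound (y a : R) : 0 < y -> 1 <= a -> Rabs (gap y a) <= 5 / 2 * / a.
Proof.
intros Hy Ha; unfold gap.
pose proof (alt_harmonic_re_bound a y Ha) as H1.
pose proof (alt_harmonic_bounds a ltac:(lra)) as [A1 A2].
assert (0 < / (2 * a)) by (apply Rinv_0_lt_compat; lra).
pose proof (exp_weight_bounds y Hy).
apply Rabs_le_between in H1; unfold Rdiv in H1; apply Rabs_le; split; nra.
Qed.

(** Once one step is nonnegative all later ones are, so [gap y] decreases along a, a + 2, ... to its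
    limit 0. *)
Lemma gap_nonneg_of_steps (y a : R) : 0 < y -> 1 <= a -> 0 <= gap_step y a -> 0 <= gap y a.
Proof.
intros Hy Ha Hd.
assert (H : forall i, gap y (a + 2 * INR i) <= gap y a).
{ induction i as [|i IH].
  - simpl; rewrite Rmult_0_r, Rplus_0_r; lra.
  - rewrite S_INR; pose proof (pos_INR i).
    pose proof (gap_rec y (a + 2 * INR i) ltac:(lra)) as E.
    pose proof (gap_step_sign y a (a + 2 * INR i) Hy ltac:(lra) Hd).
    replace (a + 2 * (INR i + 1)) with (a + 2 * INR i + 2) by ring; lra. }
apply (is_lim_seq_le (fun i => gap y (a + 2 * INR i)) (fun _ => gap y a) 0 (gap y a) H);
  [|apply is_lim_seq_const].
apply is_lim_seq_abs_0, is_lim_seq_le_le with (fun _ => 0) (fun i => 5 / 2 * / (a + 2 * INR i)).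
- intros i; split; [apply Rabs_pos|]; pose proof (pos_INR i); apply gap_bound; auto; lra.
- apply is_lim_seq_const.
- now apply is_lim_seq_scal_inv.
Qed.

(** The cubic Taylor polynomial of exp(3 y) and PI > 3 give a rational bound for the exponential. *)
Lemma exp_weight_upper (y : R) : 0 < y ->
  exp (- (PI * y)) * (1 + 3 * y + 9 / 2 * y ^ 2 + 9 / 2 * y ^ 3) <= 1.
Proof.
intros Hy; pose proof PI2_3_2.
assert (H1 : 1 + 3 * y + 9 / 2 * y ^ 2 + 9 / 2 * y ^ 3 <= exp (3 * y)).
{ apply Rle_trans with (2 := exp_ge_taylor (3 * y) 3 ltac:(lra)).
  simpl; apply Req_le; field. }
assert (H2 : exp (3 * y) <= exp (PI * y)).
{ destruct (Req_dec (3 * y) (PI * y)) as [->|]; [lra|].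
  left; apply exp_increasing; nra. }
rewrite exp_Ropp; pose proof (exp_pos (PI * y)).
apply Rmult_le_reg_l with (exp (PI * y)); auto.
rewrite <- Rmult_assoc, Rinv_r; lra.
Qed.

Definition boole (y k : R) : R := / 2 * (k - / 2) / ((k - / 2) ^ 2 + y ^ 2 + / 4).

Definition boole_err (y k : R) : R :=
  (y ^ 2 + / 4) / ((k ^ 2 + y ^ 2) * ((k ^ 2 + y ^ 2 + / 2) ^ 2 - k ^ 2)).

(* Boole summation: a telescoping minorant of k / (k^2 + y^2). The shift 1/4 in [boole] is
   what makes the numerator of the error linear in k. *)
Lemma boole_identity (y k : R) : 0 < y -> 1 <= k ->
  k / (k ^ 2 + y ^ 2) = boole y k + boole y (k + 1) + k * boole_err y k.
Proof.
intros Hy Hk; unfold boole, boole_err.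
replace ((k ^ 2 + y ^ 2 + / 2) ^ 2 - k ^ 2) with
  (((k - / 2) ^ 2 + y ^ 2 + / 4) * ((k + 1 - / 2) ^ 2 + y ^ 2 + / 4)) by field.
field; repeat split; nra.
Qed.

Lemma boole_err_decreasing (y k : R) : 0 < y -> 1 <= k ->
  0 < boole_err y (k + 1) <= boole_err y k.
Proof.
intros Hy Hk; unfold boole_err.
assert (Hy2 : 0 < y ^ 2) by (apply pow_lt; lra).
assert (forall k, 1 <= k -> 0 < (k ^ 2 + y ^ 2) * ((k ^ 2 + y ^ 2 + / 2) ^ 2 - k ^ 2)).
{ intros c Hc; apply Rmult_lt_0_compat; nra. }
split.
- apply Rdiv_lt_0_compat; [lra | apply H; lra].
- apply Rmult_le_compat_l; [lra|]; apply Rinv_le_contravar; [now apply H|].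
  apply Rmult_le_compat; nra.
Qed.

Lemma boole_err_upper (y : R) (i : nat) : 0 < y ->
  boole_err y (2 * INR (S i)) <=
  (y ^ 2 + / 4) / (8 * (y ^ 2 * (y ^ 2 + 4))) * (/ INR (S i) - / INR (S (S i))).
Proof.
intros Hy; unfold boole_err; pose proof (INR_S_ge1 i) as Hm; rewrite (S_INR (S i)).
revert Hm; generalize (INR (S i)) as m; intros m Hm.
assert (Hy2 : 0 < y ^ 2) by (apply pow_lt; lra).
replace ((y ^ 2 + / 4) / (8 * (y ^ 2 * (y ^ 2 + 4))) * (/ m - / (m + 1))) with
  ((y ^ 2 + / 4) / ((4 + y ^ 2) * (8 * m * (m + 1) * y ^ 2))) by (field; repeat split; lra).
apply Rmult_le_compat_l; [lra|]; apply Rinv_le_contravar.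
- apply Rmult_lt_0_compat; [lra|]; repeat apply Rmult_lt_0_compat; lra.
- apply Rmult_le_compat; [lra | | nra |].
  + repeat apply Rmult_le_pos; lra.
  + apply Rle_trans with (((2 * m) ^ 2 + y ^ 2) ^ 2); [|nra].
    (* The arithmetic-geometric mean inequality for (2 m)^2 and y^2. *)
    apply Rle_trans with (4 * (2 * m) ^ 2 * y ^ 2); [nra|].
    pose proof (pow2_ge_0 ((2 * m) ^ 2 - y ^ 2)); lra.
Qed.

(** In each pair of terms the [boole] values telescope, leaving [boole y 1] as the main term. Since
    [boole_err] decreases, a pair loses at most one error value at an even argument, and these
    losses are bounded by a telescoping sum with total [c]. *)
Lemma alt_harmonic_re_1_lower (y : R) : 0 < y ->
  / 4 / (y ^ 2 + / 2) - (y ^ 2 + / 4) / (8 * (y ^ 2 * (y ^ 2 + 4))) <= alt_harmonic_re 1 y.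
Proof.
intros Hy; assert (Hy2 : 0 < y ^ 2) by (apply pow_lt; lra).
set (c := (y ^ 2 + / 4) / (8 * (y ^ 2 * (y ^ 2 + 4)))).
assert (Hc : 0 <= c) by (apply Rdiv_le_0_compat; nra).
assert (Hpair : forall i, boole y (1 + 2 * INR i) - boole y (1 + 2 * INR (S i))
  - c * (/ INR (S i) - / INR (S (S i))) <= re_term 1 y i).
{ intros i; pose proof (boole_err_upper y i Hy) as Hu; fold c in Hu.
  pose proof (pos_INR i) as Hi; unfold re_term.
  pose proof (boole_identity y (1 + 2 * INR i) Hy ltac:(lra)) as B1.
  pose proof (boole_identity y (1 + 2 * INR i + 1) Hy ltac:(lra)) as B2.
  pose proof (boole_err_decreasing y (1 + 2 * INR i) Hy ltac:(lra)) as [D1 D2].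
  replace (2 * INR (S i)) with (1 + 2 * INR i + 1) in Hu by (rewrite S_INR; ring).
  replace (1 + 2 * INR (S i)) with (1 + 2 * INR i + 1 + 1) by (rewrite S_INR; ring).
  rewrite B1, B2.
  assert ((1 + 2 * INR i) * boole_err y (1 + 2 * INR i + 1) <= (1 + 2 * INR i) * boole_err y (1 + 2 * INR i))
    by (apply Rmult_le_compat_l; lra).
  lra. }
assert (Hsum : forall N, boole y 1 - boole y (1 + 2 * INR (S N)) - c <= sum_n (re_term 1 y) N).
{ intros N; apply Rle_trans with
    (boole y 1 - boole y (1 + 2 * INR (S N)) - c * (1 - / INR (S (S N)))).
  - assert (0 < / INR (S (S N))) by apply Rinv_0_lt_compat, INR_S_pos; nra.
  - induction N as [|N IH].
    + rewrite sum_O; apply Rle_trans with (2 := Hpair 0%nat); apply Req_le.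
      replace (1 + 2 * INR 0) with 1 by (simpl; ring).
      replace (/ INR 1) with 1 by (simpl; field); reflexivity.
    + rewrite sum_n_S; pose proof (Hpair (S N)); lra. }
assert (E : / 4 / (y ^ 2 + / 2) = boole y 1) by (unfold boole; field; lra).
rewrite E.
apply (is_lim_seq_le (fun N => boole y 1 - boole y (1 + 2 * INR (S N)) - c)
  (sum_n (re_term 1 y)) (boole y 1 - 0 - c) (alt_harmonic_re 1 y)) in Hsum.
- simpl in Hsum; lra.
- apply is_lim_seq_minus'; [|apply is_lim_seq_const].
  apply is_lim_seq_minus'; [apply is_lim_seq_const|].
  apply is_lim_seq_le_le with (fun _ => 0) (fun N => / INR (S N)).
  + intros N; pose proof (INR_S_pos N) as Hm; revert Hm; generalize (INR (S N)) as m; intros m Hm.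
    unfold boole; split; [apply Rdiv_le_0_compat; nra|].
    apply Rmult_le_reg_r with ((1 + 2 * m - / 2) ^ 2 + y ^ 2 + / 4); [nra|].
    unfold Rdiv; rewrite Rmult_assoc, Rinv_l by nra.
    apply Rmult_le_reg_l with m; [lra|].
    replace (m * (/ m * ((1 + 2 * m - / 2) ^ 2 + y ^ 2 + / 4))) with
      ((1 + 2 * m - / 2) ^ 2 + y ^ 2 + / 4) by (field; lra).
    nra.
  + apply is_lim_seq_const.
  + apply is_lim_seq_inv_S.
- apply Series_correct, ex_series_re_term; lra.
Qed.

(** For small y the first step is already nonnegative. This fails once y^2 >= 2, but there the
    minorant of order 1 / y^2 dominates the exponential. The threshold 6/5 lies where both arguments
    work. *)
Lemma gap_1_nonneg (y : R) : 0 < y -> 0 <= gap y 1.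
Proof.
intros Hy; pose proof (exp_weight_upper y Hy) as HE.
pose proof (exp_weight_bounds y Hy) as [E1 E2].
destruct (Rle_lt_dec y (6 / 5)) as [Hy1|Hy1].
- apply gap_nonneg_of_steps; auto; [lra|].
  unfold gap_step; set (E := exp (- (PI * y))) in *.
  replace (1 / (1 ^ 2 + y ^ 2) - (1 + 1) / ((1 + 1) ^ 2 + y ^ 2) - E * (/ 1 - / (1 + 1))) with
    ((2 * (2 - y ^ 2) - E * ((1 + y ^ 2) * (4 + y ^ 2))) / (2 * ((1 + y ^ 2) * (4 + y ^ 2))))
    by (field; split; nra).
  apply Rdiv_le_0_compat; [|nra].
  set (P := 1 + 3 * y + 9 / 2 * y ^ 2 + 9 / 2 * y ^ 3) in *.
  assert (HP : (1 + y ^ 2) * (4 + y ^ 2) <= 2 * (2 - y ^ 2) * P).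
  { assert (0 <= y * (12 + 11 * y + 12 * y ^ 2 - 10 * y ^ 3 - 9 * y ^ 4)).
    { apply Rmult_le_pos; [lra|].
      assert (y ^ 2 <= 36 / 25) by nra.
      assert (y ^ 3 <= 6 / 5 * y ^ 2) by nra.
      assert (y ^ 4 <= 36 / 25 * y ^ 2) by nra.
      nra. }
    unfold P; nra. }
  assert (0 <= 2 * (2 - y ^ 2)) by nra.
  assert (E * ((1 + y ^ 2) * (4 + y ^ 2)) <= E * (2 * (2 - y ^ 2) * P))
    by (apply Rmult_le_compat_l; lra).
  assert (2 * (2 - y ^ 2) * (E * P) <= 2 * (2 - y ^ 2) * 1) by (apply Rmult_le_compat_l; auto).
  lra.
- unfold gap; pose proof (alt_harmonic_re_1_lower y Hy) as HL.
  pose proof (alt_harmonic_bounds 1 Rlt_0_1) as [A1 A2]; rewrite Rinv_1 in A2.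
  set (E := exp (- (PI * y))) in *.
  assert (Hu : 36 / 25 < y ^ 2) by nra.
  assert (H1 : / 8 / (y ^ 2 + / 2) <= / 4 / (y ^ 2 + / 2) - (y ^ 2 + / 4) / (8 * (y ^ 2 * (y ^ 2 + 4)))).
  { revert Hu; generalize (y ^ 2) as u; intros u Hu.
    assert (0 <= (u * (u + 4) - (u + / 4) * (u + / 2)) / (8 * (u * (u + 4)) * (u + / 2))).
    { apply Rdiv_le_0_compat; [nra|]; repeat apply Rmult_lt_0_compat; lra. }
    assert (Eq : / 4 / (u + / 2) - (u + / 4) / (8 * (u * (u + 4))) - / 8 / (u + / 2) =
      (u * (u + 4) - (u + / 4) * (u + / 2)) / (8 * (u * (u + 4)) * (u + / 2)))
      by (field; repeat split; lra).
    lra. }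
  assert (H2 : E <= / 8 / (y ^ 2 + / 2)).
  { assert (HP : 8 * (y ^ 2 + / 2) <= 1 + 3 * y + 9 / 2 * y ^ 2 + 9 / 2 * y ^ 3) by nra.
    apply Rmult_le_reg_r with (8 * (y ^ 2 + / 2)); [lra|].
    replace (/ 8 / (y ^ 2 + / 2) * (8 * (y ^ 2 + / 2))) with 1 by (field; lra).
    apply Rle_trans with (2 := HE); apply Rmult_le_compat_l; lra. }
  assert (E * alt_harmonic 1 <= E * 1) by (apply Rmult_le_compat_l; lra).
  lra.
Qed.

(** While the steps are negative the gap increases along the odd numbers, and afterwards it
    decreases to 0; so only its value at 1 needs a genuine estimate. *)
Lemma gap_nonneg (y : R) (j : nat) : 0 < y -> 0 <= gap y (1 + 2 * INR j).
Proof.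
intros Hy; induction j as [|j IH].
- simpl; rewrite Rmult_0_r, Rplus_0_r; now apply gap_1_nonneg.
- pose proof (pos_INR j); rewrite S_INR.
  replace (1 + 2 * (INR j + 1)) with (1 + 2 * INR j + 2) by ring.
  destruct (Rle_lt_dec 0 (gap_step y (1 + 2 * INR j))) as [Hd|Hd].
  + apply gap_nonneg_of_steps; auto; [lra|].
    apply gap_step_sign with (1 + 2 * INR j); auto; lra.
  + pose proof (gap_rec y (1 + 2 * INR j) ltac:(lra)); lra.
Qed.

(** Already the first half of each [sq_term] dominates the corresponding [re_term]; the subtracted
    exponential term makes the inequality strict. *)
Lemma gap_lt_inv_sq_sum (y a : R) : 0 < y -> 1 <= a -> gap y a < inv_sq_sum a y.
Proof.
intros Hy Ha; unfold gap.
pose proof (alt_harmonic_bounds a ltac:(lra)) as [A1 A2].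
assert (0 < / (2 * a)) by (apply Rinv_0_lt_compat; lra).
pose proof (exp_weight_bounds y Hy).
assert (alt_harmonic_re a y <= inv_sq_sum a y).
{ unfold alt_harmonic_re, inv_sq_sum.
  apply (is_lim_seq_le (sum_n (re_term a y)) (sum_n (sq_term a y))
    (Series (re_term a y)) (Series (sq_term a y))).
  - intros N; apply sum_n_m_le; intros i.
    pose proof (re_term_bound a y i Ha) as H1; apply Rabs_le_between in H1.
    unfold sq_term; pose proof (pos_INR i).
    assert (0 < / ((a + 2 * INR i + 1) ^ 2 + y ^ 2)) by (apply Rinv_0_lt_compat; nra).
    lra.
  - now apply Series_correct, ex_series_re_term.
  - now apply Series_correct, ex_series_sq_term. }
assert (0 < exp (- (PI * y)) * alt_harmonic a) by (apply Rmult_lt_0_compat; lra).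
lra.
Qed.

(** * The kernel and the central ratios *)

Definition node (j : nat) : R := 1 + 2 * INR j.

Lemma node_ge_1 (j : nat) : 1 <= node j.
Proof. unfold node; pose proof (pos_INR j); lra. Qed.

Lemma node_S (j : nat) : node (S j) = node j + 2.
Proof. unfold node; rewrite S_INR; ring. Qed.

Lemma ratio_sqr_step (j : nat) :
  (node j + 1) ^ 2 * central_ratio (S j) ^ 2 = node j ^ 2 * central_ratio j ^ 2.
Proof.
change (central_ratio (S j)) with (central_ratio j * (INR (2 * j + 1) / INR (2 * j + 2))).
replace (INR (2 * j + 1)) with (node j) by (unfold node; rewrite plus_INR, mult_INR; simpl; ring).
replace (INR (2 * j + 2)) with (node j + 1) by (unfold node; rewrite plus_INR, mult_INR; simpl; ring).
pose proof (node_ge_1 j); field; lra.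
Qed.

(** A Wallis-type bound; the induction closes because [n * (n + 2) <= (n + 1) ^ 2]. *)
Lemma ratio_sqr_bounds (j : nat) : 0 < central_ratio j ^ 2 <= / node j.
Proof.
induction j as [|j [IH1 IH2]].
- unfold node; simpl; split; [lra|]; apply Req_le; field.
- pose proof (ratio_sqr_step j) as H; rewrite node_S; pose proof (node_ge_1 j) as Hn.
  revert H IH1 IH2; generalize (central_ratio (S j) ^ 2) (central_ratio j ^ 2).
  intros u v H IH1 IH2.
  assert (Hu : u = (node j) ^ 2 * v / (node j + 1) ^ 2) by (rewrite <- H; field; lra).
  revert Hu Hn IH2; generalize (node j) as n; intros n Hu Hn IH2; rewrite Hu; split.
  + apply Rdiv_lt_0_compat; [|nra]; apply Rmult_lt_0_compat; nra.
  + apply Rle_trans with (n ^ 2 * / n / (n + 1) ^ 2).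
    * apply Rmult_le_compat_r; [apply Rlt_le, Rinv_0_lt_compat; nra|].
      apply Rmult_le_compat_l; nra.
    * apply Rmult_le_reg_r with ((n + 1) ^ 2 * (n + 2)); [nra|].
      replace (n ^ 2 * / n / (n + 1) ^ 2 * ((n + 1) ^ 2 * (n + 2))) with (n * (n + 2))
        by (field; lra).
      replace (/ (n + 2) * ((n + 1) ^ 2 * (n + 2))) with ((n + 1) ^ 2) by (field; lra).
      nra.
Qed.

Lemma ratio_sqr_scal_bound (c x : R) (j : nat) : 0 <= x <= c / node j ->
  0 <= central_ratio j ^ 2 * x <= 3 / 2 * c * telescope 1 j.
Proof.
intros Hx; destruct (ratio_sqr_bounds j) as [H1 H2]; pose proof (node_ge_1 j) as Hn.
assert (0 < / node j) by (apply Rinv_0_lt_compat; lra).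
split; [apply Rmult_le_pos; lra|].
apply Rle_trans with (/ node j * (c / node j)).
- apply Rmult_le_compat; lra.
- assert (Hc : 0 <= c).
  { unfold Rdiv in Hx; destruct (Rle_lt_dec 0 c); auto; nra. }
  pose proof (inv_sqr_le_telescope 1 j ltac:(lra)) as H4; fold (node j) in H4.
  replace (/ node j * (c / node j)) with (c * / node j ^ 2) by (field; lra).
  nra.
Qed.

(* [shift_kern n m] is (n - 1)^2 [shift_kern' (n - 2) m], rewritten so that it still
   makes sense (and vanishes) at n = 1. *)
Definition shift_kern (n m : R) : R :=
  2 * (n - 1) * (1 - (n - 1) * alt_harmonic n + (n - 1) * alt_harmonic (m + 1)) / (n + m - 1)
  - 2 * (n - 1) / (m + 1) + 2 * (n - 1) ^ 2 * alt_harmonic2 n (m + 2).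

Definition shift_kern' (n m : R) : R :=
  2 * (alt_harmonic (n + 1) + alt_harmonic (m + 1)) / (n + m + 1)
  - 2 * alt_harmonic2 (n + 1) (m + 1).

Lemma shift_kern_shift (n m : R) : 1 <= n -> 1 <= m ->
  shift_kern (n + 2) m = (n + 1) ^ 2 * shift_kern' n m.
Proof.
intros Hn Hm; unfold shift_kern, shift_kern'.
pose proof (alt_harmonic_succ (n + 1) ltac:(lra)) as S1.
pose proof (alt_harmonic2_succ (n + 1) (m + 1) ltac:(lra) ltac:(lra)) as S2.
replace (n + 1 + 1) with (n + 2) in * by ring; replace (m + 1 + 1) with (m + 2) in * by ring.
replace (alt_harmonic (n + 2)) with (/ (n + 1) - alt_harmonic (n + 1)) by lra.
replace (alt_harmonic2 (n + 2) (m + 2)) with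
  (/ ((n + 1) * (m + 1)) - alt_harmonic2 (n + 1) (m + 1)) by lra.
field; repeat split; lra.
Qed.

(** The recurrence operator in m is traded for one in n. By [shift_kern_shift] the right-hand side
    is the difference of one expression at n and n - 2, with weights that match [ratio_sqr_step];
    this makes the weighted sum over the odd n telescope. *)
Lemma kern_recurrence (n m : R) : 1 <= n -> 1 <= m ->
  m ^ 2 * kern n m - (m + 1) ^ 2 * kern n (m + 2) = n ^ 2 * shift_kern' n m - shift_kern n m.
Proof.
intros Hn Hm; unfold kern, shift_kern, shift_kern'.
pose proof (alt_harmonic_succ n ltac:(lra)) as S1.
pose proof (alt_harmonic_succ m ltac:(lra)) as S2.
pose proof (alt_harmonic_succ (m + 1) ltac:(lra)) as S3.
replace (m + 1 + 1) with (m + 2) in S3 by ring.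
pose proof (alt_harmonic2_succ n m ltac:(lra) ltac:(lra)) as T1.
pose proof (alt_harmonic2_mult n m ltac:(lra) ltac:(lra)) as M1.
pose proof (alt_harmonic2_mult n (m + 2) ltac:(lra) ltac:(lra)) as M2.
replace (alt_harmonic2 (n + 1) (m + 1)) with (/ (n * m) - alt_harmonic2 n m) by lra.
replace (alt_harmonic (n + 1)) with (/ n - alt_harmonic n) by lra.
replace (alt_harmonic (m + 2)) with (/ (m + 1) - / m + alt_harmonic m) in * by lra.
replace (alt_harmonic (m + 1)) with (/ m - alt_harmonic m) in * by lra.
clear S1 S2 S3 T1; revert M1 M2.
generalize (alt_harmonic n) (alt_harmonic m) (alt_harmonic2 n m) (alt_harmonic2 n (m + 2)).
intros p q u v M1 M2.
(* The divided differences [u] and [v] are known only through their products with m - n and m + 2 -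
   n. Hence m^2 is written as n^2 + (m + n)(m - n), and likewise (m + 1)^2 as (n - 1)^2 + (m + n)(m
   + 2 - n). *)
replace (m ^ 2 * (2 * (p + q) / (n + m - 1) + 2 * u)) with
  (m ^ 2 * (2 * (p + q) / (n + m - 1)) + 2 * (n ^ 2 * u + (m + n) * ((m - n) * u))) by ring.
rewrite M1.
replace ((m + 1) ^ 2 * (2 * (p + (/ (m + 1) - / m + q)) / (n + (m + 2) - 1) + 2 * v)) with
  ((m + 1) ^ 2 * (2 * (p + (/ (m + 1) - / m + q)) / (n + (m + 2) - 1))
   + 2 * ((n - 1) ^ 2 * v + (m + n) * ((m + 2 - n) * v))) by ring.
rewrite M2; field; repeat split; lra.
Qed.

(** The boundary term of the telescoping sum carries the weight [n ^ 2 * central_ratio j ^ 2], at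
    most n, so decay n^(-2) is required. The condition 2 m <= n keeps n - m at least n / 2, away
    from the diagonal. *)
Lemma shift_kern'_bound (n m : R) : 1 <= m -> 2 * m <= n ->
  Rabs (shift_kern' n m) <= (8 * m + 12) / n ^ 2.
Proof.
intros Hm Hn; unfold shift_kern'.
pose proof (alt_harmonic2_mult (n + 1) (m + 1) ltac:(lra) ltac:(lra)) as M.
pose proof (alt_harmonic_bounds (n + 1) ltac:(lra)) as [A1 A2].
pose proof (alt_harmonic_bounds (m + 1) ltac:(lra)) as [B1 B2].
assert (0 < / (2 * (n + 1))) by (apply Rinv_0_lt_compat; lra).
assert (0 < / (2 * (m + 1))) by (apply Rinv_0_lt_compat; lra).
assert (/ (m + 1) <= 1) by (rewrite <- Rinv_1; apply Rinv_le_contravar; lra).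
assert (E : alt_harmonic2 (n + 1) (m + 1) = (alt_harmonic (m + 1) - alt_harmonic (n + 1)) / (n - m)).
{ apply Rmult_eq_reg_l with (m + 1 - (n + 1)); [|lra]; rewrite M; field; lra. }
rewrite E; revert A1 A2 B1 B2; generalize (alt_harmonic (n + 1)) (alt_harmonic (m + 1)).
intros p q A1 A2 B1 B2.
replace (2 * (p + q) / (n + m + 1) - 2 * ((q - p) / (n - m))) with
  ((2 * p * (2 * n + 1) - 2 * q * (2 * m + 1)) * / ((n + m + 1) * (n - m))) by (field; lra).
assert (Hd : 0 < / ((n + m + 1) * (n - m)) <= 2 * / n ^ 2).
{ assert (0 < (n + m + 1) * (n - m)) by (apply Rmult_lt_0_compat; lra).
  split; [now apply Rinv_0_lt_compat|].
  replace (2 * / n ^ 2) with (/ (n * (n / 2))) by (field; lra).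
  apply Rinv_le_contravar; nra. }
rewrite Rabs_mult, (Rabs_right (/ _)) by lra.
replace ((8 * m + 12) / n ^ 2) with ((4 * m + 6) * (2 * / n ^ 2)) by (field; lra).
apply Rmult_le_compat; [apply Rabs_pos | lra | | lra].
assert (p * (n + 1) <= 1).
{ apply Rle_trans with (/ (n + 1) * (n + 1)); [apply Rmult_le_compat_r; lra|].
  rewrite Rinv_l; lra. }
apply Rabs_le; split; nra.
Qed.

Lemma kern_series_term (m : R) (j : nat) : 1 <= m ->
  0 <= central_ratio j ^ 2 * kern (node j) m <= 9 * telescope 1 j.
Proof.
intros Hm; pose proof (kern_bounds (node j) m (node_ge_1 j) Hm).
replace 9 with (3 / 2 * 6) by field; apply ratio_sqr_scal_bound; lra.
Qed.

Lemma ex_series_telescope_le (c : R) (a : nat -> R) :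
  (forall j, Rabs (a j) <= c * telescope 1 j) -> ex_series a.
Proof.
intros H; apply (ex_series_le (K := R_AbsRing) (V := R_CompleteNormedModule) _
  (fun j => c * telescope 1 j)); auto.
eexists; apply is_series_telescope_scal; lra.
Qed.

Lemma ex_series_kern (m : R) : 1 <= m ->
  ex_series (fun j => central_ratio j ^ 2 * kern (node j) m).
Proof.
intros Hm; apply ex_series_telescope_le with 9; intros j.
pose proof (kern_series_term m j Hm); rewrite Rabs_right; lra.
Qed.

Definition kern_sum (m : R) : R := Series (fun j => central_ratio j ^ 2 * kern (node j) m).

(** The partial sums of the weighted defect equal their upper boundary term, because [shift_kern]
    vanishes at n = 1. That boundary term tends to 0. *)
Lemma kern_sum_recurrence (m : R) : 1 <= m ->
  m ^ 2 * kern_sum m = (m + 1) ^ 2 * kern_sum (m + 2).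
Proof.
intros Hm; unfold kern_sum.
pose proof (ex_series_kern m Hm) as X1; pose proof (ex_series_kern (m + 2) ltac:(lra)) as X2.
assert (E : Series (fun j => m ^ 2 * (central_ratio j ^ 2 * kern (node j) m)
  - (m + 1) ^ 2 * (central_ratio j ^ 2 * kern (node j) (m + 2))) = 0).
{ apply is_series_unique.
  set (t := fun j => _ - _); change (is_lim_seq (sum_n t) 0).
  apply is_lim_seq_ext with
    (fun J => central_ratio J ^ 2 * (node J ^ 2 * shift_kern' (node J) m)).
  - intros J; induction J as [|J IH].
    + rewrite sum_O; unfold t.
      pose proof (kern_recurrence (node 0) m (node_ge_1 0) Hm) as K.
      assert (S0 : shift_kern (node 0) m = 0).
      { unfold shift_kern; replace (node 0) with 1 by (unfold node; simpl; ring).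
        field; split; lra. }
      rewrite S0 in K; simpl central_ratio; rewrite pow1; lra.
    + rewrite sum_n_S, <- IH; unfold t.
      pose proof (kern_recurrence (node (S J)) m (node_ge_1 _) Hm) as K.
      rewrite node_S in *.
      pose proof (shift_kern_shift (node J) m (node_ge_1 J) Hm) as K2; rewrite K2 in K.
      pose proof (ratio_sqr_step J) as R2.
      revert K R2; generalize (central_ratio (S J) ^ 2) (central_ratio J ^ 2); intros a b K R2.
      replace (m ^ 2 * (a * kern (node J + 2) m) - (m + 1) ^ 2 * (a * kern (node J + 2) (m + 2)))
        with (a * (m ^ 2 * kern (node J + 2) m - (m + 1) ^ 2 * kern (node J + 2) (m + 2))) by ring.
      rewrite K.
      replace (b * (node J ^ 2 * shift_kern' (node J) m)) with
        (node J ^ 2 * b * shift_kern' (node J) m) by ring.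
      rewrite <- R2; ring.
  - apply is_lim_seq_abs_0.
    apply is_lim_seq_le_le_loc with (fun _ => 0) (fun J => (8 * m + 12) * / (1 + 2 * INR J)).
    (* Indices above the integer part of m satisfy [2 * m <= node J]. *)
    + destruct (nfloor_ex m ltac:(lra)) as [M [_ HM]].
      exists (S M); intros J HJ.
      assert (HJ' : INR (S M) <= INR J) by (apply le_INR; auto).
      rewrite S_INR in HJ'; fold (node J).
      assert (Hn : 2 * m <= node J) by (unfold node; lra).
      pose proof (shift_kern'_bound (node J) m Hm Hn) as B.
      destruct (ratio_sqr_bounds J) as [W1 W2].
      split; [apply Rabs_pos|].
      rewrite Rabs_mult, (Rabs_right (central_ratio J ^ 2)) by lra.
      rewrite Rabs_mult, (Rabs_right (node J ^ 2)) by (apply Rle_ge, pow2_ge_0).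
      rewrite Rmult_comm; apply Rmult_le_compat; try lra.
      * apply Rmult_le_pos; [apply pow2_ge_0 | apply Rabs_pos].
      * apply Rle_trans with (node J ^ 2 * ((8 * m + 12) / node J ^ 2)).
        -- apply Rmult_le_compat_l; [apply pow2_ge_0 | auto].
        -- apply Req_le; field; lra.
    + apply is_lim_seq_const.
    + apply is_lim_seq_scal_inv; lra. }
rewrite Series_minus in E;
  [|exact (ex_series_scal_l (m ^ 2) _ X1) | exact (ex_series_scal_l ((m + 1) ^ 2) _ X2)].
rewrite !Series_scal_l in E; lra.
Qed.

Lemma kern_sum_node (N : nat) : kern_sum (node N) = kern_sum 1 * central_ratio N ^ 2.
Proof.
induction N as [|N IH].
- replace (node 0) with 1 by (unfold node; simpl; ring); simpl; ring.
- pose proof (kern_sum_recurrence (node N) (node_ge_1 N)) as H.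
  pose proof (ratio_sqr_step N) as H2; pose proof (node_ge_1 N).
  rewrite node_S; rewrite IH in H.
  apply Rmult_eq_reg_l with ((node N + 1) ^ 2); [|nra].
  rewrite <- H, (Rmult_comm (kern_sum 1)), <- Rmult_assoc, <- H2; ring.
Qed.

(** * Superposition over the levels *)

Lemma pow_le_fact_exp (y : R) (k : nat) : 0 <= y -> y ^ k <= INR (fact k) * exp y.
Proof.
intros Hy; pose proof (exp_ge_taylor y k Hy) as H.
assert (Hk : y ^ k / INR (fact k) <= sum_f_R0 (fun k => y ^ k / INR (fact k)) k).
{ destruct k as [|k]; [simpl; lra|]; rewrite tech5.
  assert (0 <= sum_f_R0 (fun k => y ^ k / INR (fact k)) k); [|lra].
  apply cond_pos_sum; intros i; apply Rdiv_le_0_compat; [now apply pow_le | apply INR_fact_lt_0]. }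
pose proof (INR_fact_lt_0 k).
apply Rmult_le_reg_l with (/ INR (fact k)); [now apply Rinv_0_lt_compat|].
rewrite <- Rmult_assoc, Rinv_l by lra; unfold Rdiv in *; lra.
Qed.

(** The inequality 1 + 2 t <= exp(2 t) yields [t * exp t <= (1 + 2 * t) * sinh t]. For t = PI y one
    has y <= t <= 4 y, whence the constant 8. *)
Lemma csch_weight_exp_bound (y : R) : 0 < y -> csch_weight y <= (1 + 8 * y) * exp (- y).
Proof.
intros Hy; pose proof PI2_1; pose proof PI_4; unfold csch_weight.
set (t := PI * y); assert (Ht : 0 < t) by (unfold t; nra).
assert (Hs : t * exp t <= sinh t * (1 + 2 * t)).
{ assert (E : exp (- t) * exp (2 * t) = exp t) by (rewrite <- exp_plus; f_equal; ring).
  pose proof (exp_ineq1_le (2 * t)); pose proof (exp_pos (- t)).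
  assert (exp (- t) * (1 + 2 * t) <= exp t) by (rewrite <- E; apply Rmult_le_compat_l; lra).
  unfold sinh; lra. }
pose proof (sinh_PI_pos y Hy) as Hp; fold t in Hp.
apply Rmult_le_reg_r with (sinh t); auto.
unfold Rdiv; rewrite Rmult_assoc, Rinv_l, Rmult_1_r by lra.
assert (Hexp : exp y <= exp t).
{ destruct (Req_dec y t) as [<-|]; [lra|]; left; apply exp_increasing; unfold t in *; nra. }
rewrite exp_Ropp; pose proof (exp_pos y).
apply Rmult_le_reg_r with (exp y); auto.
replace ((1 + 8 * y) * / exp y * sinh t * exp y) with ((1 + 8 * y) * sinh t) by (field; lra).
assert (Hyt : y <= t <= 4 * y) by (unfold t; nra).
assert (y * exp y <= t * exp t) by (apply Rmult_le_compat; lra).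
assert (sinh t * (1 + 2 * t) <= sinh t * (1 + 8 * y)) by (apply Rmult_le_compat_l; lra).
lra.
Qed.

Lemma admissible_moment (p : nat) :
  exists C, 0 <= C /\ admissible C (fun y => y ^ p * csch_weight y).
Proof.
(* The product of y^p, 1 + 8 y and 1 + y^2 has four monomials, each bounded by a factorial times exp
   y. *)
exists (INR (fact p) + 8 * INR (fact (p + 1)) + INR (fact (p + 2)) + 8 * INR (fact (p + 3))).
pose proof (pos_INR (fact p)); pose proof (pos_INR (fact (p + 1))).
pose proof (pos_INR (fact (p + 2))); pose proof (pos_INR (fact (p + 3))).
split; [lra|]; split; intros y Hy.
- apply (continuous_mult (K := R_AbsRing) (fun y => y ^ p)); [|now apply continuous_csch_weight].
  apply continuous_of_ex_derive; now auto_derive.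
- pose proof (csch_weight_pos y Hy); pose proof (pow_lt y p Hy) as Hp.
  rewrite Rabs_right by nra.
  apply Rmult_le_reg_r with (1 + y ^ 2); [nra|].
  unfold Rdiv; rewrite Rmult_assoc, (Rmult_assoc _ (/ _)), Rinv_l, Rmult_1_r by nra.
  apply Rle_trans with (y ^ p * ((1 + 8 * y) * exp (- y) * (1 + y ^ 2))).
  + apply Rmult_le_compat_l; [lra|]; apply Rmult_le_compat_r; [nra|].
    now apply csch_weight_exp_bound.
  + rewrite exp_Ropp; pose proof (exp_pos y).
    apply Rmult_le_reg_r with (exp y); auto.
    replace (y ^ p * ((1 + 8 * y) * / exp y * (1 + y ^ 2)) * exp y) with
      (y ^ p + 8 * y ^ (p + 1) + y ^ (p + 2) + 8 * y ^ (p + 3))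
      by (rewrite !pow_add; field; lra).
    pose proof (pow_le_fact_exp y p ltac:(lra)); pose proof (pow_le_fact_exp y (p + 1) ltac:(lra)).
    pose proof (pow_le_fact_exp y (p + 2) ltac:(lra)); pose proof (pow_le_fact_exp y (p + 3) ltac:(lra)).
    lra.
Qed.

(** The function a of the representation; [mass_gap] is g. *)
Definition mass (y : R) : R := Series (fun j => central_ratio j ^ 2 * inv_sq_sum (node j) y).
Definition mass_gap (y : R) : R := Series (fun j => central_ratio j ^ 2 * gap y (node j)).

Lemma mass_term (y : R) (j : nat) :
  0 <= central_ratio j ^ 2 * inv_sq_sum (node j) y <= 9 / 2 * telescope 1 j.
Proof.
pose proof (inv_sq_sum_bounds (node j) y (node_ge_1 j)).
replace (9 / 2) with (3 / 2 * 3) by field; apply ratio_sqr_scal_bound; lra.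
Qed.

Lemma mass_gap_term (y : R) (j : nat) : 0 < y ->
  0 <= central_ratio j ^ 2 * gap y (node j) < central_ratio j ^ 2 * inv_sq_sum (node j) y.
Proof.
intros Hy; pose proof (gap_nonneg y j Hy) as H1; fold (node j) in H1.
pose proof (gap_lt_inv_sq_sum y (node j) Hy (node_ge_1 j)).
pose proof (ratio_sqr_bounds j) as [W _].
split; [apply Rmult_le_pos; lra | apply Rmult_lt_compat_l; lra].
Qed.

Lemma ex_series_mass (y : R) : ex_series (fun j => central_ratio j ^ 2 * inv_sq_sum (node j) y).
Proof.
apply ex_series_telescope_le with (9 / 2); intros j; pose proof (mass_term y j).
rewrite Rabs_right; lra.
Qed.

Lemma ex_series_mass_gap (y : R) : 0 < y ->
  ex_series (fun j => central_ratio j ^ 2 * gap y (node j)).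
Proof.
intros Hy; apply ex_series_telescope_le with (9 / 2); intros j.
pose proof (mass_term y j); pose proof (mass_gap_term y j Hy).
rewrite Rabs_right; lra.
Qed.

Lemma Series_nonneg (a : nat -> R) : (forall j, 0 <= a j) -> ex_series a -> 0 <= Series a.
Proof.
intros H Ha; replace 0 with (Series (fun _ : nat => 0)).
- apply Series_le; auto; intros; split; [lra | auto].
- apply is_series_unique; change (is_lim_seq (sum_n (fun _ : nat => 0)) 0).
  apply is_lim_seq_ext with (fun _ => 0); [|apply is_lim_seq_const].
  intros k; rewrite sum_n_const; ring.
Qed.

Lemma Series_pos (a : nat -> R) : (forall j, 0 < a j) -> ex_series a -> 0 < Series a.
Proof.
intros H Ha; rewrite Series_incr_1 by auto.
apply Rplus_lt_le_0_compat; auto.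
apply Series_nonneg; [intros; now apply Rlt_le|].
now apply (ex_series_incr_1 (K := R_AbsRing) a).
Qed.

Lemma mass_bounds (y : R) : 0 < y -> 0 <= mass_gap y < mass y /\ mass y <= 9 / 2.
Proof.
intros Hy; pose proof (ex_series_mass y) as H1; pose proof (ex_series_mass_gap y Hy) as H2.
split; [split|].
- apply Series_nonneg; auto; intros j; now apply mass_gap_term.
- apply Rlt_0_minus; unfold mass, mass_gap; rewrite <- Series_minus by auto.
  apply Series_pos; [|now apply (ex_series_minus (K := R_AbsRing) (V := R_NormedModule))].
  intros j; pose proof (mass_gap_term y j Hy); lra.
- apply Rle_trans with (Series (fun j => 9 / 2 * telescope 1 j)).
  + apply Series_le; [intros j; apply mass_term|].
    eexists; apply is_series_telescope_scal; lra.
  + rewrite (is_series_unique _ _ (is_series_telescope_scal (9 / 2) 1 ltac:(lra))); lra.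
Qed.

Lemma continuous_series_telescope (c : R) (f : nat -> R -> R) :
  (forall j y, 0 < y -> continuous (f j) y) ->
  (forall j y, 0 < y -> Rabs (f j y) <= c * telescope 1 j) ->
  forall y, 0 < y -> continuous (fun y => Series (fun j => f j y)) y.
Proof.
intros Hc Hb; apply continuous_undivide.
assert (A : admissible (Series (fun j => c * telescope 1 j * (1 + / 1 ^ 2)))
  (fun y => Series (fun j => f j y * / (1 ^ 2 + y ^ 2)))).
{ apply admissible_series.
  - intros j; apply admissible_mult; auto; apply admissible_inv; lra.
  - apply ex_series_scal_r; eexists; apply is_series_telescope_scal; lra. }
intros y Hy; apply (continuous_positive_ext (fun y => Series (fun j => f j y * / (1 ^ 2 + y ^ 2)))); auto.
- intros; apply Series_scal_r.
- apply A.
Qed.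

Lemma continuous_gap (a y : R) : 1 <= a -> 0 < y -> continuous (fun y => gap y a) y.
Proof.
intros Ha Hy; unfold gap; apply (continuous_minus (V := R_NormedModule)).
- now apply continuous_re.
- apply continuous_of_ex_derive; now auto_derive.
Qed.

Lemma continuous_mass (y : R) : 0 < y -> continuous mass y.
Proof.
revert y; apply (continuous_series_telescope (9 / 2)
  (fun j y => central_ratio j ^ 2 * inv_sq_sum (node j) y)).
- intros j y Hy; apply (continuous_mult (K := R_AbsRing) (fun _ => central_ratio j ^ 2)).
  + apply continuous_const.
  + apply continuous_sq; auto using node_ge_1.
- intros j y Hy; pose proof (mass_term y j); rewrite Rabs_right; lra.
Qed.

Lemma continuous_mass_gap (y : R) : 0 < y -> continuous mass_gap y.
Proof.
revert y; apply (continuous_series_telescope (9 / 2)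
  (fun j y => central_ratio j ^ 2 * gap y (node j))).
- intros j y Hy; apply (continuous_mult (K := R_AbsRing) (fun _ => central_ratio j ^ 2)).
  + apply continuous_const.
  + apply continuous_gap; auto using node_ge_1.
- intros j y Hy; pose proof (mass_term y j); pose proof (mass_gap_term y j Hy).
  rewrite Rabs_right; lra.
Qed.

Definition total_fun (X y : R) : R :=
  csch_weight y * ((mass_gap y - X * mass y) * / (X ^ 2 + y ^ 2)).

Definition total_int (X : R) : R := 2 * halfline_int (total_fun X).

(** The admissibility constants of the levels are O(1 / [node j]), so with the weights
    [central_ratio j ^ 2] they are summable and the superposition may be integrated term by term. *)
Lemma is_series_total_int (X : R) : 0 < X ->
  is_series (fun j => central_ratio j ^ 2 * level_int (node j) X) (total_int X).
Proof.
intros HX; set (c := (5 / 2 + 3 * X) * (1 + / X ^ 2)).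
assert (HX2 : 0 < / X ^ 2) by (apply Rinv_0_lt_compat, pow_lt; lra).
assert (Hc : 0 <= c) by (unfold c; nra).
set (M := fun j => 3 / 2 * c * telescope 1 j).
assert (HA : forall j, admissible (c / node j) (level_fun (node j) X)).
{ intros j; apply admissible_level; auto using node_ge_1. }
assert (Hadm : forall j, admissible (M j) (fun y => central_ratio j ^ 2 * level_fun (node j) X y)).
{ intros j; pose proof (ratio_sqr_bounds j) as [W _]; pose proof (node_ge_1 j).
  apply admissible_le with (Rabs (central_ratio j ^ 2) * (c / node j)).
  - rewrite Rabs_right by lra; apply ratio_sqr_scal_bound.
    split; [apply Rdiv_le_0_compat; lra | lra].
  - now apply admissible_scal. }
assert (HM : ex_series M) by (eexists; apply is_series_telescope_scal; lra).
pose proof (halfline_int_series M _ Hadm HM) as HS.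
apply is_series_ext with
  (fun j => 2 * halfline_int (fun y => central_ratio j ^ 2 * level_fun (node j) X y)).
- intros j; unfold level_int; rewrite (halfline_int_scal _ _ _ (HA j)).
  real_eq; ring.
- unfold total_int; rewrite (halfline_int_ext (total_fun X)
    (fun y => Series (fun j => central_ratio j ^ 2 * level_fun (node j) X y))).
  + exact (is_series_scal_l 2 _ _ HS).
  + intros y Hy; unfold total_fun, level_fun.
    rewrite (Series_ext _ (fun j => (central_ratio j ^ 2 * gap y (node j)
      - X * (central_ratio j ^ 2 * inv_sq_sum (node j) y)) * (csch_weight y * / (X ^ 2 + y ^ 2)))).
    * rewrite Series_scal_r, Series_minus, Series_scal_l;
        [| now apply ex_series_mass_gap
         | exact (ex_series_scal_l X _ (ex_series_mass y))].
      unfold mass, mass_gap; ring.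
    * intros j; unfold gap; ring.
Qed.

(** The coefficient of the logarithm in the increments of [total_int], hence the positive factor
    between [total_int] and f(N). *)
Definition log_coef : R := 2 * Series (fun j => central_ratio j ^ 2 * alt_harmonic (node j)).

Lemma ex_series_log_coef : ex_series (fun j => central_ratio j ^ 2 * alt_harmonic (node j)).
Proof.
apply ex_series_telescope_le with (3 / 2 * 1); intros j; pose proof (node_ge_1 j).
pose proof (alt_harmonic_bounds (node j) ltac:(lra)) as [A1 A2].
assert (0 < / (2 * node j)) by (apply Rinv_0_lt_compat; lra).
assert (H2 : 0 <= alt_harmonic (node j) <= 1 / node j) by (unfold Rdiv; lra).
pose proof (ratio_sqr_scal_bound _ _ j H2); rewrite Rabs_right; lra.
Qed.

Lemma log_coef_pos : 0 < log_coef.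
Proof.
unfold log_coef; apply Rmult_lt_0_compat; [lra|].
apply Series_pos; [|apply ex_series_log_coef].
intros j; pose proof (node_ge_1 j); pose proof (ratio_sqr_bounds j) as [W _].
pose proof (alt_harmonic_bounds (node j) ltac:(lra)) as [A1 A2].
assert (0 < / (2 * node j)) by (apply Rinv_0_lt_compat; lra).
apply Rmult_lt_0_compat; lra.
Qed.

Lemma total_int_diff (X : R) : 0 < X ->
  total_int X - total_int (X + 2) = log_coef * ln (1 + 2 / X) - kern_sum (X + 1).
Proof.
intros HX.
pose proof (is_series_total_int X HX) as H1.
pose proof (is_series_total_int (X + 2) ltac:(lra)) as H2.
assert (H3 : Series (fun j => central_ratio j ^ 2 * level_int (node j) X
  - central_ratio j ^ 2 * level_int (node j) (X + 2)) = total_int X - total_int (X + 2))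
  by (apply is_series_unique; exact (is_series_minus _ _ _ _ H1 H2)).
rewrite <- H3.
rewrite (Series_ext _ (fun j => 2 * ln (1 + 2 / X) * (central_ratio j ^ 2 * alt_harmonic (node j))
  - central_ratio j ^ 2 * kern (node j) (X + 1))).
- rewrite Series_minus, Series_scal_l; [unfold log_coef, kern_sum; ring | |].
  + exact (ex_series_scal_l (2 * ln (1 + 2 / X)) _ ex_series_log_coef).
  + apply ex_series_kern; lra.
- intros j.
  pose proof (level_int_diff (node j) X (node_ge_1 j) HX) as D.
  replace (level_int (node j) X) with (level_int (node j) (X + 2) +
    (2 * alt_harmonic (node j) * ln (1 + 2 / X) - kern (node j) (X + 1))) by lra.
  ring.
Qed.

(** * Remainders *)

Definition even_fun (J : nat) (X y : R) : R :=
  y ^ (2 * J) * csch_weight y * ((mass_gap y - X * mass y) * / (X ^ 2 + y ^ 2)).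

Definition odd_fun (J : nat) (X y : R) : R :=
  y ^ (2 * J) * csch_weight y * ((mass_gap y + y ^ 2 / X * mass y) * / (X ^ 2 + y ^ 2)).

Definition odd_moment (J : nat) : R :=
  halfline_int (fun y => mass y * (y ^ (2 * J) * csch_weight y)).

Definition even_moment (J : nat) : R :=
  halfline_int (fun y => mass_gap y * (y ^ (2 * J) * csch_weight y)).

Lemma admissible_odd_moment (J : nat) :
  exists C, admissible C (fun y => mass y * (y ^ (2 * J) * csch_weight y)).
Proof.
destruct (admissible_moment (2 * J)) as [C [_ HC]].
exists (9 / 2 * C); apply admissible_mult; auto using continuous_mass.
intros y Hy; pose proof (mass_bounds y Hy); rewrite Rabs_right; lra.
Qed.

(** [C] is uniform in X, so the factor 1 / X becomes the extra order of the remainder. It comes from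
    a numerator of size at most 9/2 X against a denominator of at least X^2. *)
Lemma admissible_even_fun (J : nat) :
  exists C, forall X, 1 <= X -> admissible (C / X) (even_fun J X).
Proof.
destruct (admissible_moment (2 * J)) as [C [HC0 HC]].
exists (9 / 2 * C); intros X HX.
replace (9 / 2 * C / X) with (9 / 2 / X * C) by (field; lra).
apply admissible_ext with (fun y => (mass_gap y - X * mass y) * / (X ^ 2 + y ^ 2)
  * (y ^ (2 * J) * csch_weight y)); [intros; unfold even_fun; ring|].
apply admissible_mult; auto.
- intros y Hy.
  apply (continuous_mult (K := R_AbsRing) (fun y => mass_gap y - X * mass y)).
  + apply (continuous_minus (V := R_NormedModule)); [now apply continuous_mass_gap|].
    apply (continuous_mult (K := R_AbsRing) (fun _ => X)); [apply continuous_const|].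
    now apply continuous_mass.
  + apply continuous_inv_sqr; lra.
- intros y Hy; pose proof (mass_bounds y Hy) as [[M1 M2] M3].
  pose proof (inv_sqr_bounds X y ltac:(lra) Hy).
  rewrite Rabs_mult, (Rabs_right (/ _)) by lra.
  replace (9 / 2 / X) with (9 / 2 * X * / X ^ 2) by (field; lra).
  apply Rmult_le_compat; [apply Rabs_pos | lra | | lra].
  apply Rabs_le; split; nra.
Qed.

(** With the term X a expanded, the numerator no longer grows with X. The additional y^2 is absorbed
    by the next moment, whence the second constant [D]. *)
Lemma admissible_odd_fun (J : nat) :
  exists C, forall X, 1 <= X -> admissible (C / X ^ 2) (odd_fun J X).
Proof.
destruct (admissible_moment (2 * J)) as [C [HC0 HC]].
destruct (admissible_moment (2 * S J)) as [D [HD0 HD]].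
exists (9 / 2 * (C + D)); intros X HX.
assert (HX2 : 0 < / X ^ 2) by (apply Rinv_0_lt_compat; nra).
assert (HX1 : 0 < / X <= 1).
{ split; [apply Rinv_0_lt_compat; lra | rewrite <- Rinv_1; apply Rinv_le_contravar; lra]. }
replace (9 / 2 * (C + D) / X ^ 2) with (9 / 2 * / X ^ 2 * C + 9 / 2 * / X ^ 2 * D)
  by (field; lra).
apply admissible_ext with (fun y =>
  mass_gap y * / (X ^ 2 + y ^ 2) * (y ^ (2 * J) * csch_weight y)
  + mass y * / X * / (X ^ 2 + y ^ 2) * (y ^ (2 * S J) * csch_weight y)).
{ intros y Hy; unfold odd_fun.
  replace (2 * S J)%nat with (2 * J + 2)%nat by lia; rewrite pow_add; unfold Rdiv; ring. }
apply admissible_plus; apply admissible_mult; auto.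
- intros y Hy; apply (continuous_mult (K := R_AbsRing) mass_gap); [now apply continuous_mass_gap|].
  apply continuous_inv_sqr; lra.
- intros y Hy; pose proof (mass_bounds y Hy) as [[M1 M2] M3].
  pose proof (inv_sqr_bounds X y ltac:(lra) Hy).
  rewrite Rabs_mult, !Rabs_right by lra; apply Rmult_le_compat; lra.
- intros y Hy; apply (continuous_mult (K := R_AbsRing) (fun y => mass y * / X)).
  + apply (continuous_mult (K := R_AbsRing) mass); [now apply continuous_mass | apply continuous_const].
  + apply continuous_inv_sqr; lra.
- intros y Hy; pose proof (mass_bounds y Hy) as [[M1 M2] M3].
  pose proof (inv_sqr_bounds X y ltac:(lra) Hy).
  assert (0 <= mass y * / X <= 9 / 2) by nra.
  rewrite Rabs_mult, !Rabs_right by lra; apply Rmult_le_compat; lra.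
Qed.

Definition even_rem (J : nat) (X : R) : R :=
  (-1) ^ J * (2 / X ^ (2 * J)) * halfline_int (even_fun J X).

Definition odd_rem (J : nat) (X : R) : R :=
  (-1) ^ J * (2 / X ^ (2 * J)) * halfline_int (odd_fun J X).

(** Only the a-part is expanded: [X / (X^2 + y^2)] equals [1 / X] minus [(y^2 / X) / (X^2 + y^2)].
    This produces the odd power of 1 / X. *)
Lemma even_rem_step (J : nat) (X : R) : 1 <= X ->
  even_rem J X = (-1) ^ S J * 2 * odd_moment J / X ^ S (2 * J) + odd_rem J X.
Proof.
intros HX; unfold even_rem, odd_rem.
destruct (admissible_even_fun J) as [C HC]; specialize (HC X HX).
destruct (admissible_odd_moment J) as [M HM].
assert (E : halfline_int (odd_fun J X) = halfline_int (even_fun J X) + / X * odd_moment J).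
{ unfold odd_moment; rewrite <- (halfline_int_scal _ _ _ HM).
  rewrite <- (halfline_int_plus _ _ _ _ HC (admissible_scal _ (/ X) _ HM)).
  apply halfline_int_ext; intros y Hy; unfold odd_fun, even_fun; field; split; nra. }
rewrite E; change ((-1) ^ S J) with (-1 * (-1) ^ J); change (X ^ S (2 * J)) with (X * X ^ (2 * J)).
assert (0 < X ^ (2 * J)) by (apply pow_lt; lra).
field; split; lra.
Qed.

(** Now the g-part is expanded, which produces the even power; the a-part is carried along and
    restores the shape of [even_fun], with a change of sign. *)
Lemma odd_rem_step (J : nat) (X : R) : 1 <= X ->
  odd_rem J X = (-1) ^ J * 2 * even_moment J / X ^ (2 * S J) + even_rem (S J) X.
Proof.
intros HX; unfold even_rem, odd_rem.
destruct (admissible_even_fun (S J)) as [C HC]; specialize (HC X HX).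
destruct (admissible_odd_fun J) as [D HD]; specialize (HD X HX).
assert (E : even_moment J = X ^ 2 * halfline_int (odd_fun J X) + halfline_int (even_fun (S J) X)).
{ unfold even_moment; rewrite <- (halfline_int_scal _ _ _ HD).
  rewrite <- (halfline_int_plus _ _ _ _ (admissible_scal _ (X ^ 2) _ HD) HC).
  apply halfline_int_ext; intros y Hy; unfold odd_fun, even_fun.
  replace (2 * S J)%nat with (2 * J + 2)%nat by lia; rewrite pow_add; field; split; nra. }
rewrite E; change ((-1) ^ S J) with (-1 * (-1) ^ J).
replace (2 * S J)%nat with (2 * J + 2)%nat by lia; rewrite pow_add.
assert (0 < X ^ (2 * J)) by (apply pow_lt; lra).
field; split; lra.
Qed.

(** Since X >= 1 and a > 0, g < a implies g < X a. *)
Lemma even_fun_neg (J : nat) (X : R) : 1 <= X -> halfline_int (even_fun J X) < 0.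
Proof.
intros HX; destruct (admissible_even_fun J) as [C HC]; specialize (HC X HX).
assert (0 < halfline_int (fun y => -1 * even_fun J X y)).
{ apply (halfline_int_pos _ _ (admissible_scal _ (-1) _ HC)).
  intros y Hy; unfold even_fun; pose proof (mass_bounds y Hy) as [[M1 M2] M3].
  pose proof (inv_sqr_bounds X y ltac:(lra) Hy); pose proof (csch_weight_pos y Hy).
  pose proof (pow_lt y (2 * J) Hy).
  replace (-1 * _) with (y ^ (2 * J) * csch_weight y * ((X * mass y - mass_gap y) * / (X ^ 2 + y ^ 2)))
    by ring.
  apply Rmult_lt_0_compat; [now apply Rmult_lt_0_compat|].
  apply Rmult_lt_0_compat; [nra | lra]. }
rewrite (halfline_int_scal _ _ _ HC) in H; lra.
Qed.

Lemma odd_fun_pos (J : nat) (X : R) : 1 <= X -> 0 < halfline_int (odd_fun J X).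
Proof.
intros HX; destruct (admissible_odd_fun J) as [C HC]; specialize (HC X HX).
apply (halfline_int_pos _ _ HC).
intros y Hy; unfold odd_fun; pose proof (mass_bounds y Hy) as [[M1 M2] M3].
pose proof (inv_sqr_bounds X y ltac:(lra) Hy); pose proof (csch_weight_pos y Hy).
pose proof (pow_lt y (2 * J) Hy).
apply Rmult_lt_0_compat; [now apply Rmult_lt_0_compat|].
apply Rmult_lt_0_compat; [|lra].
assert (0 < y ^ 2 / X) by (apply Rdiv_lt_0_compat; nra); nra.
Qed.

Lemma rem_factor_abs (J : nat) (X h : R) : 1 <= X ->
  Rabs ((-1) ^ J * (2 / X ^ (2 * J)) * h) = 2 / X ^ (2 * J) * Rabs h.
Proof.
intros HX; assert (0 < 2 / X ^ (2 * J)) by (apply Rdiv_lt_0_compat; [lra | apply pow_lt; lra]).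
rewrite !Rabs_mult, pow_1_abs, (Rabs_right (2 / X ^ (2 * J))) by lra; ring.
Qed.

Lemma even_rem_bound (J : nat) :
  exists K, forall X, 1 <= X -> Rabs (even_rem J X) <= K / X ^ S (2 * J).
Proof.
destruct (admissible_even_fun J) as [C HC]; exists (8 * C); intros X HX.
unfold even_rem; rewrite rem_factor_abs by auto.
pose proof (halfline_int_abs _ _ (HC X HX)).
assert (HP : 0 < X ^ (2 * J)) by (apply pow_lt; lra).
assert (0 < 2 / X ^ (2 * J)) by (apply Rdiv_lt_0_compat; lra).
replace (8 * C / X ^ S (2 * J)) with (2 / X ^ (2 * J) * (4 * (C / X))).
- apply Rmult_le_compat_l; lra.
- change (X ^ S (2 * J)) with (X * X ^ (2 * J)); field; split; lra.
Qed.

Lemma odd_rem_bound (J : nat) :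
  exists K, forall X, 1 <= X -> Rabs (odd_rem J X) <= K / X ^ (2 * S J).
Proof.
destruct (admissible_odd_fun J) as [C HC]; exists (8 * C); intros X HX.
unfold odd_rem; rewrite rem_factor_abs by auto.
pose proof (halfline_int_abs _ _ (HC X HX)).
assert (HP : 0 < X ^ (2 * J)) by (apply pow_lt; lra).
assert (0 < 2 / X ^ (2 * J)) by (apply Rdiv_lt_0_compat; lra).
replace (8 * C / X ^ (2 * S J)) with (2 / X ^ (2 * J) * (4 * (C / X ^ 2))).
- apply Rmult_le_compat_l; lra.
- replace (2 * S J)%nat with (2 * J + 2)%nat by lia; rewrite pow_add; field; split; lra.
Qed.

(** [l] counts the terms already split off. *)
Definition remainder (l : nat) (X : R) : R :=
  if Nat.even l then even_rem (Nat.div2 l) X else odd_rem (Nat.div2 l) X.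

(** Coefficients in powers of 1 / X = 1 / (2 N), so those in 1 / N differ by the factor 2^k. The
    predecessor appears because the power 2 J + 2 carries [even_moment J]. *)
Definition coef (k : nat) : R :=
  if Nat.even k then (-1) ^ pred (Nat.div2 k) * 2 * even_moment (pred (Nat.div2 k))
  else (-1) ^ S (Nat.div2 k) * 2 * odd_moment (Nat.div2 k).

Lemma even_double (J : nat) : Nat.even (2 * J) = true.
Proof. apply Nat.even_spec; now exists J. Qed.

Lemma even_S_double (J : nat) : Nat.even (S (2 * J)) = false.
Proof. rewrite Nat.even_succ, <- Nat.negb_even, even_double; reflexivity. Qed.

Lemma remainder_double (J : nat) (X : R) : remainder (2 * J) X = even_rem J X.
Proof. unfold remainder; now rewrite even_double, Nat.div2_double. Qed.

Lemma remainder_S_double (J : nat) (X : R) : remainder (S (2 * J)) X = odd_rem J X.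
Proof. unfold remainder; now rewrite even_S_double, Nat.div2_succ_double. Qed.

Lemma even_or_odd (l : nat) : exists J, l = (2 * J)%nat \/ l = S (2 * J).
Proof.
destruct (Nat.Even_or_Odd l) as [[J H]|[J H]]; exists J; [left | right]; lia.
Qed.

Lemma remainder_step (l : nat) (X : R) : 1 <= X ->
  remainder l X = coef (S l) / X ^ S l + remainder (S l) X.
Proof.
intros HX; destruct (even_or_odd l) as [J [->| ->]].
- rewrite remainder_double, remainder_S_double; unfold coef.
  rewrite even_S_double, Nat.div2_succ_double; now apply even_rem_step.
- replace (S (S (2 * J))) with (2 * S J)%nat by lia.
  rewrite remainder_double, remainder_S_double; unfold coef.
  rewrite even_double, Nat.div2_double; now apply odd_rem_step.
Qed.

Lemma remainder_bound (l : nat) :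
  exists K, forall X, 1 <= X -> Rabs (remainder l X) <= K / X ^ S l.
Proof.
destruct (even_or_odd l) as [J [->| ->]].
- destruct (even_rem_bound J) as [K HK]; exists K; intros X HX.
  rewrite remainder_double; auto.
- destruct (odd_rem_bound J) as [K HK]; exists K; intros X HX.
  rewrite remainder_S_double; replace (S (S (2 * J))) with (2 * S J)%nat by lia; auto.
Qed.

Lemma pow_m1_double (s : nat) : (-1) ^ (2 * s) = 1.
Proof. rewrite pow_mult; replace ((-1) ^ 2) with 1 by ring; apply pow1. Qed.

(** For p = 4 s + 1 the index J = 2 s is even and the density is positive; for p = 4 s + 2 both
    (-1)^J, with J = 2 s + 1, and the density are negative. *)
Lemma remainder_pos (s p : nat) (X : R) : 1 <= X ->
  p = (4 * s + 1)%nat \/ p = (4 * s + 2)%nat -> 0 < remainder p X.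
Proof.
intros HX [->| ->].
- replace (4 * s + 1)%nat with (S (2 * (2 * s))) by lia; rewrite remainder_S_double.
  unfold odd_rem; rewrite pow_m1_double, Rmult_1_l.
  apply Rmult_lt_0_compat; [|now apply odd_fun_pos].
  apply Rdiv_lt_0_compat; [lra | apply pow_lt; lra].
- replace (4 * s + 2)%nat with (2 * S (2 * s))%nat by lia; rewrite remainder_double.
  unfold even_rem; change ((-1) ^ S (2 * s)) with (-1 * (-1) ^ (2 * s)); rewrite pow_m1_double.
  pose proof (even_fun_neg (S (2 * s)) X HX).
  assert (0 < 2 / X ^ (2 * S (2 * s))) by (apply Rdiv_lt_0_compat; [lra | apply pow_lt; lra]).
  nra.
Qed.

(** The two remaining residues modulo 4 are those where the sign (-1)^J and the sign of the density
    disagree with each other's positivity: J = 2 m with a negative density, or J = 2 m + 1 with a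
    positive one. *)
Lemma remainder_neg (m q : nat) (X : R) : 1 <= X ->
  q = (4 * m)%nat \/ q = (4 * m + 3)%nat -> remainder q X < 0.
Proof.
intros HX [->| ->].
- replace (4 * m)%nat with (2 * (2 * m))%nat by lia; rewrite remainder_double.
  unfold even_rem; rewrite pow_m1_double.
  pose proof (even_fun_neg (2 * m) X HX).
  assert (0 < 2 / X ^ (2 * (2 * m))) by (apply Rdiv_lt_0_compat; [lra | apply pow_lt; lra]).
  nra.
- replace (4 * m + 3)%nat with (S (2 * S (2 * m))) by lia; rewrite remainder_S_double.
  unfold odd_rem; change ((-1) ^ S (2 * m)) with (-1 * (-1) ^ (2 * m)); rewrite pow_m1_double.
  pose proof (odd_fun_pos (S (2 * m)) X HX).
  assert (0 < 2 / X ^ (2 * S (2 * m))) by (apply Rdiv_lt_0_compat; [lra | apply pow_lt; lra]).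
  nra.
Qed.

Lemma sum_n_m_1_S (a : nat -> R) (l : nat) : sum_n_m a 1 (S l) = sum_n_m a 1 l + a (S l).
Proof. exact (sum_n_Sm a 1 l (le_n_S _ _ (Nat.le_0_l l))). Qed.

Lemma sum_n_m_1_0 (a : nat -> R) : sum_n_m a 1 0 = 0.
Proof. exact (sum_n_m_zero a 1 0 (Nat.lt_0_succ 0)). Qed.

Lemma total_int_expansion (l : nat) (X : R) : 1 <= X ->
  total_int X = sum_n_m (fun k => coef k / X ^ k) 1 l + remainder l X.
Proof.
intros HX; induction l as [|l IH].
- rewrite sum_n_m_1_0; change 0%nat with (2 * 0)%nat; rewrite remainder_double.
  unfold total_int, even_rem.
  rewrite (halfline_int_ext (even_fun 0 X) (total_fun X)).
  + simpl; field.
  + intros; unfold even_fun, total_fun; simpl; ring.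
- rewrite sum_n_m_1_S, IH, (remainder_step l X HX); ring.
Qed.

(** * Comparison with the Landau constants *)

Definition landau_tail (n : nat) : R :=
  PI * landau_G n - ln (16 * INR (n + 1)) - euler_gamma.

Lemma landau_partial_tail (alpha : nat -> R) (m n : nat) :
  PI * landau_G n - landau_partial alpha m n =
  landau_tail n - sum_n_m (fun k => alpha k / INR (n + 1) ^ k) 1 m.
Proof. unfold landau_partial, landau_tail; ring. Qed.

Lemma INR_add1_ge_1 (n : nat) : 1 <= INR (n + 1).
Proof. replace (n + 1)%nat with (S n) by lia; apply INR_S_ge1. Qed.

Lemma INR_add1_S (n : nat) : INR (S n + 1) = INR (n + 1) + 1.
Proof. exact (S_INR (n + 1)). Qed.

Lemma landau_G_S (n : nat) : landau_G (S n) = landau_G n + central_ratio (S n) ^ 2.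
Proof. exact (sum_n_Sm _ 0 n (Nat.le_0_l _)). Qed.

Lemma landau_tail_diff (n : nat) :
  landau_tail n - landau_tail (S n) = ln (1 + / INR (n + 1)) - PI * central_ratio (S n) ^ 2.
Proof.
unfold landau_tail; rewrite landau_G_S; pose proof (INR_add1_ge_1 n) as Hn.
rewrite INR_add1_S.
revert Hn; generalize (INR (n + 1)) as N; intros N HN.
assert (0 < / N) by (apply Rinv_0_lt_compat; lra).
replace (16 * (N + 1)) with (16 * N * (1 + / N)) by (field; lra).
rewrite (ln_mult (16 * N) (1 + / N)) by lra; ring.
Qed.

(** The expansion of order 0; it is what identifies the constants ln 16 and gamma. *)
Lemma landau_tail_lim (alpha : nat -> R) : landau_expansion alpha -> is_lim_seq landau_tail 0.
Proof.
intros H; destruct (H 0%nat) as [C HC].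
apply is_lim_seq_abs_0, is_lim_seq_le_le_loc with (fun _ => 0) (fun n => C * / INR (S n)).
- revert HC; apply filter_imp; intros n Hn; split; [apply Rabs_pos|].
  rewrite landau_partial_tail, sum_n_m_1_0, Rminus_0_r in Hn.
  replace (INR (n + 1) ^ (0 + 1)) with (INR (S n)) in Hn
    by (replace (n + 1)%nat with (S n) by lia; simpl Nat.add; rewrite pow_1; reflexivity).
  exact Hn.
- apply is_lim_seq_const.
- replace (Finite 0) with (Rbar_mult C 0) by (simpl; f_equal; ring).
  apply is_lim_seq_scal_l, is_lim_seq_inv_S.
Qed.

Lemma is_lim_seq_inv_pow_bound (u : nat -> R) (K : R) :
  eventually (fun n => Rabs (u n) <= K / INR (n + 1)) -> is_lim_seq u 0.
Proof.
intros H; apply is_lim_seq_abs_0, is_lim_seq_le_le_loc with (fun _ => 0) (fun n => K * / INR (S n)).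
- revert H; apply filter_imp; intros n Hn; split; [apply Rabs_pos|].
  replace (S n) with (n + 1)%nat by lia; exact Hn.
- apply is_lim_seq_const.
- replace (Finite 0) with (Rbar_mult K 0) by (simpl; f_equal; ring).
  apply is_lim_seq_scal_l, is_lim_seq_inv_S.
Qed.

Definition level (n : nat) : R := 2 * INR (n + 1).

Lemma level_ge_1 (n : nat) : 1 <= level n.
Proof. unfold level; pose proof (INR_add1_ge_1 n); lra. Qed.

Lemma total_int_level_lim : is_lim_seq (fun n => total_int (level n)) 0.
Proof.
destruct (remainder_bound 0) as [K HK].
apply (is_lim_seq_inv_pow_bound _ (K / 2)).
exists 0%nat; intros n _; pose proof (level_ge_1 n) as Hl; pose proof (INR_add1_ge_1 n).
rewrite (total_int_expansion 0 _ Hl), sum_n_m_1_0, Rplus_0_l.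
apply Rle_trans with (1 := HK _ Hl); unfold level; simpl pow; apply Req_le; field; lra.
Qed.

Lemma total_int_level_diff (n : nat) :
  total_int (level n) - total_int (level (S n)) =
  log_coef * ln (1 + / INR (n + 1)) - kern_sum 1 * central_ratio (S n) ^ 2.
Proof.
pose proof (level_ge_1 n); pose proof (INR_add1_ge_1 n).
replace (level (S n)) with (level n + 2)
  by (unfold level; rewrite INR_add1_S; ring).
rewrite total_int_diff by lra.
(* With N = n + 1 and X = 2 N, the argument X + 1 of the kernel is the odd number [node N], and 2 /
   X is 1 / N. *)
replace (level n + 1) with (node (S n))
  by (unfold level, node; rewrite Nat.add_1_r; ring).
rewrite kern_sum_node; do 3 f_equal; unfold level; field; lra.
Qed.

Lemma ln_level_unbounded (l : R) : ~ is_lim_seq (fun n => ln (16 * INR (n + 1))) l.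
Proof.
intros H.
assert (H' : is_lim_seq (fun n => ln (16 * INR (n + 1))) p_infty).
{ apply (filterlim_comp _ _ _ (fun n => 16 * INR (n + 1)) ln _ (Rbar_locally p_infty));
    [|exact is_lim_ln_p].
  change (is_lim_seq (fun n => 16 * INR (n + 1)) p_infty).
  replace p_infty with (Rbar_mult 16 p_infty).
  - apply is_lim_seq_scal_l, (is_lim_seq_incr_n INR 1), is_lim_seq_INR.
  - simpl; destruct (Rle_dec 0 16) as [h|h]; [|lra].
    destruct (Rle_lt_or_eq_dec 0 16 h); [reflexivity | lra]. }
apply is_lim_seq_unique in H; apply is_lim_seq_unique in H'; rewrite H in H'; discriminate.
Qed.

(* The two sequences have proportional logarithmic increments up to a multiple of
   the increments of [landau_G]; as [landau_G] diverges, this multiple is 0. *)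
Lemma total_int_landau_tail (alpha : nat -> R) (n : nat) : landau_expansion alpha ->
  total_int (level n) = log_coef * landau_tail n.
Proof.
intros Ha.
set (kappa := log_coef * PI - kern_sum 1).
set (d := fun n => total_int (level n) - log_coef * landau_tail n).
assert (Hd : is_lim_seq d 0).
{ replace (Finite 0) with (Finite (0 - log_coef * 0)) by (f_equal; ring).
  apply is_lim_seq_minus'; [apply total_int_level_lim|].
  apply (is_lim_seq_scal_l _ log_coef 0); now apply landau_tail_lim with alpha. }
assert (Hstep : forall n, d n + kappa * landau_G n = d 0%nat + kappa * landau_G 0).
{ intros k; induction k as [|k IH]; auto.
  rewrite <- IH, landau_G_S.
  pose proof (total_int_level_diff k); pose proof (landau_tail_diff k).
  unfold d, kappa; set (w := central_ratio (S k) ^ 2) in *.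
  assert (total_int (level (S k)) = total_int (level k)
    - (log_coef * ln (1 + / INR (k + 1)) - kern_sum 1 * w)) by lra.
  assert (landau_tail (S k) = landau_tail k - (ln (1 + / INR (k + 1)) - PI * w)) by lra.
  rewrite H1, H2; ring. }
assert (Hk : kappa = 0).
{ destruct (Req_dec kappa 0) as [|Hk]; auto; exfalso.
  (* For nonzero [kappa] the invariant expresses [landau_G] through the convergent [d]. Then ln(16
     N), which is PI times [landau_G] minus the tail and gamma, would converge. *)
  set (c := d 0%nat + kappa * landau_G 0) in *.
  apply (ln_level_unbounded (PI * ((c - 0) / kappa) - 0 - euler_gamma)).
  apply is_lim_seq_ext with (fun n => PI * ((c - d n) / kappa) - landau_tail n - euler_gamma).
  - intros k; replace ((c - d k) / kappa) with (landau_G k).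
    + unfold landau_tail; ring.
    + rewrite <- (Hstep k); field; auto.
  - apply is_lim_seq_minus'; [|apply is_lim_seq_const].
    apply is_lim_seq_minus'; [|now apply landau_tail_lim with alpha].
    apply (is_lim_seq_scal_l _ PI ((c - 0) / kappa)).
    apply (is_lim_seq_scal_r _ (/ kappa) (c - 0)).
    apply is_lim_seq_minus'; [apply is_lim_seq_const | auto]. }
assert (Hc : forall k, d k = d 0%nat).
{ intros k; pose proof (Hstep k); rewrite Hk in *; lra. }
assert (Hd' : is_lim_seq d (d n)).
{ apply is_lim_seq_ext with (fun _ => d n); [|apply is_lim_seq_const].
  intros k; now rewrite (Hc k), (Hc n). }
apply is_lim_seq_unique in Hd; apply is_lim_seq_unique in Hd'; rewrite Hd in Hd'.
injection Hd' as Hd'; unfold d in Hd'; lra.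
Qed.

Lemma coef_level (k n : nat) : coef k / level n ^ k = coef k / 2 ^ k / INR (n + 1) ^ k.
Proof.
unfold level; rewrite Rpow_mult_distr; pose proof (INR_add1_ge_1 n).
field; split; apply pow_nonzero; lra.
Qed.

Lemma remainder_landau (alpha : nat -> R) (l n : nat) : landau_expansion alpha ->
  (forall k, (1 <= k <= l)%nat -> log_coef * alpha k = coef k / 2 ^ k) ->
  remainder l (level n) = log_coef * (PI * landau_G n - landau_partial alpha l n).
Proof.
intros Ha Hl; rewrite landau_partial_tail, Rmult_minus_distr_l.
rewrite <- (total_int_landau_tail alpha n Ha), (total_int_expansion l _ (level_ge_1 n)).
assert (E : sum_n_m (fun k => coef k / level n ^ k) 1 l =
  log_coef * sum_n_m (fun k => alpha k / INR (n + 1) ^ k) 1 l); [|lra].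
rewrite <- (sum_n_m_mult_l (K := R_AbsRing)).
apply sum_n_m_ext_loc; intros k Hk; rewrite coef_level, <- Hl by auto.
unfold mult; simpl; unfold Rdiv; ring.
Qed.

(** Uniqueness of asymptotic coefficients. If the coefficients up to l agree, comparing both
    expansions at order l + 1 leaves [delta] / N^(l + 1) = O(N^(-l-2)), so the constant [delta] is
    0. *)
Lemma alpha_coef (alpha : nat -> R) (l : nat) : landau_expansion alpha ->
  forall k, (1 <= k <= l)%nat -> log_coef * alpha k = coef k / 2 ^ k.
Proof.
intros Ha; induction l as [|l IH]; [intros; lia|].
intros k Hk; destruct (Nat.eq_dec k (S l)) as [->|]; [|apply IH; lia].
destruct (Ha (S l)) as [C HC]; destruct (remainder_bound (S l)) as [K HK].
set (delta := coef (S l) / 2 ^ S l - log_coef * alpha (S l)).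
assert (L : is_lim_seq (fun _ => delta) 0).
{ apply (is_lim_seq_inv_pow_bound _ (log_coef * C + Rabs K)).
  revert HC; apply filter_imp; intros n Hn.
  pose proof (remainder_landau alpha l n Ha IH) as E.
  rewrite (remainder_step l _ (level_ge_1 n)), coef_level in E.
  pose proof (HK _ (level_ge_1 n)) as HKn; pose proof (INR_add1_ge_1 n) as HN.
  assert (E2 : landau_partial alpha (S l) n = landau_partial alpha l n + alpha (S l) / INR (n + 1) ^ S l)
    by (unfold landau_partial; rewrite sum_n_m_1_S; ring).
  rewrite E2 in Hn.
  assert (HP : 0 < INR (n + 1) ^ S l) by (apply pow_lt; lra).
  assert (Ed : delta / INR (n + 1) ^ S l =
    log_coef * (PI * landau_G n - (landau_partial alpha l n + alpha (S l) / INR (n + 1) ^ S l))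
    - remainder (S l) (level n)) by (unfold delta, Rdiv in *; lra).
  assert (HKn' : Rabs (remainder (S l) (level n)) <= Rabs K * / INR (n + 1) ^ (S l + 1)).
  { apply Rle_trans with (1 := HKn); apply Rle_trans with (Rabs K / level n ^ S (S l)).
    - apply Rmult_le_compat_r; [|apply Rle_abs].
      apply Rlt_le, Rinv_0_lt_compat, pow_lt; pose proof (level_ge_1 n); lra.
    - apply Rmult_le_compat_l; [apply Rabs_pos|].
      replace (S l + 1)%nat with (S (S l)) by lia.
      apply Rinv_le_contravar; [apply pow_lt; lra|].
      apply pow_incr; unfold level; lra. }
  assert (B : Rabs (delta / INR (n + 1) ^ S l) <= (log_coef * C + Rabs K) * / INR (n + 1) ^ (S l + 1)).
  { rewrite Ed; apply Rle_trans with (1 := Rabs_triang _ _).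
    rewrite Rabs_Ropp, Rabs_mult, (Rabs_right log_coef) by (pose proof log_coef_pos; lra).
    rewrite Rmult_plus_distr_r, Rmult_assoc.
    apply Rplus_le_compat; auto.
    apply Rmult_le_compat_l; [pose proof log_coef_pos; lra | exact Hn]. }
  replace delta with (delta / INR (n + 1) ^ S l * INR (n + 1) ^ S l) by (field; lra).
  rewrite Rabs_mult, (Rabs_right (INR (n + 1) ^ S l)) by lra.
  apply Rle_trans with ((log_coef * C + Rabs K) * / INR (n + 1) ^ (S l + 1) * INR (n + 1) ^ S l).
  - apply Rmult_le_compat_r; lra.
  - apply Req_le; rewrite pow_add, pow_1; field; lra. }
assert (L' := is_lim_seq_const delta).
apply is_lim_seq_unique in L; apply is_lim_seq_unique in L'; rewrite L in L'.
injection L' as L'; unfold delta in L'; lra.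
Qed.

Theorem corollary1 (alpha : nat -> R) (Halpha : landau_expansion alpha)
  (n p q : nat)
  (Hp : exists s : nat, p = (4 * s + 1)%nat \/ p = (4 * s + 2)%nat)
  (Hq : exists m : nat, q = (4 * m)%nat \/ q = (4 * m + 3)%nat) :
  landau_partial alpha p n < PI * landau_G n < landau_partial alpha q n.
Proof.
destruct Hp as [s Hp]; destruct Hq as [m Hq]; pose proof log_coef_pos as HC.
pose proof (remainder_pos s p (level n) (level_ge_1 n) Hp) as H1.
pose proof (remainder_neg m q (level n) (level_ge_1 n) Hq) as H2.
rewrite (remainder_landau alpha p n Halpha (alpha_coef alpha p Halpha)) in H1.
rewrite (remainder_landau alpha q n Halpha (alpha_coef alpha q Halpha)) in H2.
split; nra.
Qed.
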